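(* Let $(X,d,m)$ be a metric measure space satisfying the volume doubling property $\mathrm{VD}$, and let $\phi:[0,\infty)\to[0,\infty)$ be a scale function. Let $(\mathcal{E},\mathcal{F})$ be a regular pure jump Dirichlet form on $L^2(X,m)$ that satisfies the two-sided jump kernel bounds $\mathrm{J}(\phi)$ and the capacity upper bound $\mathrm{Cap}(\phi)_{\le}$. Then $(\mathcal{E},\mathcal{F})$ satisfies the cutoff Sobolev inequality $\mathrm{CSJ}(\phi)$.
   Context: Metric measure space: $(X,d)$ is a complete, locally compact, separable metric space with at least two points, and $m$ is a positive Radon measure on $X$ with full support. $B(x,r)=\{y\in X: d(x,y)<r\}$, $V(x,r)=m(B(x,r))$, $\operatorname{diam}(X,d)\in(0,\infty]$. $\mathrm{VD}$: there is $C_D>1$ with $V(x,2r)\le C_D V(x,r)$ for all $x\in X$, $r\in(0,\infty)$. Scale function: a homeomorphism $\phi:[0,\infty)\to[0,\infty)$ for which there are $C_\phi\ge 1$ and $\beta_2\ge\beta_1>0$ with $C_\phi^{-1}(R/r)^{\beta_1}\le \phi(R)/\phi(r)\le C_\phi (R/r)^{\beta_2}$ for all $0<r\le R$. Regular pure jump Dirichlet form: $(\mathcal{E},\mathcal{F})$ is a symmetric Dirichlet form on $L^2(X,m)$ ($\mathcal F$ dense in $L^2(X,m)$, $\mathcal E$ symmetric, non-negative definite, bilinear, closed and Markovian) such that $\mathcal{F}\cap C_c(X)$ is dense both in $\mathcal{F}$ for the norm $(\mathcal{E}(f,f)+\|f\|_{L^2(X,m)}^2)^{1/2}$ and in $C_c(X)$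 for the supremum norm; and there is a symmetric positive Radon measure $J$ on $X\times X\setminus\mathrm{diag}$, where $\mathrm{diag}=\{(x,x):x\in X\}$, with $\mathcal{E}(f,f)=\int_{X\times X\setminus\mathrm{diag}}(f(x)-f(y))^2\,J(dx,dy)$ for all $f\in\mathcal{F}$. It is assumed throughout that $J(dx,dy)=J(x,y)\,m(dx)\,m(dy)$ for a non-negative symmetric measurable function $J:X\times X\to[0,\infty)$ (same symbol for measure and density). $\mathrm{J}(\phi)$: there are constants $c,C>0$ such that the (symmetric) density $J(x,y)$ satisfies, for all $x\ne y$ in $X$, $\frac{c}{V(x,d(x,y))\,\phi(d(x,y))}\le J(x,y)\le \frac{C}{V(x,d(x,y))\,\phi(d(x,y))}$. Cutoff function: for open sets $U\subset\overline{U}\subset V$, a cutoff function for $U\subset V$ is a bounded measurable function $\psi$ with $0\le\psi\le1$ on $X$, $\psi\equiv1$ on $U$ and $\psi\equiv0$ on $V^c$. $\mathrm{Cap}(\phi)_{\le}$: there are constants $A_1,A_2,C_1\in(1,\infty)$ such that for all $x\in X$ and $0<r<\operatorname{diam}(X,d)/A_2$ there is a cutoff function $\psi\in\mathcal F$ for $B(x,r)\subset B(x,A_1r)$ with $\mathcal{E}(\psi,\psi)\le C_1V(x,r)/\phi(r)$. Energy measure: for $f\in\mathcal F$, $\Gamma(f,f)(A)=\int_A\int_X (f(x)-f(y))^2J(x,y)\,m(dy)\,m(dx)$ for measurable $A\subset X$. $\mathrm{CSJ}(\phi)$: there are constants $a_0\in(0,1]$ and $C_1,C_2\in(0,\infty)$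 such that for all $0<r\le R$, $x\in X$ and $f\in\mathcal{F}$, there is a cutoff function $\psi\in\mathcal{F}$ for $B(x,R)\subset B(x,R+r)$ such that $$\int_{B(x,R+(1+a_0)r)} f^2\,d\Gamma(\psi,\psi)\le C_1\int_{U\times U^*}(f(x')-f(y'))^2\,J(dx',dy')+\frac{C_2}{\phi(r)}\int_{B(x,R+(1+a_0)r)} f^2\,dm,$$ where $U=B(x,R+r)\setminus B(x,R)$ and $U^*=B(x,R+(1+a_0)r)\setminus B(x,R-a_0r)$. *)

(* Defs.v *)
From HB Require Import structures.
From mathcomp Require Import all_boot all_order all_algebra.
From mathcomp Require Import all_classical all_reals all_analysis.

Set Implicit Arguments.
Unset Strict Implicit.
Unset Printing Implicit Defensive.

Import Order.TTheory GRing.Theory Num.Theory.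
Import numFieldNormedType.Exports.

Local Open Scope classical_set_scope.
Local Open Scope ring_scope.

(* The library's [completeType] is pointed; this is harmless here because the
   spaces considered are nonempty, and [g_sigma_algebraType] requires it. *)
#[short(type="completeMetricType")]
HB.structure Definition CompleteMetric (R : numDomainType) :=
  {T of Metric R T & Complete T}.

Notation borel X := (g_sigma_algebraType (@open X)).

Definition separable (T : topologicalType) : Prop :=
  exists2 D : set T, countable D & dense D.

(* A Borel measure that is finite on the compact subsets of D. For D open in a
   locally compact separable metric space this is a Radon measure on D, since
   inner and outer regularity are then automatic. *)
Definition radon_on (R : realType) (T : topologicalType) (D : set T)
    (mu : set T -> \bar R) : Prop :=
  forall K : set T, compact K -> K `<=` D -> (mu K < +oo)%E.

Section MetricMeasureSpace.
Context (R : realType) (X : completeMetricType R).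
Variable m : {measure set (borel X) -> \bar R}.

Definition metric_measure_space : Prop :=
  [/\ locally_compact [set: X],
      separable X,
      exists x y : X, x <> y,
      radon_on [set: X] m
    & forall U : set X, open U -> U !=set0 -> (0 < m U)%E].

Definition vol (x : X) (r : R) : \bar R := m (ball x r).

Definition diam : \bar R :=
  ereal_sup [set (mdist z.1 z.2)%:E | z in [set: X * X]].

Definition VD : Prop :=
  exists2 CD : R, 1 < CD &
    forall (x : X) (r : R), 0 < r -> (vol x (2 * r) <= CD%:E * vol x r)%E.

End MetricMeasureSpace.

Definition homeomorphism_on (T U : topologicalType) (A : set T) (B : set U)
    (f : T -> U) : Prop :=
  exists g : U -> T,
    [/\ set_fun A B f, set_fun B A g,
        {in A, cancel f g}, {in B, cancel g f}
      & {within A, continuous f} /\ {within B, continuous g}].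

(* phi : [0, oo) -> [0, oo) is represented by a total function on R, whose
   values on negative numbers are irrelevant. *)
Definition scale_function (R : realType) (phi : R -> R) : Prop :=
  homeomorphism_on (`[0, +oo[ : set R) (`[0, +oo[ : set R) phi /\
  exists Cphi beta1 beta2 : R,
    [/\ 1 <= Cphi, 0 < beta1, beta1 <= beta2 &
      forall r s : R, 0 < r -> r <= s ->
        Cphi^-1 * (s / r) `^ beta1 <= phi s / phi r
        /\ phi s / phi r <= Cphi * (s / r) `^ beta2].

Definition compactly_supported_continuous (R : realType) (T : topologicalType)
    (f : T -> R) : Prop :=
  continuous f /\ compact (closure [set x | f x != 0]).

(* Elements of L^2(X, m) are represented by square-integrable Borel functions,
   so a domain F is a set of such functions closed under a.e. equality, and the
   form E does not distinguish a.e. equal functions. Only the values of E on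
   F x F are meaningful. *)
Section DirichletForm.
Context (R : realType) (X : completeMetricType R).
Variable m : {measure set (borel X) -> \bar R}.
Variables (F : set (X -> R)) (E : (X -> R) -> (X -> R) -> R).

Definition L2norm (f : X -> R) : R :=
  fine ('N[m]_2%:E [EFin \o (f : borel X -> R)])%E.

Definition form_norm (f : X -> R) : R := Num.sqrt (E f f + L2norm f ^+ 2).

Definition L2_domain : Prop :=
  [/\ forall f, F f -> (f : borel X -> R) \in Lfun m 2%:E,
      forall f g, F f -> measurable_fun [set: borel X] g ->
        (f : borel X -> R) = g %[ae m] -> F g,
      F (cst 0),
      forall (a : R) f g, F f -> F g -> F (fun x => a * f x + g x)
    & forall (f : borel X -> R) (e : R), f \in Lfun m 2%:E -> 0 < e ->
        exists2 g, F g & L2norm (f \- g) < e].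

Definition symmetric_nonneg_form : Prop :=
  [/\ forall f g h, F f -> F g -> F h ->
        (f : borel X -> R) = g %[ae m] -> E f h = E g h,
      forall (a : R) f g h, F f -> F g -> F h ->
        E (fun x => a * f x + g x) h = a * E f h + E g h,
      forall f g, F f -> F g -> E f g = E g f
    & forall f, F f -> 0 <= E f f].

Definition closed_form : Prop :=
  forall u : nat -> X -> R, (forall n, F (u n)) ->
    (forall e : R, 0 < e -> exists N : nat, forall n k : nat,
       (N <= n)%N -> (N <= k)%N -> form_norm (u n \- u k) < e) ->
    exists2 f, F f & form_norm (u n \- f) @[n --> \oo] --> (0 : R).

Definition markovian : Prop :=
  forall f, F f ->
    let f1 := fun x => Num.min (Num.max (f x) 0) 1 in
    F f1 /\ E f1 f1 <= E f f.

Definition dirichlet_form : Prop :=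
  [/\ L2_domain, symmetric_nonneg_form, closed_form & markovian].

Definition regular_form : Prop :=
  (forall f (e : R), F f -> 0 < e ->
     exists g, [/\ F g, compactly_supported_continuous g
                 & form_norm (f \- g) < e]) /\
  (forall f (e : R), compactly_supported_continuous f -> 0 < e ->
     exists g, [/\ F g, compactly_supported_continuous g
                 & forall x, `|f x - g x| < e]).

End DirichletForm.

Definition cutoff (R : realType) (X : completeMetricType R) (U V : set X)
    (psi : X -> R) : Prop :=
  [/\ measurable_fun [set: borel X] (psi : borel X -> R),
      forall x, 0 <= psi x <= 1,
      forall x, U x -> psi x = 1
    & forall x, ~ V x -> psi x = 0].

Section JumpForm.
Context (R : realType) (X : completeMetricType R).
Variable m : {measure set (borel X) -> \bar R}.
Variables (F : set (X -> R)) (E : (X -> R) -> (X -> R) -> R).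
Variable J : X -> X -> R.

Definition offdiag : set (X * X) := [set z | z.1 <> z.2].

(* J(dx, dy) = J(x, y) m(dx) m(dy), carried by the complement of the diagonal.
   The library's integrals are defined for arbitrary set functions, so the
   measure structure need not be packaged in order to integrate. *)
Definition jump_measure (A : set (borel X * borel X)) : \bar R :=
  (\int[m \x m]_(z in A `&` offdiag) (J z.1 z.2)%:E)%E.

Definition jump_energy (f : X -> R) (A : set (borel X * borel X)) : \bar R :=
  (\int[jump_measure]_(z in A) ((f z.1 - f z.2) ^+ 2)%:E)%E.

Definition jump_kernel : Prop :=
  [/\ forall x y, 0 <= J x y,
      forall x y, J x y = J y x,
      measurable_fun [set: borel X * borel X]
        (fun z : borel X * borel X => J z.1 z.2)
    & radon_on offdiag jump_measure].

Definition regular_pure_jump_dirichlet_form : Prop :=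
  [/\ dirichlet_form m F E, regular_form m F E, jump_kernel
    & forall f, F f -> (E f f)%:E = jump_energy f offdiag].

Definition energy_measure (f : X -> R) (A : set (borel X)) : \bar R :=
  (\int[m]_(x in A) \int[m]_y ((f x - f y) ^+ 2 * J x y)%:E)%E.

Variable phi : R -> R.

Definition J_phi : Prop :=
  exists c C : R, [/\ 0 < c, 0 < C & forall x y : X, x <> y ->
    let d := mdist x y in
    (c%:E / (vol m x d * (phi d)%:E) <= (J x y)%:E
       <= C%:E / (vol m x d * (phi d)%:E))%E].

Definition Cap_phi_le : Prop :=
  exists A1 A2 C1 : R, [/\ 1 < A1, 1 < A2, 1 < C1 &
    forall (x : X) (r : R), 0 < r -> (r%:E < diam X / A2%:E)%E ->
      exists psi, [/\ F psi, cutoff (ball x r) (ball x (A1 * r)) psi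
        & ((E psi psi)%:E <= C1%:E * vol m x r / (phi r)%:E)%E]].

Definition CSJ : Prop :=
  exists a0 C1 C2 : R, [/\ 0 < a0, a0 <= 1, 0 < C1, 0 < C2 &
    forall (r s : R) (x : X) (f : X -> R), 0 < r -> r <= s -> F f ->
      let B := ball x (s + (1 + a0) * r) in
      let U := ball x (s + r) `\` ball x s in
      let U' := ball x (s + (1 + a0) * r) `\` ball x (s - a0 * r) in
      exists psi, [/\ F psi, cutoff (ball x s) (ball x (s + r)) psi
        & (\int[energy_measure psi]_(y in B) (f y ^+ 2)%:E
            <= C1%:E * jump_energy f (U `*` U')
               + (C2 / phi r)%:E * \int[m]_(y in B) (f y ^+ 2)%:E)%E]].

End JumpForm.

(* Main.v *)
(* The cutoff function is allowed to depend on f. Write d for the distance to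
   the centre, let h = |f| + eps, and let u equal h on the collar
   s <= d < s + r/2 and 0 elsewhere. Smoothing u with a Whitney-type partition of
   unity made of capacity cutoffs, at a scale that vanishes exactly on the shell
   s + r/8 <= d <= s + r/4 and is otherwise comparable to the distance to it (up
   to r), yields g with g = h on the shell, g = 0 for d >= s + 5r/8, and energy
   at most C (energy of f near the collar + phi(r)^-1 |f|_2^2). Put psi = 1 up to
   the shell and psi = min(1, g/h) beyond it. Since h psi = min(h, g) there,
   h(x)^2 (psi x - psi y)^2 <= 2 (g x - g y)^2 + 4 (f x - f y)^2 for nearby
   points, while distant points are handled by the tail of the jump kernel.
   Finally psi belongs to F because every function with bounded support and
   finite energy does: its smoothings at a constant scale tending to 0 are finite
   combinations of cutoffs, have bounded energy, and converge to it in L^2. *)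
From HB Require Import structures.
Require Import Defs.
From mathcomp Require Import all_boot all_order all_algebra.
From mathcomp Require Import all_classical all_reals all_analysis.
From mathcomp Require Import measurable_realfun ring lra.

Set Implicit Arguments.
Unset Strict Implicit.
Unset Printing Implicit Defensive.

Import Order.TTheory GRing.Theory Num.Theory.
Import numFieldNormedType.Exports.

Local Open Scope classical_set_scope.
Local Open Scope ring_scope.

Import HBNNSimple.

(** The obstacle is that f^2 cannot be paired directly with the energy measure of a capacity cutoff:
    cutting |f| off by multiplication would reproduce the very term that CSJ bounds. Smoothing
    avoids this, because it replaces f by a constant on each Whitney ball, so the energy of a cutoff
    is only ever multiplied by squared differences of ball means. Those are paid for by the lower
    bound on J: on a ball of radius t the density is at least a multiple of 1/(V phi(t)), so the
    jump energy controls oscillation with no Poincare inequality assumed. The scale vanishes on a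
    shell of positive thickness, where g = h, so that no jump appears where the two formulas for psi
    meet. The number eps keeps h positive; its cost eps^2 V(o, s + 2r) is finally made equal to the
    integral of f^2 over the ball, a zero integral being treated apart. Capacity cutoffs exist only
    at radii below a multiple of the diameter; when r exceeds the diameter the constant 1 serves. *)

(** * Measures given by a density *)

Section Density.
Context d (T : measurableType d) (R : realType).
Variables (mu : {measure set T -> \bar R}) (w : T -> \bar R).
Hypotheses (mw : measurable_fun [set: T] w) (w0 : forall x, (0 <= w x)%E).
Local Open Scope ereal_scope.

Definition density (A : set T) : \bar R := \int[mu]_(x in A) w x.

Let density0 : density set0 = 0.
Proof. by rewrite /density integral_set0. Qed.

Let density_ge0 A : 0 <= density A.
Proof. by apply: integral_ge0 => x _; exact: w0. Qed.

Let density_sigma_additive : semi_sigma_additive density.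
Proof.
move=> A mA tA mUA; rewrite /density ge0_integral_bigcup//; last first.
  exact: measurable_funTS.
by apply: is_cvg_nneseries => n _ _; exact: density_ge0.
Qed.

HB.instance Definition _ := isMeasure.Build _ _ _ density
  density0 density_ge0 density_sigma_additive.

(** Both sides are limits along the same simple functions increasing to [f], so monotone convergence
    reduces the identity to level sets, where it is the definition of the density. It serves to
    unfold integrals against the jump measure and the energy measure. *)
Lemma ge0_integral_density (A : set T) (f : T -> \bar R) :
  measurable A -> measurable_fun A f -> (forall x, 0 <= f x) ->
  \int[density]_(x in A) f x = \int[mu]_(x in A) (f x * w x).
Proof.
move=> mA mf f0; pose h := nnsfun_approx mA mf.
have cvh x : A x -> (h n x)%:E @[n --> \oo] --> f x.
  by move=> Ax; apply: cvg_nnsfun_approx => // y _; exact: f0.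
have ndh x : {homo (fun n => h n x) : n m / (n <= m)%N >-> (n <= m)%R}.
  by move=> n m nm; exact/lefP/nd_nnsfun_approx.
have mh n : measurable_fun A (fun x => (h n x)%:E).
  by apply/measurable_EFinP; exact: measurable_funTS.
have -> : \int[density]_(x in A) f x =
    lim (\int[density]_(x in A) (h n x)%:E @[n --> \oo]).
  rewrite -monotone_convergence//.
  - by apply: eq_integral => x /[!inE] Ax; apply/esym/cvg_lim => //; exact: cvh.
  - by move=> n x Ax; rewrite lee_fin.
  - by move=> x Ax n m nm; rewrite lee_fin; exact: ndh.
have -> : \int[mu]_(x in A) (f x * w x) =
    lim (\int[mu]_(x in A) ((h n x)%:E * w x) @[n --> \oo]).
  rewrite -monotone_convergence//.
  - apply: eq_integral => x /[!inE] Ax; apply/esym/cvg_lim => //.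
    (* The product of the limits may be 0 times infinity; if [w x] or [f x] is 0, every term of the
       sequence is already 0. *)
    have [wx0|wx0] := eqVneq (w x) 0.
      by rewrite wx0 mule0; under eq_fun do rewrite mule0; exact: cvg_cst.
    have [fx0|fx0] := eqVneq (f x) 0.
      have hx0 n : (h n x)%:E = 0.
        apply/eqP; rewrite eq_le; apply/andP; split; last by rewrite lee_fin.
        rewrite -[leRHS]fx0 -(cvg_lim _ (cvh x Ax))//.
        apply: lime_ge; first by apply/cvg_ex; exists (f x); exact: cvh.
        by exists n => // k /= nk; rewrite lee_fin; exact: ndh.
      by rewrite fx0 mul0e; under eq_fun do rewrite hx0 mul0e; exact: cvg_cst.
    apply: cvgeM; [|exact: cvh|exact: cvg_cst].
    by rewrite mule_defE (negbTE wx0) (negbTE fx0).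
  - by move=> n; apply: emeasurable_funM => //; exact: measurable_funTS.
  - by move=> n x Ax; rewrite mule_ge0// lee_fin.
  - by move=> x Ax n m nm; rewrite lee_wpmul2r// lee_fin; exact: ndh.
congr (lim (_ @ \oo)); apply/funext => n.
have indic r : measurable_fun A (fun x => (r * \1_(h n @^-1` [set r]) x)%:E).
  by apply: (measurable_comp measurableT) => //; exact: measurable_funM.
transitivity (\int[density]_(x in A)
   (\sum_(y \in range (h n)) (y * \1_(h n @^-1` [set y]) x)%:E)).
  by apply: eq_integral => t tE; rewrite /= fimfunE -fsumEFin.
rewrite ge0_integral_fsum//; last by move=> m y Ey; exact: nnfun_muleindic_ge0.
transitivity (\int[mu]_(x in A) (\sum_(y \in range (h n))
    (y * \1_(h n @^-1` [set y]) x)%:E * w x)); last first.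
  under [RHS]eq_integral => x xE.
    rewrite fimfunE -fsumEFin// ge0_mule_fsuml; last first.
      by move=> y; exact: nnfun_muleindic_ge0.
    over.
  by [].
rewrite ge0_integral_fsum//; last 2 first.
  - by move=> y; apply: emeasurable_funM => //; exact: measurable_funTS.
  - by move=> m y Ey; rewrite mule_ge0 // nnfun_muleindic_ge0.
apply: eq_fsbigr => r rhn.
under [LHS]eq_integral do rewrite EFinM.
rewrite integralZl_indic_nnsfun => //.
under [RHS]eq_integral do rewrite EFinM -muleA.
rewrite ge0_integralZl//.
- under [in RHS]eq_integral do rewrite muleC.
  rewrite [in RHS](eq_integral (w \_ (h n @^-1` [set r]))); last first.
    by move=> x xE; rewrite epatch_indic.
  by rewrite -integral_mkcondr integral_indic//= setIC.
- apply: emeasurable_funM; first exact/measurable_EFinP.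
  exact/measurable_funTS.
- by move=> t Et; rewrite mule_ge0 ?lee_fin.
- by move: rhn; rewrite inE => -[t _ <-]; rewrite lee_fin.
Qed.

End Density.

(** * Nonnegative series and indicators *)

Lemma nneseries_le_bound (R : realType) (u : nat -> \bar R) (b : \bar R) :
  (forall i, 0 <= u i)%E -> (forall n, \sum_(0 <= i < n) u i <= b)%E ->
  (\sum_(i <oo) u i <= b)%E.
Proof.
move=> u0 ub; apply: lime_le; first exact: is_cvg_nneseries.
by near=> n; exact: ub.
Unshelve. all: by end_near. Qed.

Lemma nneseries_ge_term (R : realType) (u : nat -> \bar R) (i : nat) :
  (forall i, 0 <= u i)%E -> (u i <= \sum_(j <oo) u j)%E.
Proof.
move=> u0; apply: (@le_trans _ _ (\sum_(0 <= j < i.+1) u j)%E).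
  by rewrite big_nat_recr//= leeDr// sume_ge0.
by apply: nneseries_lim_ge.
Qed.

Lemma measurable_bool_natr d (T : measurableType d) (R : realType) (b : T -> bool) :
  measurable_fun [set: T] b -> measurable_fun [set: T] (fun x => (b x)%:R : R).
Proof.
move=> mb; rewrite (_ : (fun x => _) = fun x => if b x then 1 else 0 : R).
  by apply: measurable_fun_ifT.
by apply/funext => x; case: (b x).
Qed.

Lemma integral_bool_natr d (T : measurableType d) (R : realType)
    (mu : {measure set T -> \bar R}) (b : T -> bool) :
  measurable_fun [set: T] b ->
  (\int[mu]_x (b x)%:R%:E = mu [set x | b x])%E.
Proof.
move=> mb; rewrite -[in RHS](setIT [set x | _]) -integral_indic//.
  apply: eq_integral => x _; rewrite indicE.
    by case: (boolP (b x)) => bx; [rewrite mem_set|rewrite memNset//=; exact/negP].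
by rewrite -[X in measurable X]setTI; exact: mb.
Qed.

(** * Jump kernels on a doubling space *)

Section JumpSpace.
Context d (T : measurableType d) (R : realType).
Local Notation ind b := ((b%R : bool)%:R%R : R).
Variable mu : {sigma_finite_measure set T -> \bar R}.
(* V x r is the volume of the ball, and phi_geom the lower scaling bound of phi
   along powers of 2, with q = 2^-beta1. *)
Variables (dd : T -> T -> R) (V : T -> R -> R) (CD K q : R) (phi : R -> R).
Variable J : T -> T -> R.
Hypothesis ddxx : forall x, dd x x = 0.
Hypothesis dd_sym : forall x y, dd x y = dd y x.
Hypothesis dd_tri : forall y x z, dd x z <= dd x y + dd y z.
Hypothesis dd_gt0 : forall x y, x <> y -> 0 < dd x y.
Hypothesis mdd : measurable_fun [set: T * T] (fun z => dd z.1 z.2).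
Hypothesis muV : forall x r, 0 < r -> mu [set y | dd x y < r] = (V x r)%:E.
Hypothesis V_gt0 : forall x r, 0 < r -> 0 < V x r.
Hypothesis CD_ge1 : 1 <= CD.
Hypothesis V_dbl : forall x r, 0 < r -> V x (2 * r) <= CD * V x r.
Hypothesis phi_gt0 : forall r, 0 < r -> 0 < phi r.
Hypothesis K_ge1 : 1 <= K.
Hypothesis phi_mono : forall r s, 0 < r -> r <= s -> phi r <= K * phi s.
Hypothesis phi_dbl : forall r, 0 < r -> phi (2 * r) <= K * phi r.
Hypothesis q01 : 0 < q < 1.
Hypothesis phi_geom : forall r k, 0 < r -> phi r <= K * q ^+ k * phi (2 ^+ k * r).
Hypothesis J_ge0 : forall x y, 0 <= J x y.
Hypothesis J_sym : forall x y, J x y = J y x.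
Hypothesis mJ : measurable_fun [set: T * T] (fun z => J z.1 z.2).
Hypothesis J_lower : forall x y, x <> y ->
  1 <= K * (J x y * (V x (dd x y) * phi (dd x y))).
Hypothesis J_upper : forall x y, x <> y ->
  J x y * (V x (dd x y) * phi (dd x y)) <= K.

Let CD_gt0 : 0 < CD. Proof. exact: lt_le_trans CD_ge1. Qed.
Let K_gt0 : 0 < K. Proof. exact: lt_le_trans K_ge1. Qed.

Lemma dd_ge0 x y : 0 <= dd x y.
Proof. by have := dd_tri y x x; rewrite ddxx (dd_sym y x); lra. Qed.

Lemma measurable_dd x : measurable_fun [set: T] (dd x).
Proof. exact: (measurableT_comp mdd (pair1_measurable x)). Qed.

Lemma measurable_lt_dd x r : measurable_fun [set: T] (fun y => dd x y < r).
Proof. by apply: measurable_fun_ltr => //; exact: measurable_dd. Qed.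

Lemma measurable_ddball x r : measurable [set y | dd x y < r].
Proof. by rewrite -[X in measurable X]setTI; exact: measurable_lt_dd. Qed.

Lemma V_sub x y r s : 0 < s -> dd x y + s <= r -> V y s <= V x r.
Proof.
move=> s0 xyr; have r0 : 0 < r by have := dd_ge0 x y; lra.
rewrite -lee_fin -!muV//; apply: le_measure.
- by rewrite inE; exact: measurable_ddball.
- by rewrite inE; exact: measurable_ddball.
- by move=> z /= yz; have := dd_tri y x z; lra.
Qed.

Lemma V_iter x r k : 0 < r -> V x (2 ^+ k * r) <= CD ^+ k * V x r.
Proof.
move=> r0; elim: k => [|k IH]; first by rewrite !expr0 !mul1r.
rewrite !exprS -!mulrA (le_trans (V_dbl _ _))//; first by rewrite mulr_gt0 ?exprn_gt0.
by rewrite ler_wpM2l// ltW.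
Qed.

Lemma V_cmp k x y r s : 0 < r -> 0 < s -> dd x y + s <= 2 ^+ k * r ->
  V y s <= CD ^+ k * V x r.
Proof. by move=> r0 s0 h; apply: le_trans (V_iter _ _ r0); exact: V_sub h. Qed.

Lemma phi_iter r k : 0 < r -> phi (2 ^+ k * r) <= K ^+ k * phi r.
Proof.
move=> r0; elim: k => [|k IH]; first by rewrite !expr0 !mul1r.
rewrite !exprS -!mulrA (le_trans (phi_dbl _))//; first by rewrite mulr_gt0 ?exprn_gt0.
by rewrite ler_wpM2l// ltW.
Qed.

(** The exponent counts k doublings and one more factor, because monotonicity is only assumed up to
    [K]. *)
Lemma phi_cmp k r s : 0 < r -> 0 < s -> s <= 2 ^+ k * r ->
  phi s <= K ^+ k.+1 * phi r.
Proof.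
move=> r0 s0 h; apply: (le_trans (phi_mono s0 h)).
by rewrite exprS -mulrA ler_wpM2l ?phi_iter// ltW.
Qed.

Lemma Vphi_gt0 x r s : 0 < r -> 0 < s -> 0 < V x r * phi s.
Proof. by move=> r0 s0; rewrite mulr_gt0 ?V_gt0 ?phi_gt0. Qed.

(** With d = dd x y, the ball about z of radius dd z w lies in B(x, 4d), which costs CD^2; passing
    from radius 2d to d in [phi] costs K^2, and the upper and lower kernel bounds cost one K
    each. *)
Lemma J_cmp x y z w : x <> y -> dd x y / 2 <= dd z w <= 2 * dd x y ->
  dd x z <= dd x y -> J x y <= K ^+ 4 * CD ^+ 2 * J z w.
Proof.
move=> xy /andP[h1 h2] h3; have d0 := dd_gt0 xy.
have e0 : 0 < dd z w by lra.
have zw : z <> w by move=> zw; move: e0; rewrite zw ddxx ltxx.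
have Vc : V z (dd z w) <= CD ^+ 2 * V x (dd x y).
  by apply: V_cmp => //; rewrite expr2; lra.
have pc : phi (dd z w) <= K ^+ 2 * phi (dd x y).
  by apply: phi_cmp => //; rewrite expr1.
have v0 := Vphi_gt0 x d0 d0.
rewrite -(ler_pM2r v0) (le_trans (J_upper xy))//.
rewrite -[leLHS]mulr1 (le_trans (ler_wpM2l (ltW K_gt0) (J_lower zw)))//.
have -> : K ^+ 4 * CD ^+ 2 * J z w * (V x (dd x y) * phi (dd x y)) =
  K * (K * (J z w * ((CD ^+ 2 * V x (dd x y)) * (K ^+ 2 * phi (dd x y))))) by ring.
do 2 (rewrite ler_wpM2l//; first exact: ltW).
by rewrite ler_wpM2l//; apply: ler_pM => //; exact/ltW/V_gt0 || exact/ltW/phi_gt0.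
Qed.

(** Inside a fixed ball the kernel dominates the constant weight 1/(V phi). This stands in for a
    Poincare inequality when oscillations are bounded by energy. *)
Lemma J_low k o x y r : 0 < r -> x <> y -> dd o x < 2 ^+ k * r -> dd o y < 2 ^+ k * r ->
  (V o r * phi r)^-1 <= CD ^+ k.+2 * K ^+ k.+3 * J x y.
Proof.
move=> r0 xy ox oy; have d0 := dd_gt0 xy.
have dxy : dd x y <= 2 * (2 ^+ k * r) by have := dd_tri o x y; rewrite (dd_sym x o); lra.
have Vc : V x (dd x y) <= CD ^+ k.+2 * V o r.
  by apply: V_cmp => //; rewrite !exprS; lra.
have pc : phi (dd x y) <= K ^+ k.+2 * phi r.
  by apply: phi_cmp => //; rewrite exprS -mulrA.
rewrite -[leLHS]mul1r ler_pdivrMr ?Vphi_gt0// (le_trans (J_lower xy))//.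
have -> : CD ^+ k.+2 * K ^+ k.+3 * J x y * (V o r * phi r) =
  K * (J x y * ((CD ^+ k.+2 * V o r) * (K ^+ k.+2 * phi r))) by rewrite [K ^+ k.+3]exprS; ring.
rewrite ler_wpM2l//; first exact: ltW.
by rewrite ler_wpM2l//; apply: ler_pM => //; exact/ltW/V_gt0 || exact/ltW/phi_gt0.
Qed.

(** * Tail of the jump kernel *)

Definition Ctail := K ^+ 3 * CD / (1 - q).

Lemma dyadic_index (t s : R) : 0 < t -> t <= s ->
  exists k, 2 ^+ k * t <= s < 2 ^+ k.+1 * t.
Proof.
move=> t0 ts.
have ex : exists n, s < 2 ^+ n * t.
  exists (Num.bound (s / t)); rewrite -ltr_pdivrMr//.
  apply: (lt_le_trans (archi_boundP _)); first by rewrite divr_ge0 ?(le_trans _ ts)// ltW.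
  by rewrite -natrX ler_nat ltnW// ltn_expl.
case: (ex_minnP ex) => -[|n] hn hmin; first by move: hn; rewrite expr0 mul1r; lra.
by exists n; rewrite hn andbT leNgt; apply/negP => /hmin; rewrite ltnn.
Qed.

(** The dyadic shell of radius 2^k t has mass at most CD V(x, 2^k t) and kernel at most K^2/(V phi)
    at that radius; the volumes cancel, and the lower scaling of [phi] makes the shells sum like
    q^k. *)
Lemma J_tail (x : T) (t : R) : 0 < t ->
  (\int[mu]_y (ind (t <= dd x y) * J x y)%:E <= (Ctail / phi t)%:E)%E.
Proof.
move=> t0; have [q0 q1] := andP q01.
(* One K comes from [J_upper], the other from comparing [phi] at 2^k t and at dd x y. *)
pose a k := K ^+ 2 / (V x (2 ^+ k * t) * phi (2 ^+ k * t)).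
have t2 k : 0 < 2 ^+ k * t by rewrite mulr_gt0 ?exprn_gt0.
have a0 k : 0 <= a k by rewrite divr_ge0 ?exprn_ge0 ?(ltW K_gt0)// ltW ?Vphi_gt0.
(* Whole balls replace the shells: an upper bound is enough, and [V] gives the measure of balls. *)
pose u k y := (ind (dd x y < 2 ^+ k.+1 * t) * a k)%:E.
have mu_ k : measurable_fun [set: T] (u k).
  apply/measurable_EFinP; apply: measurable_funM => //.
  by apply: measurable_bool_natr; exact: measurable_lt_dd.
have u0 k y : (0 <= u k y)%E by rewrite lee_fin mulr_ge0.
apply: (@le_trans _ _ (\int[mu]_y \sum_(k <oo) u k y)%E).
  apply: ge0_le_integral => //.
  - by move=> y _; rewrite lee_fin mulr_ge0.
  - apply/measurable_EFinP; apply: measurable_funM.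
      apply: measurable_bool_natr; apply: measurable_fun_ler => //; exact: measurable_dd.
    exact: (measurableT_comp mJ (pair1_measurable x)).
  - by apply: ge0_emeasurable_sum.
  - move=> y _; case: (boolP (t <= dd x y)) => [txy|_]; last first.
      by rewrite mul0r; apply: nneseries_ge0.
    rewrite mul1r; have [k /andP[h1 h2]] := dyadic_index t0 txy.
    apply: le_trans (nneseries_ge_term k _) => //.
    rewrite /u h2 mul1r lee_fin /a ler_pdivlMr ?Vphi_gt0//.
    have xy : x <> y by move=> xy; move: txy; rewrite xy ddxx; lra.
    have d0 := dd_gt0 xy.
    rewrite expr2 (le_trans _ (ler_wpM2l (ltW K_gt0) (J_upper xy)))//.
    rewrite [leRHS]mulrCA ler_wpM2l// [leRHS]mulrCA ler_pM ?(ltW (V_gt0 _ _)) ?(ltW (phi_gt0 _))//.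
      by apply: V_sub => //; rewrite ddxx add0r.
    exact: phi_mono.
rewrite integral_nneseries//.
have ubd k : (\int[mu]_y u k y <= (K ^+ 3 * CD / phi t * q ^+ k)%:E)%E.
  rewrite /u; under eq_integral do rewrite mulrC EFinM.
  rewrite ge0_integralZl//; last 2 first.
  - by apply/measurable_EFinP/measurable_bool_natr; exact: measurable_lt_dd.
  - by rewrite lee_fin.
  rewrite integral_bool_natr/=; last exact: measurable_lt_dd.
  rewrite muV//.
  rewrite -EFinM lee_fin /a.
  rewrite [2 ^+ k.+1]exprS -[2 * _ * t]mulrA.
  have p0 := phi_gt0 (t2 k); have v0 := V_gt0 x (t2 k); have pt := phi_gt0 t0.
  apply: (@le_trans _ _ (K ^+ 2 / (V x (2 ^+ k * t) * phi (2 ^+ k * t)) * (CD * V x (2 ^+ k * t)))).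
    by rewrite ler_wpM2l ?V_dbl//; exact: a0.
  have -> : K ^+ 2 / (V x (2 ^+ k * t) * phi (2 ^+ k * t)) * (CD * V x (2 ^+ k * t)) =
    K ^+ 2 * CD / phi (2 ^+ k * t) by field; rewrite !gt_eqF.
  have -> : K ^+ 3 * CD / phi t * q ^+ k = K ^+ 2 * CD * (K * q ^+ k / phi t) by field; rewrite gt_eqF.
  rewrite ler_wpM2l ?mulr_ge0 ?exprn_ge0 ?(ltW K_gt0) ?(ltW CD_gt0)//.
  by rewrite -[leLHS]mul1r ler_pdivrMr// mulrAC ler_pdivlMr// mul1r phi_geom.
apply: nneseries_le_bound => [k|n]; first by apply: integral_ge0.
apply: (@le_trans _ _ (\sum_(0 <= k < n) (K ^+ 3 * CD / phi t * q ^+ k)%:E)%E).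
  by apply: lee_sum.
rewrite sumEFin lee_fin.
apply: (le_trans (geometric_le_lim n _ q0 _)).
- by rewrite divr_ge0 ?mulr_ge0 ?exprn_ge0 ?(ltW K_gt0) ?(ltW CD_gt0)// ltW ?phi_gt0.
- by rewrite gtr0_norm.
- by rewrite /Ctail mulrAC.
Qed.

(** * Packing bounds for the dense sequence *)

Variable pt : nat -> T.
Hypothesis pt_dense : forall y e, 0 < e -> exists n, dd (pt n) y < e.

(** A volume count: the balls of radius e about the chosen points are disjoint, lie in B(o, r1 + e),
    and by doubling each carries at least the fraction CD^-k of its volume. *)
Lemma count_separated (P : pred nat) (o : T) (e r1 : R) (k : nat) (n : nat) :
  0 < e -> 0 < r1 -> 2 * r1 + e <= 2 ^+ k * e ->
  (forall i, P i -> dd o (pt i) < r1) ->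
  (forall i j, (i < j)%N -> P i -> P j -> 2 * e <= dd (pt i) (pt j)) ->
  \sum_(i < n | P i) 1 <= CD ^+ k.
Proof.
move=> e0 r10 hk ho hsep.
have v0 := V_gt0 o (addr_gt0 r10 e0).
rewrite -(ler_pM2r v0) mulr_suml.
apply: (@le_trans _ _ (CD ^+ k * \sum_(i < n | P i) V (pt i) e)).
  rewrite mulr_sumr; apply: ler_sum => i Pi; rewrite mul1r.
  apply: V_cmp => //; first exact: addr_gt0.
  by rewrite dd_sym; have := ho _ Pi; lra.
rewrite ler_wpM2l ?exprn_ge0 ?(ltW CD_gt0)// -lee_fin -sumEFin.
under eq_bigr do rewrite -muV//.
rewrite -measure_bigsetU_ord_cond//; last 2 first.
- by move=> i _; exact: measurable_ddball.
- have disj (i j : nat) : (i < j)%N -> P i -> P j ->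
      [set y | dd (pt i) y < e] `&` [set y | dd (pt j) y < e] !=set0 -> False.
    move=> ij Pi Pj [y [/= yi yj]]; have := hsep _ _ ij Pi Pj.
    by have := dd_tri y (pt i) (pt j); rewrite (dd_sym y); lra.
  move=> i j Pi Pj h; apply/val_inj => /=.
  case: (ltngtP i j) => // ij; first by case: (disj i j).
  by rewrite setIC in h; case: (disj j i).
rewrite -muV; last exact: addr_gt0.
apply: le_measure; rewrite ?inE.
- by apply: bigsetU_measurable => i _; exact: measurable_ddball.
- exact: measurable_ddball.
- apply: (@big_ind _ (fun A => A `<=` [set y | dd o y < r1 + e])).
  + by [].
  + by move=> A B hA hB y [/hA|/hB].
  + by move=> i Pi y /= iy; have := ho _ Pi; have := dd_tri (pt i) o y; lra.
Qed.

(** Turns a count that is bounded uniformly in n into an index beyond which nothing is counted, so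
    that the locally finite sums below become finite sums. *)
Lemma count_bounded_eventually (P : pred nat) (b : R) :
  (forall n, \sum_(i < n | P i) 1 <= b) ->
  exists n, forall i, (n <= i)%N -> ~~ P i.
Proof.
move=> hb; apply: contrapT => h.
have {}h n : exists2 i, (n <= i)%N & P i.
  by apply: contrapT => h'; apply: h; exists n => i ni; apply/negP => Pi; apply: h'; exists i.
have hk k : exists n, k%:R <= \sum_(i < n | P i) (1 : R).
  elim: k => [|k [n hn]]; first by exists 0; rewrite big_ord0.
  have [i ni Pi] := h n; exists i.+1; rewrite big_mkcond big_ord_recr/= Pi.
  rewrite -natr1 lerD2r (le_trans hn)//.
  rewrite [leLHS]big_mkcond -!(big_mkord xpredT (fun i => if P i then 1 else 0)).
  rewrite (@big_cat_nat _ _ _ n 0 i)//= lerDl sumr_ge0// => j _; by case: ifP.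
have [n hn] := hk (Num.bound `|b|).
have := archi_boundP (normr_ge0 b).
by have := hb n; have := ler_norm b; lra.
Qed.

(** * Smoothing at a variable scale *)

Section Whitney.
Variables (rho : T -> R) (l : nat) (L : R).
Hypothesis LE : L = 2 ^+ l.
Hypothesis rho_ge0 : forall x, 0 <= rho x.
Hypothesis mrho : measurable_fun [set: T] rho.
(** This slope keeps [rho] between 1/2 and 3/2 of its central value on a ball of radius L times that
    value. *)
Hypothesis rho_lip : forall x y, 2 * L * `|rho x - rho y| <= dd x y.

Lemma L_ge1 : 1 <= L. Proof. by rewrite LE exprn_ege1// ler1n. Qed.

Lemma rho_le x y : rho x <= rho y + dd x y / (2 * L).
Proof.
have L1 := L_ge1.
have := rho_lip x y; rewrite -ler_pdivlMl; last lra.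
by rewrite mulrC => h; have := ler_norm (rho x - rho y); lra.
Qed.

Lemma rho_cmp x y : dd x y < L * rho x -> rho x / 2 <= rho y <= 3 / 2 * rho x.
Proof.
move=> xy; have L1 := L_ge1.
have h : dd x y / (2 * L) <= rho x / 2.
  by rewrite ler_pdivrMr; [lra|lra].
by have := rho_le x y; have := rho_le y x; rewrite (dd_sym y x); lra.
Qed.

(** * The greedy net and its overlap *)

(** Yields a maximal separated net at the variable scale, by inspecting the dense sequence in order.
    A point is tested with its own scale against those kept before it, and points of scale 0 are
    never kept. *)
Definition greedy_ok (s : seq nat) (n : nat) : bool :=
  (0 < rho (pt n)) && all (fun j => rho (pt n) / 4 <= dd (pt j) (pt n)) s.

Fixpoint greedy (n : nat) : seq nat :=
  if n is k.+1 then (if greedy_ok (greedy k) k then k :: greedy k else greedy k)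
  else [::].

Definition sel (n : nat) : bool := greedy_ok (greedy n) n.

Lemma mem_greedy n j : (j \in greedy n) = (j < n)%N && sel j.
Proof.
elim: n => [|n IH] //=; rewrite -/(sel n) ltnS leq_eqVlt.
case: ifPn => sn; rewrite ?in_cons IH; case: eqVneq => [->|_]//=.
by rewrite (negbTE sn) andbF.
Qed.

Lemma sel_gt0 n : sel n -> 0 < rho (pt n).
Proof. by case/andP. Qed.

Lemma sel_sep i j : (i < j)%N -> sel i -> sel j -> rho (pt j) / 4 <= dd (pt i) (pt j).
Proof.
move=> ij si /andP[_ /allP h]; apply: h.
by rewrite mem_greedy ij.
Qed.

(** A point of the dense sequence close to y was either kept, or rejected because of an earlier kept
    point. The scales at these points are comparable, so the ball of the kept point contains y in
    both cases. *)
Lemma sel_cover y : 0 < rho y -> exists2 n, sel n & dd (pt n) y < rho (pt n).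
Proof.
move=> ry; have L1 := L_ge1.
have [n yn] : exists n, dd (pt n) y < rho y / 8 by apply: pt_dense; lra.
have lip x z : rho x <= rho z + dd x z / 2.
  apply: (le_trans (rho_le x z)); rewrite lerD2l ler_wpM2l ?dd_ge0//.
  by rewrite lef_pV2 ?posrE; lra.
have h1 := lip y (pt n); have h2 := lip (pt n) y.
rewrite (dd_sym y) in h1.
have pn : 0 < rho (pt n) by lra.
have [sn|] := boolP (sel n).
  by exists n => //; lra.
rewrite negb_and pn /= => /allPn[j]; rewrite mem_greedy => /andP[jn sj].
rewrite -ltNge => h; exists j => //.
have h3 := lip (pt n) (pt j); rewrite (dd_sym (pt n)) in h3.
by have := dd_tri (pt n) (pt j) y; lra.
Qed.

Definition act (i : nat) (y : T) : bool := sel i && (dd (pt i) y < L * rho (pt i)).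

Definition Cov := CD ^+ (l + 7).

Lemma act_rho i y : act i y -> rho (pt i) / 2 <= rho y <= 3 / 2 * rho (pt i).
Proof. by case/andP=> _; exact: rho_cmp. Qed.

(** Net points active at y have scales between 2/3 and 2 times [rho y], hence are separated by at
    least [rho y] / 8 and lie within 2 L [rho y] of y. Packing with balls of radius [rho y] / 16
    then gives the exponent l + 7. *)
Lemma overlap y n : \sum_(i < n | act i y) 1 <= Cov.
Proof.
have L1 := L_ge1; have [ry|ry] := eqVneq (rho y) 0.
  rewrite big_pred0 ?exprn_ge0 ?(ltW CD_gt0)// => i; apply/negP => /[dup] /act_rho h /andP[/sel_gt0].
  by move: h; rewrite ry; lra.
have {}ry : 0 < rho y by rewrite lt_neqAle eq_sym ry rho_ge0.
apply: (@count_separated (act ^~ y) y (rho y / 16) (2 * L * rho y)).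
- lra.
- by rewrite mulr_gt0//; have := L_ge1; lra.
- rewrite exprD -LE !exprS expr0; nra.
- move=> i /[dup] /act_rho /andP[h1 h2] /andP[_ h]; rewrite dd_sym (lt_le_trans h)//.
  rewrite (_ : 2 * L * rho y = L * (2 * rho y)); last by ring.
  by rewrite ler_wpM2l; lra.
- move=> i j ij /andP[si _] /[dup] /act_rho /andP[h1 h2] /andP[sj _].
  by apply: le_trans (sel_sep ij si sj); lra.
Qed.

Variables (a : nat) (A : R).
Hypothesis AE : A = 2 ^+ a.
Hypothesis A_ge1 : 1 <= A.
(** Pairs will count as near when their distance is below 16 A times the larger scale. The factor
    128 makes the L-ball of any net point whose cutoff can be nonzero at such a pair contain the
    balls of all the others. *)
Hypothesis LA : L = 128 * A.
Local Notation s i := (rho (pt i)).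
Local Notation Vi i := (V (pt i) (rho (pt i))).
Variables (eta : nat -> T -> R) (C1 : R).
Hypothesis C1_ge0 : 0 <= C1.
Definition actA (i : nat) (y : T) : bool := sel i && (dd (pt i) y < A * s i).
Hypothesis meta : forall i, measurable_fun [set: T] (eta i).
Hypothesis eta01 : forall i y, 0 <= eta i y <= 1.
Hypothesis eta1 : forall i y, sel i -> dd (pt i) y < s i -> eta i y = 1.
Hypothesis eta0 : forall i y, ~~ actA i y -> eta i y = 0.

Definition energy (f : T -> R) : \bar R :=
  (\int[mu \x mu]_z ((f z.1 - f z.2) ^+ 2 * J z.1 z.2)%:E)%E.
Hypothesis eta_energy : forall i, sel i ->
  (energy (eta i) <= (C1 * (Vi i / phi (s i)))%:E)%E.

Lemma actA_act i y : actA i y -> act i y.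
Proof.
case/andP => si h; rewrite /act si /= (lt_le_trans h)// ler_wpM2r//.
by have := A_ge1; rewrite LA; lra.
Qed.

(** * Partition of unity by running maxima *)

Fixpoint cutmax (n : nat) (y : T) : R :=
  if n is k.+1 then Num.max (cutmax k y) (eta k y) else 0.

Lemma cutmaxS n y : cutmax n.+1 y = Num.max (cutmax n y) (eta n y).
Proof. by []. Qed.

Lemma cutmax_ge0 n y : 0 <= cutmax n y.
Proof. by elim: n => [|n IH]; rewrite ?cutmaxS ?le_max ?IH. Qed.

Lemma cutmax_le1 n y : cutmax n y <= 1.
Proof.
elim: n => [|n IH] //; rewrite cutmaxS ge_max IH.
by have /andP[] := eta01 n y.
Qed.

Lemma cutmax_nd y : {homo cutmax ^~ y : m n / (m <= n)%N >-> m <= n}.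
Proof. by apply: homo_leq => [//|m n p|n]; [exact: le_trans|rewrite cutmaxS le_max lexx]. Qed.

Lemma measurable_cutmax n : measurable_fun [set: T] (cutmax n).
Proof.
by elim: n => [|n IH]; [exact: measurable_cst|exact: measurable_maxr].
Qed.

(* Increments of a running maximum: a partition of unity obtained from the
   cutoffs by lattice operations, under which the domain of the form is stable. *)
Definition theta (i : nat) (y : T) : R := cutmax i.+1 y - cutmax i y.

Lemma theta_ge0 i y : 0 <= theta i y.
Proof. by rewrite subr_ge0 cutmax_nd. Qed.

Lemma theta_le i y : theta i y <= eta i y.
Proof.
rewrite /theta cutmaxS lerBlDr; have := cutmax_ge0 i y; have /andP[h _] := eta01 i y.
by rewrite ge_max => h'; apply/andP; split; lra.
Qed.

Lemma theta_le1 i y : theta i y <= 1.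
Proof. by apply: le_trans (theta_le i y) _; have /andP[] := eta01 i y. Qed.

Lemma theta0 i y : ~~ actA i y -> theta i y = 0.
Proof.
by move=> h; apply/eqP; rewrite eq_le theta_ge0 andbT -(eta0 h) theta_le.
Qed.

Lemma measurable_theta i : measurable_fun [set: T] (theta i).
Proof. by apply: measurable_funB; exact: measurable_cutmax. Qed.

Lemma sum_theta n y : \sum_(i < n) theta i y = cutmax n y.
Proof.
elim: n => [|n IH]; first by rewrite big_ord0.
by rewrite big_ord_recr/= IH /theta addrC subrK.
Qed.

Lemma cutmax_diff n x y : `|cutmax n x - cutmax n y| <= \sum_(j < n) `|eta j x - eta j y|.
Proof.
elim: n => [|n IH]; first by rewrite big_ord0 subrr normr0.
rewrite !cutmaxS big_ord_recr /=.
set e := \sum_(_ < _) _ in IH *; set b := `|eta n x - eta n y|.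
have e0 : 0 <= e by apply: le_trans IH.
have b0 : 0 <= b by rewrite normr_ge0.
have := ler_norm (cutmax n x - cutmax n y); have := ler_norm (- (cutmax n x - cutmax n y)).
have : eta n x - eta n y <= b by exact: ler_norm.
have : - (eta n x - eta n y) <= b by rewrite /b -normrN ler_norm.
rewrite normrN => h1 h2 h3 h4.
by rewrite ler_norml !maxEle; case: ifP => h5; case: ifP => h6; apply/andP; split; lra.
Qed.

(** [theta] is a difference of two running maxima, and each of them moves by at most the total
    movement of the cutoffs. *)
Lemma theta_diff n i x y : (i < n)%N ->
  `|theta i x - theta i y| <= 2 * \sum_(j < n) `|eta j x - eta j y|.
Proof.
move=> ni.
have mono k : (k <= n)%N -> `|cutmax k x - cutmax k y| <= \sum_(j < n) `|eta j x - eta j y|.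
  move=> kn; apply: (le_trans (cutmax_diff _ _ _)).
  rewrite -!(big_mkord xpredT (fun j => `|eta j x - eta j y|)).
  by rewrite (@big_cat_nat _ _ _ k 0 n)//= lerDl sumr_ge0.
rewrite /theta (_ : _ - _ = (cutmax i.+1 x - cutmax i.+1 y) - (cutmax i x - cutmax i y)); last by ring.
apply: (le_trans (ler_normB _ _)).
by have := mono _ ni; have := mono _ (ltnW ni); lra.
Qed.

Lemma act_finite y : exists n, forall i, (n <= i)%N -> ~~ act i y.
Proof. by apply: count_bounded_eventually => n; exact: overlap. Qed.

Lemma cutmax_eq1 y : 0 < rho y -> exists n, forall m, (n <= m)%N -> cutmax m y = 1.
Proof.
move=> /sel_cover[n sn yn]; exists n.+1 => m nm; apply/eqP.
rewrite eq_le cutmax_le1 (le_trans _ (cutmax_nd y nm))// cutmaxS le_max.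
by rewrite (eta1 sn yn) lexx orbT.
Qed.

(** * The smoothing operator and its duality *)

Definition avg (i : nat) (F : T -> \bar R) : \bar R :=
  (((Vi i)^-1)%:E * \int[mu]_z ((ind (dd (pt i) z < s i))%:E * F z))%E.

(** Acts on extended-valued functions, so that locality, duality and Tonelli apply to nonnegative
    functions without integrability conditions. *)
Definition smooth (F : T -> \bar R) (y : T) : \bar R :=
  if rho y == 0 then F y else (\sum_(i <oo) ((theta i y)%:E * avg i F))%E.

Lemma avg_ge0 i F : (forall z, 0 <= F z)%E -> (0 <= avg i F)%E.
Proof.
move=> F0; have [si|si] := ltP 0 (s i).
  rewrite mule_ge0//; first by rewrite lee_fin invr_ge0 ltW ?V_gt0.
  by apply: integral_ge0 => z _; rewrite mule_ge0// lee_fin.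
(* At a nonpositive scale the sign of [V] is unknown, but the ball is empty and the integral is
   0. *)
rewrite /avg; under eq_integral => z _.
  rewrite ltNge (le_trans si) ?dd_ge0//= mul0e; over.
by rewrite integral0 mule0.
Qed.

Lemma smooth_ge0 F y : (forall z, 0 <= F z)%E -> (0 <= smooth F y)%E.
Proof.
move=> F0; rewrite /smooth; case: ifP => // _; apply: nneseries_ge0 => i _ _.
by rewrite mule_ge0 ?avg_ge0// lee_fin theta_ge0.
Qed.

Lemma measurable_ind_ball i : measurable_fun [set: T] (fun z => (ind (dd (pt i) z < s i))%:E : \bar R).
Proof. by apply/measurable_EFinP/measurable_bool_natr; exact: measurable_lt_dd. Qed.

(** Locality: a net ball that contributes at y has radius at most 2 [rho y], and its centre is
    within A times its radius of y, so only points within 4 A [rho y] of y are seen. *)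
Lemma smooth_mono F G y : (forall z, 0 <= F z)%E -> (forall z, 0 <= G z)%E ->
  measurable_fun [set: T] F -> measurable_fun [set: T] G ->
  (forall z, dd y z <= 4 * A * rho y -> (F z <= G z)%E) -> (smooth F y <= smooth G y)%E.
Proof.
move=> F0 G0 mF mG FG; rewrite /smooth; case: eqVneq => ry.
  by apply: FG; rewrite ddxx ry mulr0.
apply: lee_nneseries => i _.
  by move=> _; rewrite mule_ge0 ?avg_ge0// lee_fin theta_ge0.
have [ai|/theta0 ->] := boolP (actA i y); last by rewrite !mul0e.
rewrite lee_wpmul2l ?lee_fin ?theta_ge0//.
have si : 0 < s i by case/andP: ai => /sel_gt0.
rewrite lee_wpmul2l//; first by rewrite lee_fin invr_ge0 ltW ?V_gt0.
apply: ge0_le_integral => //.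
- by move=> z _; rewrite mule_ge0// lee_fin.
- by apply: emeasurable_funM => //; exact: measurable_ind_ball.
- by apply: emeasurable_funM => //; exact: measurable_ind_ball.
- move=> z _; case: ltP => zi; last by rewrite !mul0e.
  rewrite !mul1e; apply: FG.
  have /act_rho/andP[h1 h2] := actA_act ai; case/andP: ai => _ h3.
  have h4 := dd_tri (pt i) y z; rewrite (dd_sym y (pt i)) in h4.
  have h5 : s i <= A * s i by rewrite ler_peMl// ltW.
  have h6 : A * s i <= A * (2 * rho y) by rewrite ler_wpM2l; have := A_ge1; lra.
  by rewrite (_ : 4 * A * rho y = 2 * (A * (2 * rho y))); [lra|ring].
Qed.

Lemma smoothZ F y (k : R) : 0 <= k -> (forall z, 0 <= F z)%E -> measurable_fun [set: T] F ->
  (smooth (fun z => k%:E * F z) y = k%:E * smooth F y)%E.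
Proof.
move=> k0 F0 mF; rewrite /smooth; case: ifP => // _.
rewrite -nneseriesZl; last by move=> i _; rewrite mule_ge0 ?avg_ge0// lee_fin theta_ge0.
apply: eq_eseriesr => i _; rewrite [RHS]muleCA; congr (_ * _)%E.
rewrite /avg; under eq_integral do rewrite muleCA.
rewrite ge0_integralZl//; first by rewrite muleCA.
- by apply: emeasurable_funM => //; exact: measurable_ind_ball.
- by move=> z _; rewrite mule_ge0// lee_fin.
Qed.

Lemma smooth_scale_mono F G y (k k' : R) : 0 <= k -> 0 <= k' ->
  (forall z, 0 <= F z)%E -> (forall z, 0 <= G z)%E ->
  measurable_fun [set: T] F -> measurable_fun [set: T] G ->
  (forall z, dd y z <= 4 * A * rho y -> (k%:E * F z <= k'%:E * G z)%E) ->
  (k%:E * smooth F y <= k'%:E * smooth G y)%E.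
Proof.
move=> k0 k'0 F0 G0 mF mG FG; rewrite -(smoothZ y k0 F0 mF) -(smoothZ y k'0 G0 mG).
apply: smooth_mono FG.
- by move=> z; rewrite mule_ge0 ?lee_fin.
- by move=> z; rewrite mule_ge0 ?lee_fin.
- exact: emeasurable_funM.
- exact: emeasurable_funM.
Qed.

(** The second coordinate is carried along as a parameter so that the smoothing can be iterated in
    both variables under Tonelli. *)
Lemma measurable_smooth (G : T * T -> \bar R) : (forall z, 0 <= G z)%E ->
  measurable_fun [set: T * T] G ->
  measurable_fun [set: T * T] (fun z => smooth (fun x => G (x, z.2)) z.1).
Proof.
move=> G0 mG; rewrite /smooth; apply: measurable_fun_ifT.
- apply: (measurableT_comp (f := fun x => rho x == 0)); last exact: measurable_fst.
  apply: measurable_fun_eqr => //; exact: mrho.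
- by apply: (eq_measurable_fun G) => // -[].
- apply: ge0_emeasurable_sum => //.
    by move=> i z _ _; rewrite mule_ge0 ?avg_ge0// lee_fin theta_ge0.
  move=> i _; apply: emeasurable_funM.
    apply/measurable_EFinP; apply: measurableT_comp; last exact: measurable_fst.
    exact: measurable_theta.
  apply: (measurableT_comp (f := fun y => avg i (fun x => G (x, y)))); last exact: measurable_snd.
  apply: emeasurable_funM => //.
  apply: (@measurable_fun_fubini_tonelli_G _ _ T T R mu (fun z => (ind (dd (pt i) z.1 < s i))%:E * G z)%E).
    apply: emeasurable_funM => //.
    exact: (measurableT_comp (measurable_ind_ball i) measurable_fst).
  by move=> z; rewrite mule_ge0// lee_fin.
Qed.

Lemma measurable_smooth_fun F : (forall z, 0 <= F z)%E -> measurable_fun [set: T] F ->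
  measurable_fun [set: T] (smooth F).
Proof.
move=> F0 mF; have := @measurable_smooth (F \o fst) (fun z => F0 z.1) (measurableT_comp mF measurable_fst).
move=> /measurableT_comp /(_ (measurable_fun_pair (@measurable_id _ T setT) (@measurable_id _ T setT))).
exact.
Qed.

Definition Cdual := 1 + CD ^+ a * Cov.

Lemma sum_ind_le (F : T -> \bar R) y : (0 <= F y)%E ->
  (\sum_(i <oo) ((ind (act i y))%:E * F y) <= Cov%:E * F y)%E.
Proof.
move=> F0; apply: nneseries_le_bound => [i|n]; first by rewrite mule_ge0// lee_fin.
rewrite -ge0_sume_distrl; last by move=> i _; rewrite lee_fin.
rewrite lee_wpmul2r// sumEFin lee_fin.
rewrite big_mkord; apply: le_trans (overlap y n); rewrite [leRHS]big_mkcond /=.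
by apply: ler_sum => i _; case: ifP.
Qed.

(** The integral of [theta i] is at most CD^a [Vi i], which cancels the normalisation of the average
    up to CD^a; bounded overlap then sums the integrals over balls. The 1 in [Cdual] pays for the
    points of scale 0. *)
Lemma smooth_dual F : (forall z, 0 <= F z)%E -> measurable_fun [set: T] F ->
  (\int[mu]_y smooth F y <= Cdual%:E * \int[mu]_y F y)%E.
Proof.
move=> F0 mF.
pose G y := (\sum_(i <oo) ((theta i y)%:E * avg i F))%E.
have G0 y : (0 <= G y)%E.
  by apply: nneseries_ge0 => i _ _; rewrite mule_ge0 ?avg_ge0// lee_fin theta_ge0.
have mti i : measurable_fun [set: T] (fun y => (theta i y)%:E * avg i F)%E.
  apply: emeasurable_funM => //; apply/measurable_EFinP; exact: measurable_theta.
have mG : measurable_fun [set: T] G.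
  apply: ge0_emeasurable_sum => // i y _ _.
  by rewrite mule_ge0 ?avg_ge0// lee_fin theta_ge0.
apply: (@le_trans _ _ (\int[mu]_y (F y + G y))%E).
  apply: ge0_le_integral => //.
  - by move=> y _; exact: smooth_ge0.
  - exact: measurable_smooth_fun.
  - by apply: emeasurable_funD.
  - move=> y _; rewrite /smooth; case: ifP => _; first by rewrite leeDl.
    by rewrite leeDr.
rewrite ge0_integralD// EFinD ge0_muleDl ?lee_fin//; last first.
  by rewrite mulr_ge0 ?exprn_ge0 ?(ltW CD_gt0).
rewrite mul1e leeD2l// integral_nneseries//; last first.
  by move=> i y _; rewrite mule_ge0 ?avg_ge0// lee_fin theta_ge0.
apply: (@le_trans _ _ (\sum_(i <oo) ((CD ^+ a)%:E * \int[mu]_y ((ind (act i y))%:E * F y)))%E).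
  apply: lee_nneseries => [i _ _|i _].
    by apply: integral_ge0 => y _; rewrite mule_ge0 ?avg_ge0// lee_fin theta_ge0.
  have [si|si] := boolP (sel i); last first.
    rewrite integral0_eq.
      by rewrite mule_ge0 ?lee_fin ?exprn_ge0 ?(ltW CD_gt0)// integral_ge0// => y _; rewrite mule_ge0// lee_fin.
    by move=> y _; rewrite theta0 ?mul0e// /actA (negbTE si).
  have s0 := sel_gt0 si.
  have v0 := V_gt0 (pt i) s0.
  rewrite ge0_integralZr//; last 3 first.
  - by apply/measurable_EFinP; exact: measurable_theta.
  - by move=> y _; rewrite lee_fin theta_ge0.
  - exact: avg_ge0.
  apply: (@le_trans _ _ ((CD ^+ a * Vi i)%:E * avg i F)%E).
    rewrite lee_wpmul2r ?avg_ge0//.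
    apply: (@le_trans _ _ (\int[mu]_y (ind (dd (pt i) y < A * s i))%:E)%E).
      apply: ge0_le_integral => //.
      - by move=> y _; rewrite lee_fin theta_ge0.
      - by apply/measurable_EFinP; exact: measurable_theta.
      - by apply/measurable_EFinP/measurable_bool_natr; exact: measurable_lt_dd.
      - move=> y _; have [h|h] := boolP (actA i y); last by rewrite theta0// lee_fin.
        by case/andP: h => _ ->; rewrite lee_fin theta_le1.
    rewrite integral_bool_natr/=; last exact: measurable_lt_dd.
    by rewrite muV ?lee_fin AE ?V_iter// mulr_gt0// -AE (lt_le_trans _ A_ge1).
  rewrite EFinM -muleA lee_wpmul2l ?lee_fin ?exprn_ge0 ?(ltW CD_gt0)//.
  rewrite /avg muleA -EFinM mulfV ?gt_eqF// mul1e.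
  apply: ge0_le_integral => //.
  - by move=> y _; rewrite mule_ge0// lee_fin.
  - by apply: emeasurable_funM => //; exact: measurable_ind_ball.
  - apply: emeasurable_funM => //; apply/measurable_EFinP/measurable_bool_natr.
    by rewrite /act si; exact: measurable_lt_dd.
  - move=> y _; case: ltP => [h|_]; last by rewrite mul0e mule_ge0// lee_fin.
    rewrite /act si /= (lt_le_trans h)// ?mul1e//.
    by rewrite ler_peMl ?(ltW s0)// L_ge1.
rewrite nneseriesZl; last by move=> i _; apply: integral_ge0 => y _; rewrite mule_ge0// lee_fin.
rewrite EFinM -muleA lee_wpmul2l ?lee_fin ?exprn_ge0 ?(ltW CD_gt0)//.
have mact i : measurable_fun [set: T] (fun y => (ind (act i y))%:E * F y)%E.
  apply: emeasurable_funM => //; apply/measurable_EFinP/measurable_bool_natr.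
  by rewrite /act; case: (sel i) => //=; exact: measurable_lt_dd.
rewrite -integral_nneseries//; last by move=> i y _; rewrite mule_ge0// lee_fin.
rewrite -ge0_integralZl//; last by rewrite lee_fin exprn_ge0 ?(ltW CD_gt0).
apply: ge0_le_integral => //.
- by move=> y _; apply: nneseries_ge0 => i _ _; rewrite mule_ge0// lee_fin.
- by apply: ge0_emeasurable_sum => // i y _ _; rewrite mule_ge0// lee_fin.
- by apply: emeasurable_funM.
- by move=> y _; exact: sum_ind_le.
Qed.

(** * Ball means and Jensen inequalities *)

Section Average.
Variable u : T -> R.
Hypothesis mu_ : measurable_fun [set: T] u.
Hypothesis u_ge0 : forall y, 0 <= u y.
Hypothesis u_int : forall x r, (\int[mu]_z (ind (dd x z < r) * u z)%:E < +oo)%E.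

Definition ball_mean (i : nat) : R := fine (avg i (EFin \o u)).

Lemma int_ind_u i : sel i ->
  (\int[mu]_z (ind (dd (pt i) z < s i) * u z)%:E = (ball_mean i * Vi i)%:E)%E.
Proof.
move=> /sel_gt0 si; have v0 := V_gt0 (pt i) si.
have fin : (\int[mu]_z (ind (dd (pt i) z < s i) * u z)%:E)%E \is a fin_num.
  by rewrite ge0_fin_numE ?u_int// integral_ge0// => z _; rewrite lee_fin mulr_ge0.
rewrite /ball_mean /avg (eq_integral (fun z => (ind (dd (pt i) z < s i) * u z)%:E)); last first.
  by move=> z _; rewrite EFinM.
by rewrite fineM//= mulrAC mulVf ?gt_eqF// mul1r fineK.
Qed.

Lemma ball_mean_ge0 i : 0 <= ball_mean i.
Proof. by rewrite fine_ge0// avg_ge0// => z; rewrite lee_fin. Qed.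

Lemma int_ind_affine i (p r : R) : sel i -> 0 <= p -> 0 <= r ->
  (\int[mu]_z (ind (dd (pt i) z < s i) * (p * u z + r))%:E =
   ((p * ball_mean i + r) * Vi i)%:E)%E.
Proof.
move=> si p0 r0.
have mi : measurable_fun [set: T] (fun z => ind (dd (pt i) z < s i)).
  by apply: measurable_bool_natr; exact: measurable_lt_dd.
under eq_integral do rewrite mulrDr mulrCA [_ * r]mulrC EFinD !EFinM.
rewrite ge0_integralD//; last 4 first.
- by move=> z _; rewrite !mule_ge0// lee_fin.
- by do 2 apply: emeasurable_funM => //; exact/measurable_EFinP.
- by move=> z _; rewrite !mule_ge0// lee_fin.
- by apply: emeasurable_funM => //; exact/measurable_EFinP.
rewrite !ge0_integralZl//; try by [exact/measurable_EFinP |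
  move=> z _; rewrite -EFinM lee_fin mulr_ge0 |
  apply: emeasurable_funM; exact/measurable_EFinP].
rewrite integral_bool_natr/=; last exact: measurable_lt_dd.
under eq_integral do rewrite -EFinM.
by rewrite int_ind_u// muV ?sel_gt0// -!EFinM -EFinD mulrDl mulrA.
Qed.

(** Jensen through the tangent of the square at the mean c: (u - t)^2 >= 2 (c - t) u - (c - t)(c +
    t). In [key] the affine terms are distributed over both sides with nonnegative coefficients, so
    the integral of (u - t)^2 may be infinite; the two cases are the signs of c - t. *)
Lemma avg_jensen i (t : R) : sel i -> 0 <= t ->
  (((ball_mean i - t) ^+ 2)%:E <= avg i (fun z => ((u z - t) ^+ 2)%:E))%E.
Proof.
move=> si t0; have s0 := sel_gt0 si; have v0 := V_gt0 (pt i) s0.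
have ci := ball_mean_ge0 i.
have mi : measurable_fun [set: T] (fun z => ind (dd (pt i) z < s i)).
  by apply: measurable_bool_natr; exact: measurable_lt_dd.
have m2 : measurable_fun [set: T] (fun z => (u z - t) ^+ 2).
  by apply: measurable_funX; apply: measurable_funB.
set I := (\int[mu]_z ((ind (dd (pt i) z < s i))%:E * ((u z - t) ^+ 2)%:E))%E.
have key (p r p' r' : R) : 0 <= p -> 0 <= r -> 0 <= p' -> 0 <= r' ->
    (forall z, p * u z + r <= (u z - t) ^+ 2 + (p' * u z + r')) ->
    (((p * ball_mean i + r) * Vi i - (p' * ball_mean i + r') * Vi i)%:E <= I)%E.
  move=> p0 r0 p'0 r'0 h.
  rewrite EFinB leeBlDr// -!int_ind_affine// -ge0_integralD//; last 4 first.
  - by move=> z _; rewrite mule_ge0// lee_fin// sqr_ge0.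
  - by apply: emeasurable_funM; exact/measurable_EFinP.
  - by move=> z _; rewrite lee_fin mulr_ge0// addr_ge0// mulr_ge0.
  - apply/measurable_EFinP; apply: measurable_funM => //.
    by apply: measurable_funD => //; apply: measurable_funM.
  apply: ge0_le_integral => //.
  - by move=> z _; rewrite lee_fin mulr_ge0// addr_ge0// mulr_ge0.
  - apply/measurable_EFinP; apply: measurable_funM => //.
    by apply: measurable_funD => //; apply: measurable_funM.
  - apply: emeasurable_funD.
      by apply: emeasurable_funM; exact/measurable_EFinP.
    apply/measurable_EFinP; apply: measurable_funM => //.
    by apply: measurable_funD => //; apply: measurable_funM.
  - by move=> z _; rewrite -EFinM -EFinD lee_fin -mulrDr ler_wpM2l.
rewrite /avg -/I -lee_pdivrMl ?invr_gt0// invrK.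
case: (lerP t (ball_mean i)) => tc.
  rewrite -EFinM (_ : Vi i * _ = (2 * (ball_mean i - t) * ball_mean i + 0) * Vi i -
    (0 * ball_mean i + (ball_mean i - t) * (t + ball_mean i)) * Vi i); last by ring.
  apply: key => //.
  - by rewrite mulr_ge0// subr_ge0.
  - by rewrite mulr_ge0 ?subr_ge0// addr_ge0.
  - by move=> z; have := sqr_ge0 (u z - ball_mean i); nra.
rewrite -EFinM (_ : Vi i * _ = (0 * ball_mean i + (t - ball_mean i) * (t + ball_mean i)) * Vi i -
  (2 * (t - ball_mean i) * ball_mean i + 0) * Vi i); last by ring.
apply: key => //.
- by apply: mulr_ge0; rewrite ?subr_ge0 ?(ltW tc)// addr_ge0.
- by rewrite mulr_ge0// subr_ge0 ltW.
- by move=> z; have := sqr_ge0 (u z - ball_mean i); nra.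
Qed.

(** The real-valued counterpart of [smooth], a finite sum cut at an index beyond which nothing is
    active at y. *)
Definition smoothed (y : T) : R :=
  if rho y == 0 then u y
  else \sum_(i < projT1 (cid (act_finite y))) theta i y * ball_mean i.

Lemma smoothedE y : 0 < rho y -> exists n0, forall n, (n0 <= n)%N ->
  [/\ smoothed y = \sum_(i < n) theta i y * ball_mean i, \sum_(i < n) theta i y = 1
    & forall i, (n <= i)%N -> ~~ actA i y].
Proof.
move=> ry; rewrite /smoothed gt_eqF//; case: cid => n1 /= h1.
have [n2 h2] := cutmax_eq1 ry; exists (maxn n1 n2) => n; rewrite geq_max => /andP[n1n n2n].
split.
- rewrite -!(big_mkord xpredT (fun i => theta i y * ball_mean i)).
  rewrite [RHS](@big_cat_nat _ _ _ n1)//= [X in _ = _ + X]big_nat_cond.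
  rewrite [X in _ = _ + X]big1 ?addr0// => i /andP[/andP[n1i _] _].
  by rewrite theta0 ?mul0r//; apply: contra (h1 _ n1i); exact: actA_act.
- by rewrite sum_theta h2.
- by move=> i ni; apply: contra (h1 i (leq_trans n1n ni)); exact: actA_act.
Qed.

Lemma smoothed_ge0 y : 0 <= smoothed y.
Proof.
rewrite /smoothed; case: ifP => // _; apply: sumr_ge0 => i _.
by rewrite mulr_ge0 ?theta_ge0 ?ball_mean_ge0.
Qed.

Lemma measurable_smoothed : measurable_fun [set: T] smoothed.
Proof.
have mS n : measurable_fun [set: T] (fun y => if rho y == 0 then u y else \sum_(i < n) theta i y * ball_mean i).
  apply: measurable_fun_ifT => //; first by apply: measurable_fun_eqr.
  apply: measurable_sum => i; apply: measurable_funM => //; exact: measurable_theta.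
apply: (measurable_fun_cvg mS) => y _.
have [ry|ry] := eqVneq (rho y) 0.
  by rewrite /smoothed ry eqxx; exact: cvg_cst.
have {}ry : 0 < rho y by rewrite lt_neqAle eq_sym ry rho_ge0.
have [n0 hn] := smoothedE ry.
apply: cvg_near_cst; exists n0 => // n /= /hn[-> _ _]; by rewrite ?gt_eqF.
Qed.

(** The two sides differ by the weighted variance of x about its mean. *)
Lemma wsum_sqr_le (n : nat) (w x : 'I_n -> R) (t : R) :
  (forall i, 0 <= w i) -> \sum_i w i = 1 ->
  (\sum_i w i * x i - t) ^+ 2 <= \sum_i w i * (x i - t) ^+ 2.
Proof.
move=> w0 w1; set S := \sum_i w i * x i.
have : 0 <= \sum_i w i * (x i - S) ^+ 2 by apply: sumr_ge0 => i _; rewrite mulr_ge0// sqr_ge0.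
have -> : \sum_i w i * (x i - t) ^+ 2 =
    \sum_i w i * (x i - S) ^+ 2 + (2 * (S - t)) * (S - t) - (S - t) ^+ 2.
  have -> : 2 * (S - t) * (S - t) = \sum_i 2 * (S - t) * (w i * (x i - t)).
    rewrite -mulr_sumr; congr (_ * _).
    by under eq_bigr do rewrite mulrBr; rewrite sumrB -mulr_suml w1 mul1r.
  have -> : (S - t) ^+ 2 = \sum_i w i * (S - t) ^+ 2 by rewrite -mulr_suml w1 mul1r.
  rewrite -big_split -sumrB /=; apply: eq_bigr => i _; ring.
by lra.
Qed.

Lemma smooth_jensen y (t : R) : 0 <= t ->
  (((smoothed y - t) ^+ 2)%:E <= smooth (fun z => ((u z - t) ^+ 2)%:E) y)%E.
Proof.
move=> t0; rewrite /smooth; case: eqVneq => ry; first by rewrite /smoothed ry eqxx.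
have {}ry : 0 < rho y by rewrite lt_neqAle eq_sym ry rho_ge0.
have [n hn] := smoothedE ry; have [-> th1 _] := hn n (leqnn n).
apply: (@le_trans _ _ (\sum_(i < n) ((theta i y)%:E * avg i (fun z => ((u z - t) ^+ 2)%:E)))%E).
  apply: (@le_trans _ _ (\sum_(i < n) (theta i y * (ball_mean i - t) ^+ 2)%:E)%E).
    by rewrite sumEFin lee_fin; apply: wsum_sqr_le => // i; exact: theta_ge0.
  apply: lee_sum => i _.
  have [/andP[si _]|/theta0 ->] := boolP (actA i y); last by rewrite mul0r mul0e.
  by rewrite EFinM lee_wpmul2l ?lee_fin ?theta_ge0// avg_jensen.
rewrite -(big_mkord xpredT (fun i => (theta i y)%:E * avg i (fun z => ((u z - t) ^+ 2)%:E))%E).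
apply: nneseries_lim_ge => i _ _.
by rewrite mule_ge0 ?lee_fin ?theta_ge0// avg_ge0// => z; rewrite lee_fin sqr_ge0.
Qed.

Lemma measurable_smooth2 (G : T * T -> \bar R) y : (forall z, 0 <= G z)%E ->
  measurable_fun [set: T * T] G ->
  measurable_fun [set: T] (fun z => smooth (fun w => G (z, w)) y).
Proof.
move=> G0 mG.
have msw : measurable_fun [set: T * T] (fun z : T * T => (z.2, z.1)).
  by apply: measurable_fun_pair.
have := @measurable_smooth (fun z => G (z.2, z.1)) (fun z => G0 _) (measurableT_comp mG msw).
by move=> /measurableT_comp /(_ (pair1_measurable y)).
Qed.

(** * Far pairs *)

(** The threshold is the larger scale itself and not 16 A times it: averaging moves both points, and
    the weaker condition survives the move. *)
Definition far_kernel (z : T * T) : \bar R :=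
  (ind (Num.max (rho z.1) (rho z.2) <= dd z.1 z.2) * ((u z.1 - u z.2) ^+ 2 * J z.1 z.2))%:E.

Lemma far_kernel_ge0 z : (0 <= far_kernel z)%E.
Proof. by rewrite lee_fin mulr_ge0// mulr_ge0 ?sqr_ge0. Qed.

Lemma measurable_sqdiff (f : T -> R) : measurable_fun [set: T] f ->
  measurable_fun [set: T * T] (fun z => (f z.1 - f z.2) ^+ 2).
Proof.
move=> mf; apply: measurable_funX; apply: measurable_funB.
  exact: (measurableT_comp mf measurable_fst).
exact: (measurableT_comp mf measurable_snd).
Qed.

Lemma measurable_far_kernel : measurable_fun [set: T * T] far_kernel.
Proof.
apply/measurable_EFinP; apply: measurable_funM.
  apply: measurable_bool_natr; apply: measurable_fun_ler => //.
  by apply: measurable_maxr; [exact: (measurableT_comp mrho measurable_fst)|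
                             exact: (measurableT_comp mrho measurable_snd)].
by apply: measurable_funM => //; exact: measurable_sqdiff.
Qed.

Definition Cfar := K ^+ 4 * CD ^+ 2.

(** For z within 4 A [rho x] of x and w within 4 A [rho y] of y, dd z w differs from dd x y by at
    most half of it, so [J_cmp] carries the kernel inside both averages. The scales at z and w are
    at most dd x y / 8, so (z, w) passes the threshold of [far_kernel]. *)
Lemma far_bound x y : x <> y -> 16 * A * Num.max (rho x) (rho y) <= dd x y ->
  (((smoothed x - smoothed y) ^+ 2 * J x y)%:E <=
   Cfar%:E * smooth (fun z => smooth (fun w => far_kernel (z, w)) y) x)%E.
Proof.
move=> xy far; have A1 := A_ge1; have gy0 := smoothed_ge0 y.
have d0 := dd_gt0 xy; have rx0 := rho_ge0 x; have ry0 := rho_ge0 y.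
have Cfar0 : 0 <= Cfar by rewrite mulr_ge0 ?exprn_ge0 ?(ltW CD_gt0) ?(ltW K_gt0).
have mG : measurable_fun [set: T * T] (fun z : T * T => ((u z.1 - u z.2) ^+ 2)%:E).
  by apply/measurable_EFinP; exact: measurable_sqdiff.
have mPsq : measurable_fun [set: T] (fun z => smooth (fun w => ((u z - u w) ^+ 2)%:E) y).
  apply: (@measurable_smooth2 (fun z => ((u z.1 - u z.2) ^+ 2)%:E) y) => // z.
  by rewrite lee_fin sqr_ge0.
have mu1 t : measurable_fun [set: T] (fun z => ((u z - t) ^+ 2)%:E).
  by apply/measurable_EFinP; apply: measurable_funX; apply: measurable_funB.
have mu2 t : measurable_fun [set: T] (fun z => ((t - u z) ^+ 2)%:E).
  by apply/measurable_EFinP; apply: measurable_funX; apply: measurable_funB.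
have mH1 z : measurable_fun [set: T] (fun w => far_kernel (z, w)).
  exact: (measurableT_comp measurable_far_kernel (pair1_measurable z)).
have max1 : rho x <= Num.max (rho x) (rho y) by rewrite le_max lexx.
have max2 : rho y <= Num.max (rho x) (rho y) by rewrite le_max lexx orbT.
have Ax : A * rho x <= A * Num.max (rho x) (rho y) by rewrite ler_wpM2l//; lra.
have Ay : A * rho y <= A * Num.max (rho x) (rho y) by rewrite ler_wpM2l//; lra.
have Ax1 : rho x <= A * rho x by rewrite ler_peMl.
have Ay1 : rho y <= A * rho y by rewrite ler_peMl.
rewrite mulrC EFinM.
apply: (@le_trans _ _ ((J x y)%:E * smooth (fun z => smooth (fun w => ((u z - u w) ^+ 2)%:E) y) x)%E).
  rewrite lee_wpmul2l ?lee_fin//.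
  (* Jensen in the first variable with the constant [smoothed y], then in the second with the
     constant [u z]. *)
  apply: (le_trans (smooth_jensen _ gy0)); apply: smooth_mono => //.
  - by move=> z; rewrite lee_fin sqr_ge0.
  - by move=> z; apply: smooth_ge0 => w; rewrite lee_fin sqr_ge0.
  - move=> z _; rewrite -sqrrN opprB.
    apply: (le_trans (smooth_jensen _ (u_ge0 z))); apply: smooth_mono => //.
    + by move=> w; rewrite lee_fin sqr_ge0.
    + by move=> w; rewrite lee_fin sqr_ge0.
    + by move=> w _; rewrite -sqrrN opprB.
have mPH : measurable_fun [set: T] (fun z => smooth (fun w => far_kernel (z, w)) y).
  by apply: measurable_smooth2; [exact: far_kernel_ge0|exact: measurable_far_kernel].
have Psq0 z : (0 <= smooth (fun w => ((u z - u w) ^+ 2)%:E) y)%E.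
  by apply: smooth_ge0 => w; rewrite lee_fin sqr_ge0.
have PH0 z : (0 <= smooth (fun w => far_kernel (z, w)) y)%E.
  by apply: smooth_ge0 => w; exact: far_kernel_ge0.
apply: (smooth_scale_mono (J_ge0 x y) Cfar0 Psq0 PH0 mPsq mPH) => z xz.
apply: smooth_scale_mono => //.
- by move=> w; rewrite lee_fin sqr_ge0.
- by move=> w; exact: far_kernel_ge0.
move=> w yw; rewrite /far_kernel/= -!EFinM lee_fin.
have t1 := dd_tri z x y; have t2 := dd_tri w z y; have t3 := dd_tri x z w; have t4 := dd_tri y x w.
rewrite (dd_sym w y) in t2; rewrite (dd_sym z x) in t3.
have cz : rho z <= dd x y / 8.
  have := rho_le z x; rewrite (dd_sym z) LA => h.
  have : dd x z / (2 * (128 * A)) <= rho x / 64; last by lra.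
  by rewrite ler_pdivrMr; lra.
have cw : rho w <= dd x y / 8.
  have := rho_le w y; rewrite (dd_sym w) LA => h.
  have : dd y w / (2 * (128 * A)) <= rho y / 64; last by lra.
  by rewrite ler_pdivrMr; lra.
have -> : Num.max (rho z) (rho w) <= dd z w by rewrite ge_max; apply/andP; split; lra.
rewrite mul1r [leRHS]mulrCA [leLHS]mulrC ler_wpM2l ?sqr_ge0//.
by apply: J_cmp => //; first (apply/andP; split); lra.
Qed.

(** * Near pairs *)

Definition ball_variation (j : nat) : \bar R :=
  (\int[mu \x mu]_z ((ind (act j z.1) * ind (act j z.2)) * (u z.1 - u z.2) ^+ 2)%:E)%E.

Lemma measurable_act j : measurable_fun [set: T] (fun y => act j y).
Proof.
rewrite /act; case: (sel j) => /=; last exact: measurable_cst.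
exact: measurable_lt_dd.
Qed.

Lemma measurable_ball_variation j : measurable_fun [set: T * T]
  (fun z => ((ind (act j z.1) * ind (act j z.2)) * (u z.1 - u z.2) ^+ 2)%:E).
Proof.
apply/measurable_EFinP; apply: measurable_funM; last exact: measurable_sqdiff.
apply: measurable_funM; apply: measurable_bool_natr.
  exact: (measurableT_comp (measurable_act j) measurable_fst).
exact: (measurableT_comp (measurable_act j) measurable_snd).
Qed.

Lemma ball_variation_fun_ge0 j (z : T * T) :
  (0 <= ((ind (act j z.1) * ind (act j z.2)) * (u z.1 - u z.2) ^+ 2)%:E)%E.
Proof. by rewrite lee_fin; apply: mulr_ge0; [rewrite mulr_ge0|rewrite sqr_ge0]. Qed.

Lemma ball_variation_ge0 j : (0 <= ball_variation j)%E.
Proof. by apply: integral_ge0 => z _; exact: ball_variation_fun_ge0. Qed.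

(** Jensen twice: with the other mean as the constant, then with the value [u z] as the constant. *)
Lemma avg_diff (i k j : nat) : sel i -> sel k -> 
  (forall z, dd (pt i) z < s i -> act j z) -> (forall z, dd (pt k) z < s k -> act j z) ->
  (((ball_mean i - ball_mean k) ^+ 2)%:E <= ((Vi i)^-1 * (Vi k)^-1)%:E * ball_variation j)%E.
Proof.
move=> si sk hi hk; have s0 := sel_gt0 si; have s0' := sel_gt0 sk.
have v0 := V_gt0 (pt i) s0; have v0' := V_gt0 (pt k) s0'.
apply: (le_trans (avg_jensen si (ball_mean_ge0 k))).
rewrite EFinM -muleA lee_wpmul2l//; first by rewrite lee_fin invr_ge0 ltW.
have mi i' : measurable_fun [set: T] (fun z => ind (dd (pt i') z < s i')).
  by apply: measurable_bool_natr; exact: measurable_lt_dd.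
have mu1 t : measurable_fun [set: T] (fun z => (u z - t) ^+ 2).
  by apply: measurable_funX; apply: measurable_funB.
rewrite /ball_variation (fubini_tonelli1 (m1 := mu) (m2 := mu) _ (measurable_ball_variation j)); last first.
  exact: ball_variation_fun_ge0.
have mF := @measurable_fun_fubini_tonelli_F _ _ T T R mu _ (measurable_ball_variation j).
rewrite -ge0_integralZl//; last 3 first.
- by apply: mF; exact: ball_variation_fun_ge0.
- by move=> z _; apply: integral_ge0 => w _; exact: (ball_variation_fun_ge0 j (z, w)).
- by rewrite lee_fin invr_ge0 ltW.
apply: ge0_le_integral => //.
- by move=> z _; rewrite mule_ge0// lee_fin// sqr_ge0.
- by apply: emeasurable_funM; exact/measurable_EFinP.
- apply: emeasurable_funM => //; apply: mF; exact: ball_variation_fun_ge0.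
- move=> z _; case: ltP => [zi|_]; last first.
    rewrite mul0e mule_ge0// ?lee_fin ?invr_ge0 ?(ltW v0')//.
    by apply: integral_ge0 => w _; exact: (ball_variation_fun_ge0 j (z, w)).
  rewrite mul1e -sqrrN opprB (le_trans (avg_jensen sk (u_ge0 z)))//.
  rewrite lee_wpmul2l//; first by rewrite lee_fin invr_ge0 ltW.
  apply: ge0_le_integral => //.
  + by move=> w _; rewrite mule_ge0// lee_fin// sqr_ge0.
  + by apply: emeasurable_funM; exact/measurable_EFinP.
  + exact: (measurableT_comp (measurable_ball_variation j) (pair1_measurable z)).
  + move=> w _; rewrite -EFinM lee_fin /= (hi _ zi) mul1r -sqrrN opprB.
    rewrite ler_wpM2r ?sqr_ge0//.
    by case: ltP => // /hk ->.
Qed.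

(** Cauchy-Schwarz over the active indices, obtained by expanding the nonnegative sum of the squares
    (x i - X / N)^2. *)
Lemma cauchy_bool (n : nat) (b : 'I_n -> bool) (x : 'I_n -> R) (N : R) :
  0 < N -> \sum_i ind (b i) <= N ->
  (\sum_i ind (b i) * x i) ^+ 2 <= N * \sum_i ind (b i) * x i ^+ 2.
Proof.
move=> N0 hN; set X := \sum_i _ * x i; set S2 := \sum_i _ * x i ^+ 2.
have : 0 <= \sum_i ind (b i) * (x i - X / N) ^+ 2.
  by apply: sumr_ge0 => i _; rewrite mulr_ge0// sqr_ge0.
have -> : \sum_i ind (b i) * (x i - X / N) ^+ 2 =
    S2 - 2 * (X / N) * X + (X / N) ^+ 2 * \sum_i ind (b i).
  have -> : 2 * (X / N) * X = \sum_i 2 * (X / N) * (ind (b i) * x i) by rewrite -mulr_sumr.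
  by rewrite /S2 mulr_sumr -sumrB -big_split /=; apply: eq_bigr => i _; ring.
have : (X / N) ^+ 2 * \sum_i ind (b i) <= (X / N) ^+ 2 * N.
  by rewrite ler_wpM2l// sqr_ge0.
have -> : (X / N) ^+ 2 * N = X ^+ 2 / N by field; rewrite gt_eqF.
have -> : 2 * (X / N) * X = 2 * (X ^+ 2 / N) by field; rewrite gt_eqF.
move=> h1 h2; rewrite -ler_pdivrMl// mulrC; lra.
Qed.

(** The 4 is the square of the 2 in [theta_diff]; two factors 2 [Cov] come from Cauchy-Schwarz for
    the means and for the cutoffs, the third from the number of means compared; (CD^l)^2 replaces
    two ball volumes by that of ball j. *)
Definition Cnear := 4 * (2 * Cov) ^+ 3 * (CD ^+ l) ^+ 2.

Lemma Cov_gt0 : 0 < Cov. Proof. by rewrite exprn_gt0. Qed.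

Lemma Cnear_ge0 : 0 <= Cnear.
Proof. by rewrite !mulr_ge0// exprn_ge0// ?mulr_ge0 ?exprn_ge0 ?(ltW Cov_gt0) ?(ltW CD_gt0). Qed.

(** The slope of the scale makes [rho x] and [rho y] agree up to a factor 2, hence the scales of the
    two net points up to a factor 6. The distances then add up to less than 64 A times either of
    these scales, below L times it. *)
Lemma near_geometry x y p p' i j : dd x y < 16 * A * Num.max (rho x) (rho y) ->
  (p = x \/ p = y) -> (p' = x \/ p' = y) -> actA j p -> actA i p' ->
  (forall z, dd (pt i) z < s i -> act j z) /\ Vi j <= CD ^+ l * Vi i.
Proof.
move=> near hp hp' jp ip; have A1 := A_ge1.
have /act_rho/andP[j1 j2] := actA_act jp; have /act_rho/andP[i1 i2] := actA_act ip.
have [sj dj] := andP jp; have [si di] := andP ip.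
have sj0 := sel_gt0 sj; have si0 := sel_gt0 si.
have cmp : rho x <= 2 * rho y /\ rho y <= 2 * rho x.
  have t1 := rho_le x y; have t2 := rho_le y x; rewrite (dd_sym y) in t2.
  have h : dd x y / (2 * L) <= Num.max (rho x) (rho y) / 16.
    rewrite ler_pdivrMr LA; last lra.
    have := rho_ge0 x; have := rho_ge0 y.
    by move: near; rewrite maxEle; case: ifP => _; nra.
  have := rho_ge0 x; have := rho_ge0 y.
  by move: h; rewrite maxEle; case: ifP => hm; split; lra.
have hpp' : rho p' <= 2 * rho p /\ rho p <= 2 * rho p'.
  by case: hp => ->; case: hp' => ->; split; have := rho_ge0 x; have := rho_ge0 y; lra.
have dxy : dd p p' <= dd x y.
  by case: hp => ->; case: hp' => ->; rewrite ?ddxx ?dd_ge0// dd_sym.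
have mx p0 : p0 = x \/ p0 = y -> Num.max (rho x) (rho y) <= 2 * rho p0.
  by case=> ->; rewrite ge_max; apply/andP; split; have := rho_ge0 x; have := rho_ge0 y; lra.
have mp := mx _ hp; have mp' := mx _ hp'.
have sij : s i <= 6 * s j by lra.
have sji : s j <= 6 * s i by lra.
have e1 : A * Num.max (rho x) (rho y) <= A * (3 * s j) by rewrite ler_wpM2l; lra.
have e2 : A * Num.max (rho x) (rho y) <= A * (3 * s i) by rewrite ler_wpM2l; lra.
have e3 : A * s i <= A * (6 * s j) by rewrite ler_wpM2l; lra.
have e4 : A * s j <= A * (6 * s i) by rewrite ler_wpM2l; lra.
have e5 : s i <= A * s i by rewrite ler_peMl// ltW.
have e6 : s j <= A * s j by rewrite ler_peMl// ltW.
split.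
  move=> z zi; rewrite /act sj LA /=.
  have t1 := dd_tri p (pt j) z; have t2 := dd_tri p' p z; have t3 := dd_tri (pt i) p' z.
  by rewrite (dd_sym p' (pt i)) in t3; lra.
apply: V_cmp => //; rewrite -LE LA.
have t1 := dd_tri p' (pt i) (pt j); have t2 := dd_tri p p' (pt j).
by rewrite (dd_sym p' p) (dd_sym p (pt j)) in t2; lra.
Qed.

(** The weights sum to 1 at both points, so a common reference mean [i0] can be subtracted before
    the increments of [theta] are estimated; Cauchy-Schwarz then separates the differences of means
    from the increments of the cutoffs. *)
Lemma near_bound x y : dd x y < 16 * A * Num.max (rho x) (rho y) ->
  (((smoothed x - smoothed y) ^+ 2)%:E <=
   Cnear%:E * \sum_(j <oo) (((Vi j)^-1 ^+ 2)%:E * ball_variation j * ((eta j x - eta j y) ^+ 2)%:E))%E.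
Proof.
move=> near; have A1 := A_ge1; have rx0 := rho_ge0 x; have ry0 := rho_ge0 y.
(* The near condition forces the larger scale to be positive, and comparability passes this on to
   the smaller one. *)
have [rx ry] : 0 < rho x /\ 0 < rho y.
  have t1 := rho_le x y; have t2 := rho_le y x; rewrite (dd_sym y) in t2.
  have m0 : 0 < Num.max (rho x) (rho y) by have := dd_ge0 x y; nra.
  have h : dd x y / (2 * L) <= Num.max (rho x) (rho y) / 16.
    rewrite ler_pdivrMr LA; last lra.
    by nra.
  by move: m0 h; rewrite maxEle; case: ifP => hm; split; lra.
have [n1 h1] := smoothedE rx; have [n2 h2] := smoothedE ry.
pose n := maxn n1 n2.
have [gx tx ax] := h1 n (leq_maxl _ _); have [gy ty ay] := h2 n (leq_maxr _ _).
pose b (i : 'I_n) := actA i x || actA i y.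
have Cov0 := Cov_gt0.
have hb : \sum_i ind (b i) <= 2 * Cov.
  have -> : 2 * Cov = Cov + Cov by ring.
  apply: (@le_trans _ _ (\sum_(i < n) ((if act i x then 1 else 0) + (if act i y then 1 else 0)))).
    apply: ler_sum => i _; rewrite /b.
    case: (boolP (actA i x)) => [/actA_act->|_]; first by case: ifP => _ /=; lra.
    case: (boolP (actA i y)) => [/actA_act->|_] /=; first by case: ifP => _ /=; lra.
    by do 2 case: ifP; lra.
  by rewrite big_split /= -!big_mkcond lerD ?overlap.
have [i0 bi0] : exists i0, b i0.
  apply: contrapT => hno; move: tx; rewrite big1 => [h|i _]; first by lra.
  apply: theta0; apply/negP => ai; apply: hno; exists i; by rewrite /b ai.
have ex (i : 'I_n) : b i -> exists p, (p = x \/ p = y) /\ actA i p.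
  by case/orP; [exists x|exists y]; split => //; [left|right].
have nb (i : 'I_n) : ~~ b i -> [/\ theta i x = 0, theta i y = 0, eta i x = 0 & eta i y = 0].
  by rewrite negb_or => /andP[nx ny]; rewrite !theta0 ?eta0.
pose S := \sum_(i < n) ind (b i) * `|ball_mean i - ball_mean i0|.
pose E := \sum_(i < n) ind (b i) * `|eta i x - eta i y|.
have EE : \sum_(j < n) `|eta j x - eta j y| = E.
  apply: eq_bigr => j _; case: (boolP (b j)) => [_|/nb[_ _ -> ->]]; first by rewrite mul1r.
  by rewrite subrr normr0 mulr0.
have E0 : 0 <= E by apply: sumr_ge0 => j _; rewrite mulr_ge0.
have dg : `|smoothed x - smoothed y| <= S * (2 * E).
  have -> : smoothed x - smoothed y = \sum_(i < n) ind (b i) * ((ball_mean i - ball_mean i0) * (theta i x - theta i y)).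
    rewrite gx gy.
    have -> : \sum_(i < n) theta i x * ball_mean i = \sum_(i < n) theta i x * (ball_mean i - ball_mean i0) + ball_mean i0.
      by under [in RHS]eq_bigr do rewrite mulrBr; rewrite sumrB -mulr_suml tx mul1r subrK.
    have -> : \sum_(i < n) theta i y * ball_mean i = \sum_(i < n) theta i y * (ball_mean i - ball_mean i0) + ball_mean i0.
      by under [in RHS]eq_bigr do rewrite mulrBr; rewrite sumrB -mulr_suml ty mul1r subrK.
    rewrite opprD addrACA subrr addr0 -sumrB; apply: eq_bigr => i _.
    case: (boolP (b i)) => [_|/nb[-> -> _ _]]; first by rewrite mul1r; ring.
    by rewrite /= !mul0r subrr.
  apply: (le_trans (ler_norm_sum _ _ _)); rewrite /S mulr_suml; apply: ler_sum => i _.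
  rewrite normrM ger0_norm// -mulrA ler_wpM2l// normrM ler_wpM2l// -EE.
  exact: theta_diff.
have S2 : S ^+ 2 <= 2 * Cov * \sum_(i < n) ind (b i) * (ball_mean i - ball_mean i0) ^+ 2.
  apply: le_trans (cauchy_bool _ _ hb) _; first by rewrite mulr_gt0.
  by under eq_bigr do rewrite real_normK ?num_real//.
have E2 : E ^+ 2 <= 2 * Cov * \sum_(i < n) ind (b i) * (eta i x - eta i y) ^+ 2.
  apply: le_trans (cauchy_bool _ _ hb) _; first by rewrite mulr_gt0.
  by under eq_bigr do rewrite real_normK ?num_real//.
have term0 j : (0 <= ((Vi j)^-1 ^+ 2)%:E * ball_variation j * ((eta j x - eta j y) ^+ 2)%:E)%E.
  by rewrite !mule_ge0 ?ball_variation_ge0// lee_fin sqr_ge0.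
set SC := \sum_(i < n) ind (b i) * (ball_mean i - ball_mean i0) ^+ 2 in S2.
have SC0 : 0 <= SC by apply: sumr_ge0 => i _; rewrite mulr_ge0// sqr_ge0.
have step1 : (smoothed x - smoothed y) ^+ 2 <= 4 * (2 * Cov) ^+ 2 * SC * \sum_(i < n) ind (b i) * (eta i x - eta i y) ^+ 2.
  set SE := \sum_(i < n) _ in E2 *.
  have SE0 : 0 <= SE by apply: sumr_ge0 => i _; rewrite mulr_ge0// sqr_ge0.
  rewrite -real_normK ?num_real// (le_trans (lerXn2r 2 _ _ dg))// ?nnegrE ?mulr_ge0//.
    by apply: sumr_ge0 => i _; rewrite mulr_ge0.
  have -> : (S * (2 * E)) ^+ 2 = 4 * (S ^+ 2 * E ^+ 2) by ring.
  have -> : 4 * (2 * Cov) ^+ 2 * SC * SE = 4 * ((2 * Cov * SC) * (2 * Cov * SE)) by ring.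
  by rewrite ler_wpM2l// ler_pM// sqr_ge0.
(* [SC] does not depend on j. Each active ball j bounds it by its own variation, so it can be
   matched with the increment of [eta j], term by term. *)
have stepC (j : 'I_n) : b j -> (SC%:E <= (2 * Cov * (CD ^+ l) ^+ 2)%:E * (((Vi j)^-1 ^+ 2)%:E * ball_variation j))%E.
  move=> bj; rewrite /SC -sumEFin.
  have [p [hp jp]] := ex _ bj.
  have [p0 [hp0 ip0]] := ex _ bi0.
  have [hi0 v_i0] := near_geometry near hp hp0 jp ip0.
  have sj0 := sel_gt0 (andP jp).1; have vj := V_gt0 (pt j) sj0.
  have si0 := sel_gt0 (andP ip0).1; have vi0 := V_gt0 (pt i0) si0.
  set X := (((Vi j)^-1 ^+ 2)%:E * ball_variation j)%E.
  have X0 : (0 <= X)%E by rewrite mule_ge0 ?ball_variation_ge0// lee_fin sqr_ge0.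
  apply: (@le_trans _ _ (\sum_(i < n) ((ind (b i))%:E * (((CD ^+ l) ^+ 2)%:E * X)))%E).
    apply: lee_sum => i _; case: (boolP (b i)) => [bi|_]; last by rewrite mul0r mul0e.
    rewrite mul1r mul1e.
    have [p1 [hp1 ip1]] := ex _ bi.
    have [hi v_i] := near_geometry near hp hp1 jp ip1.
    have si := sel_gt0 (andP ip1).1; have vi := V_gt0 (pt i) si.
    apply: (le_trans (avg_diff (andP ip1).1 (andP ip0).1 hi hi0)).
    rewrite /X muleA -EFinM lee_wpmul2r ?ball_variation_ge0// lee_fin -exprMn expr2.
    have inv k : 0 < Vi k -> Vi j <= CD ^+ l * Vi k -> (Vi k)^-1 <= CD ^+ l * (Vi j)^-1.
      by move=> vk h; rewrite ler_pdivlMr// mulrC ler_pdivrMr.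
    by rewrite ler_pM ?invr_ge0 ?(ltW vi) ?(ltW vi0)// inv.
  rewrite -ge0_sume_distrl; last by move=> i _; rewrite lee_fin.
  rewrite sumEFin [X in (_ <= X * _)%E]EFinM -[leRHS]muleA lee_wpmul2r//.
  by rewrite mule_ge0// lee_fin sqr_ge0.
apply: (@le_trans _ _ (Cnear%:E * \sum_(j < n) (((Vi j)^-1 ^+ 2)%:E * ball_variation j * ((eta j x - eta j y) ^+ 2)%:E))%E); last first.
  apply: lee_wpmul2l; first by rewrite lee_fin Cnear_ge0.
  rewrite -(big_mkord xpredT (fun j => ((Vi j)^-1 ^+ 2)%:E * ball_variation j * ((eta j x - eta j y) ^+ 2)%:E)%E).
  by apply: nneseries_lim_ge.
rewrite -lee_fin in step1; apply: (le_trans step1).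
rewrite mulr_sumr -sumEFin ge0_sume_distrr//.
apply: lee_sum => j _.
case: (boolP (b j)) => [bj|/nb[_ _ -> ->]]; last first.
  by rewrite !subrr !expr0n /= !mulr0 !mule0.
rewrite mul1r EFinM muleA lee_wpmul2r ?lee_fin ?sqr_ge0//.
rewrite EFinM (_ : Cnear = 4 * (2 * Cov) ^+ 2 * (2 * Cov * (CD ^+ l) ^+ 2)); last by rewrite /Cnear; ring.
rewrite [X in (_ <= X * _)%E]EFinM -[leRHS]muleA.
apply: lee_wpmul2l; last exact: stepC.
by rewrite lee_fin mulr_ge0// sqr_ge0.
Qed.

(** * Energy of the smoothed function *)

Definition Ifar : \bar R := (\int[mu \x mu]_z far_kernel z)%E.

(** The weight is V^-2, from two averages, times the bound V / phi for the energy of a cutoff. *)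
Definition Inear : \bar R :=
  (\sum_(j <oo) ((ind (sel j) * (Vi j * phi (s j))^-1)%:E * ball_variation j))%E.

Lemma energy_fun_ge0 (f : T -> R) (z : T * T) : (0 <= ((f z.1 - f z.2) ^+ 2 * J z.1 z.2)%:E)%E.
Proof. by rewrite lee_fin mulr_ge0// sqr_ge0. Qed.

Lemma measurable_energy_fun (f : T -> R) : measurable_fun [set: T] f ->
  measurable_fun [set: T * T] (fun z : T * T => ((f z.1 - f z.2) ^+ 2 * J z.1 z.2)%:E).
Proof.
by move=> mf; apply/measurable_EFinP; apply: measurable_funM => //; exact: measurable_sqdiff.
Qed.

Lemma smooth2_dual (G : T * T -> \bar R) : (forall z, 0 <= G z)%E ->
  measurable_fun [set: T * T] G ->
  (\int[mu \x mu]_z smooth (fun x => smooth (fun y => G (x, y)) z.2) z.1 <=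
   (Cdual ^+ 2)%:E * \int[mu \x mu]_z G z)%E.
Proof.
move=> G0 mG.
have Cdual0 : 0 <= Cdual.
  by rewrite addr_ge0// mulr_ge0// exprn_ge0// ltW// CD_gt0.
pose Phi (z : T * T) := smooth (fun w => G (z.1, w)) z.2.
have Phi0 z : (0 <= Phi z)%E by apply: smooth_ge0.
have msw : measurable_fun [set: T * T] (fun z : T * T => (z.2, z.1)).
  by apply: measurable_fun_pair.
have mPhi : measurable_fun [set: T * T] Phi.
  have := @measurable_smooth (fun z => G (z.2, z.1)) (fun z => G0 _) (measurableT_comp mG msw).
  by move=> /measurableT_comp /(_ msw).
have Psi0 z : (0 <= smooth (fun x => Phi (x, z.2)) z.1)%E by apply: smooth_ge0.
have mPsi := measurable_smooth Phi0 mPhi.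
rewrite (fubini_tonelli1 (m1 := mu) (m2 := mu) (fun z => smooth (fun x => Phi (x, z.2)) z.1))//.
rewrite fubini_tonelli//=.
apply: (@le_trans _ _ (\int[mu]_y (Cdual%:E * \int[mu]_x Phi (x, y)))%E).
  apply: ge0_le_integral => //.
  - by move=> y _; apply: integral_ge0 => x _; exact: (Psi0 (x, y)).
  - exact: (@measurable_fun_fubini_tonelli_G _ _ T T R mu _ mPsi Psi0).
  - apply: emeasurable_funM => //.
    exact: (@measurable_fun_fubini_tonelli_G _ _ T T R mu _ mPhi Phi0).
  - move=> y _; apply: smooth_dual => //.
    exact: (measurableT_comp mPhi (pair2_measurable y)).
rewrite ge0_integralZl//; last 2 first.
- exact: (@measurable_fun_fubini_tonelli_G _ _ T T R mu _ mPhi Phi0).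
- by move=> y _; exact: integral_ge0.
rewrite -(fubini_tonelli Phi mPhi Phi0) expr2 EFinM -muleA lee_wpmul2l ?lee_fin//.
rewrite (fubini_tonelli1 (m1 := mu) (m2 := mu) G)//.
rewrite -ge0_integralZl//; last 2 first.
- exact: (@measurable_fun_fubini_tonelli_F _ _ T T R mu _ mG G0).
- by move=> x _; exact: integral_ge0.
apply: ge0_le_integral => //.
- by move=> x _; exact: integral_ge0.
- exact: (@measurable_fun_fubini_tonelli_F _ _ T T R mu _ mPhi Phi0).
- by apply: emeasurable_funM => //; exact: (@measurable_fun_fubini_tonelli_F _ _ T T R mu _ mG G0).
- move=> x _.
  exact: (smooth_dual (fun w => G0 (x, w)) (measurableT_comp mG (pair1_measurable x))).
Qed.

(* Pairs far apart relative to the scale are handled by applying Jensen to both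
   averages and then duality; for close pairs the difference is controlled by the
   increments of the cutoffs, weighted by the oscillation of u near them. *)
Lemma smoothing_energy :
  (energy smoothed <= (Cfar * Cdual ^+ 2)%:E * Ifar + (Cnear * C1)%:E * Inear)%E.
Proof.
have Cfar0 : 0 <= Cfar by rewrite mulr_ge0 ?exprn_ge0 ?(ltW CD_gt0) ?(ltW K_gt0).
pose F1 (z : T * T) := smooth (fun x => smooth (fun y => far_kernel (x, y)) z.2) z.1.
pose t j (z : T * T) := (((Vi j)^-1 ^+ 2)%:E * ball_variation j * ((eta j z.1 - eta j z.2) ^+ 2 * J z.1 z.2)%:E)%E.
pose F2 z := (\sum_(j <oo) t j z)%E.
have t0 j z : (0 <= t j z)%E.
  by rewrite /t mule_ge0 ?energy_fun_ge0// mule_ge0 ?ball_variation_ge0// lee_fin sqr_ge0.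
have mt j : measurable_fun [set: T * T] (t j).
  by apply: emeasurable_funM => //; exact: measurable_energy_fun.
have F20 z : (0 <= F2 z)%E by apply: nneseries_ge0.
have mF2 : measurable_fun [set: T * T] F2 by apply: ge0_emeasurable_sum.
have F10 z : (0 <= F1 z)%E by apply: smooth_ge0 => x; apply: smooth_ge0 => y; exact: far_kernel_ge0.
have mF1 : measurable_fun [set: T * T] F1.
  have msw : measurable_fun [set: T * T] (fun z : T * T => (z.2, z.1)).
    by apply: measurable_fun_pair.
  have mPhi : measurable_fun [set: T * T] (fun z : T * T => smooth (fun w => far_kernel (z.1, w)) z.2).
    have := @measurable_smooth (fun z => far_kernel (z.2, z.1)) (fun z => far_kernel_ge0 _) (measurableT_comp measurable_far_kernel msw).
    by move=> /measurableT_comp /(_ msw).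
  by apply: (measurable_smooth _ mPhi) => z; apply: smooth_ge0 => w; exact: far_kernel_ge0.
apply: (@le_trans _ _ (\int[mu \x mu]_z (Cfar%:E * F1 z + Cnear%:E * F2 z))%E).
  apply: ge0_le_integral => //.
  - by move=> z _; exact: energy_fun_ge0.
  - by apply: measurable_energy_fun; exact: measurable_smoothed.
  - by apply: emeasurable_funD; apply: emeasurable_funM.
  - move=> [x y] _ /=.
    have [<-|/eqP xy] := eqVneq x y.
      rewrite subrr expr0n mul0r adde_ge0// mule_ge0// lee_fin//; exact: Cnear_ge0.
    have [far|near] := lerP (16 * A * Num.max (rho x) (rho y)) (dd x y).
      apply: (le_trans (far_bound xy far)); rewrite leeDl// mule_ge0// lee_fin; exact: Cnear_ge0.
    rewrite -[leLHS]add0e leeD// ?mule_ge0 ?lee_fin//.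
    rewrite EFinM; apply: (le_trans (lee_wpmul2r _ (near_bound near))); first by rewrite lee_fin.
    rewrite -muleA lee_wpmul2l ?lee_fin ?Cnear_ge0// muleC.
    rewrite -nneseriesZl; last first.
      by move=> j _; rewrite !mule_ge0 ?ball_variation_ge0// lee_fin sqr_ge0.
    apply: lee_nneseries => j _.
      by rewrite !mule_ge0 ?ball_variation_ge0// lee_fin// sqr_ge0.
    by rewrite /t /= muleCA -EFinM [J x y * _]mulrC.
rewrite ge0_integralD//; last 4 first.
- by move=> z _; rewrite mule_ge0// lee_fin.
- exact: emeasurable_funM.
- by move=> z _; rewrite mule_ge0// lee_fin Cnear_ge0.
- exact: emeasurable_funM.
rewrite !ge0_integralZl//; last by rewrite lee_fin Cnear_ge0.
apply: leeD.
  rewrite [X in (_ <= X * _)%E]EFinM -[leRHS]muleA; apply: lee_wpmul2l => //.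
  by apply: smooth2_dual; [exact: far_kernel_ge0|exact: measurable_far_kernel].
rewrite [X in (_ <= X * _)%E]EFinM -[leRHS]muleA.
apply: lee_wpmul2l; first by rewrite lee_fin Cnear_ge0.
rewrite integral_nneseries// /Inear -nneseriesZl; last first.
  move=> j _; rewrite mule_ge0 ?ball_variation_ge0// lee_fin; case: (boolP (sel j)) => [/sel_gt0 sj|_].
    by rewrite mul1r invr_ge0 ltW// Vphi_gt0.
  by rewrite mul0r.
apply: lee_nneseries => j _; first by move=> _; exact: integral_ge0.
rewrite /t ge0_integralZl//; last 3 first.
- by apply: measurable_energy_fun.
- by move=> z _; exact: energy_fun_ge0.
- by rewrite mule_ge0 ?ball_variation_ge0// lee_fin sqr_ge0.
case: (boolP (sel j)) => [sj|nsj]; last first.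
  rewrite (_ : (\int[_]_x _)%E = 0%E); last first.
    by apply: integral0_eq => z _; rewrite !eta0 ?subrr ?expr0n ?mul0r// /actA (negbTE nsj).
  by rewrite mule0 mul0r mul0e mule0.
have s0 := sel_gt0 sj; have v0 := V_gt0 (pt j) s0; have p0 := phi_gt0 s0.
apply: (@le_trans _ _ (((Vi j)^-1 ^+ 2)%:E * ball_variation j * (C1 * (Vi j / phi (s j)))%:E)%E).
  rewrite lee_wpmul2l//; last exact: eta_energy.
  by rewrite mule_ge0 ?ball_variation_ge0// lee_fin sqr_ge0.
rewrite mul1r muleA -EFinM muleAC -EFinM.
rewrite (_ : (Vi j)^-1 ^+ 2 * (C1 * (Vi j / phi (s j))) = C1 * (Vi j * phi (s j))^-1)//.
by field; rewrite !gt_eqF.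
Qed.

(** * Functions supported in a set where the scale may degenerate *)

Section Support.
Variables (D : T -> bool) (t : R).
Hypothesis mD : measurable_fun [set: T] D.
Hypothesis t_gt0 : 0 < t.
Hypothesis u_out : forall y, ~~ D y -> u y = 0.
Hypothesis rho_out : forall y, ~~ D y -> t <= rho y.

Definition energyD : \bar R := (\int[mu \x mu]_z
  (ind (D z.1 && D z.2) * ((u z.1 - u z.2) ^+ 2 * J z.1 z.2))%:E)%E.

Definition L2sq : \bar R := (\int[mu]_y (u y ^+ 2)%:E)%E.

Let mDD : measurable_fun [set: T * T] (fun z : T * T => D z.1 && D z.2).
Proof.
apply: measurable_and.
  exact: (measurableT_comp mD measurable_fst).
exact: (measurableT_comp mD measurable_snd).
Qed.

Let mu2 : measurable_fun [set: T] (fun y => (u y ^+ 2)%:E).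
Proof. by apply/measurable_EFinP; exact: measurable_funX. Qed.

Let mu2_1 : measurable_fun [set: T * T] (fun z : T * T => u z.1 ^+ 2).
Proof. by apply: measurable_funX; exact: (measurableT_comp mu_ measurable_fst). Qed.

Let mu2_2 : measurable_fun [set: T * T] (fun z : T * T => u z.2 ^+ 2).
Proof. by apply: measurable_funX; exact: (measurableT_comp mu_ measurable_snd). Qed.

Let fD_ge0 (z : T * T) : (0 <= (ind (D z.1 && D z.2) * ((u z.1 - u z.2) ^+ 2 * J z.1 z.2))%:E)%E.
Proof. by rewrite lee_fin; apply: mulr_ge0 => //; rewrite mulr_ge0// sqr_ge0. Qed.

Let mfD : measurable_fun [set: T * T]
  (fun z : T * T => (ind (D z.1 && D z.2) * ((u z.1 - u z.2) ^+ 2 * J z.1 z.2))%:E).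
Proof.
apply/measurable_EFinP; apply: measurable_funM; first exact: measurable_bool_natr.
by apply: measurable_funM => //; exact: measurable_sqdiff.
Qed.

Lemma L2sq_ge0 : (0 <= L2sq)%E.
Proof. by apply: integral_ge0 => y _; rewrite lee_fin sqr_ge0. Qed.

Lemma energyD_ge0 : (0 <= energyD)%E.
Proof. by apply: integral_ge0 => z _; exact: fD_ge0. Qed.

Lemma Ctail_ge0 : 0 <= Ctail.
Proof.
have /andP[_ q1] := q01.
by rewrite divr_ge0 ?subr_ge0 ?(ltW q1)// mulr_ge0 ?exprn_ge0 ?(ltW K_gt0) ?(ltW CD_gt0).
Qed.

Lemma tail_mass : 
  (\int[mu \x mu]_z (u z.1 ^+ 2 * (ind (t <= dd z.1 z.2) * J z.1 z.2))%:E <=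
   (Ctail / phi t)%:E * L2sq)%E.
Proof.
have mtJ : measurable_fun [set: T * T] (fun z : T * T => ind (t <= dd z.1 z.2) * J z.1 z.2).
  apply: measurable_funM => //; apply: measurable_bool_natr.
  exact: measurable_fun_ler.
have mF : measurable_fun [set: T * T]
    (fun z : T * T => (u z.1 ^+ 2 * (ind (t <= dd z.1 z.2) * J z.1 z.2))%:E).
  by apply/measurable_EFinP; exact: measurable_funM.
have F0 (z : T * T) : (0 <= (u z.1 ^+ 2 * (ind (t <= dd z.1 z.2) * J z.1 z.2))%:E)%E.
  by rewrite lee_fin; apply: mulr_ge0; [rewrite sqr_ge0|rewrite mulr_ge0].
have C0 : 0 <= Ctail / phi t by rewrite divr_ge0 ?Ctail_ge0// ltW ?phi_gt0.
rewrite (fubini_tonelli1 (m1 := mu) (m2 := mu) _ mF F0).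
rewrite /L2sq -ge0_integralZl//; last by move=> y _; rewrite lee_fin sqr_ge0.
apply: ge0_le_integral => //.
- by move=> x _; apply: integral_ge0 => y _; exact: (F0 (x, y)).
- exact: (@measurable_fun_fubini_tonelli_F _ _ T T R mu _ mF F0).
- by apply: emeasurable_funM.
- move=> x _; rewrite /fubini_F /=.
  under eq_integral do rewrite EFinM.
  rewrite ge0_integralZl//; last 3 first.
  + apply/measurable_EFinP; exact: (measurableT_comp mtJ (pair1_measurable x)).
  + by move=> y _; rewrite lee_fin mulr_ge0.
  + by rewrite lee_fin sqr_ge0.
  by rewrite muleC lee_wpmul2r ?lee_fin ?sqr_ge0// J_tail.
Qed.

Lemma tail_mass2 : 
  (\int[mu \x mu]_z (u z.2 ^+ 2 * (ind (t <= dd z.1 z.2) * J z.1 z.2))%:E <=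
   (Ctail / phi t)%:E * L2sq)%E.
Proof.
apply: le_trans tail_mass.
have mtJ : measurable_fun [set: T * T] (fun z : T * T => ind (t <= dd z.1 z.2) * J z.1 z.2).
  apply: measurable_funM => //; apply: measurable_bool_natr.
  exact: measurable_fun_ler.
have m1 : measurable_fun [set: T * T]
    (fun z : T * T => (u z.1 ^+ 2 * (ind (t <= dd z.1 z.2) * J z.1 z.2))%:E).
  by apply/measurable_EFinP; exact: measurable_funM.
have m2 : measurable_fun [set: T * T]
    (fun z : T * T => (u z.2 ^+ 2 * (ind (t <= dd z.1 z.2) * J z.1 z.2))%:E).
  by apply/measurable_EFinP; exact: measurable_funM.
have F1 (z : T * T) : (0 <= (u z.1 ^+ 2 * (ind (t <= dd z.1 z.2) * J z.1 z.2))%:E)%E.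
  by rewrite lee_fin; apply: mulr_ge0; [rewrite sqr_ge0|rewrite mulr_ge0].
have F2 (z : T * T) : (0 <= (u z.2 ^+ 2 * (ind (t <= dd z.1 z.2) * J z.1 z.2))%:E)%E.
  by rewrite lee_fin; apply: mulr_ge0; [rewrite sqr_ge0|rewrite mulr_ge0].
rewrite (fubini_tonelli1 (m1 := mu) (m2 := mu) _ m1 F1).
rewrite (fubini_tonelli1 (m1 := mu) (m2 := mu) _ m2 F2).
rewrite /fubini_F (fubini_tonelli (m1 := mu) (m2 := mu) _ m2 F2) /=.
by under eq_integral => x _ do under eq_integral => y _ do rewrite dd_sym J_sym.
Qed.

(** If one of the points lies outside [D], then [u] vanishes there, and its scale, which is at least
    t, bounds the distance from below in [far_kernel]. Such pairs are absorbed by the tail of the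
    kernel. *)
Lemma Ifar_le : (Ifar <= energyD + (2 * (Ctail / phi t))%:E * L2sq)%E.
Proof.
have C0 : 0 <= Ctail / phi t by rewrite divr_ge0 ?Ctail_ge0// ltW ?phi_gt0.
have mtJ : measurable_fun [set: T * T] (fun z : T * T => ind (t <= dd z.1 z.2) * J z.1 z.2).
  apply: measurable_funM => //; apply: measurable_bool_natr.
  exact: measurable_fun_ler.
pose f1 (z : T * T) := (u z.1 ^+ 2 * (ind (t <= dd z.1 z.2) * J z.1 z.2))%:E.
pose f2 (z : T * T) := (u z.2 ^+ 2 * (ind (t <= dd z.1 z.2) * J z.1 z.2))%:E.
have m1 : measurable_fun [set: T * T] f1.
  by apply/measurable_EFinP; exact: measurable_funM.
have m2 : measurable_fun [set: T * T] f2.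
  by apply/measurable_EFinP; exact: measurable_funM.
have F1 z : (0 <= f1 z)%E.
  by rewrite lee_fin; apply: mulr_ge0; [rewrite sqr_ge0|rewrite mulr_ge0].
have F2 z : (0 <= f2 z)%E.
  by rewrite lee_fin; apply: mulr_ge0; [rewrite sqr_ge0|rewrite mulr_ge0].
have -> : 2 * (Ctail / phi t) = Ctail / phi t + Ctail / phi t by ring.
rewrite EFinD ge0_muleDl ?lee_fin//.
apply: (@le_trans _ _ (energyD + (\int[mu \x mu]_z f1 z + \int[mu \x mu]_z f2 z))%E); last first.
  by rewrite leeD2l// leeD ?tail_mass ?tail_mass2.
rewrite -ge0_integralD//.
rewrite /energyD -ge0_integralD//; last 2 first.
- by move=> z _; rewrite adde_ge0.
- exact: emeasurable_funD.
apply: ge0_le_integral => //.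
- by move=> z _; exact: far_kernel_ge0.
- exact: measurable_far_kernel.
- by apply: emeasurable_funD => //; exact: emeasurable_funD.
- move=> [x y] _; rewrite /far_kernel /f1 /f2 /= -!EFinD lee_fin.
  have Jxy := J_ge0 x y.
  have cmp (b : bool) : (b -> t <= dd x y) -> forall X, 0 <= X -> ind b * X <= ind (t <= dd x y) * X.
    by move=> hb X X0; rewrite ler_wpM2r//; case: b hb => //= ->.
  have [Dx|Dx] := boolP (D x); have [Dy|Dy] := boolP (D y) => /=.
  + rewrite mul1r; apply: ler_wpDr.
    * by apply: addr_ge0; (apply: mulr_ge0; [rewrite sqr_ge0|rewrite mulr_ge0]).
    * by apply: ler_piMl; [rewrite mulr_ge0 ?sqr_ge0|rewrite lern1 leq_b1].
  + rewrite (u_out Dy) subr0 mul0r add0r expr0n mul0r addr0 mulrCA.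
    rewrite ler_wpM2l ?sqr_ge0//; apply: cmp => //.
    by rewrite ge_max => /andP[_ h]; apply: le_trans (rho_out Dy) h.
  + rewrite (u_out Dx) sub0r sqrrN mul0r add0r expr0n mul0r add0r mulrCA.
    rewrite ler_wpM2l ?sqr_ge0//; apply: cmp => //.
    by rewrite ge_max => /andP[h _]; apply: le_trans (rho_out Dx) h.
  + by rewrite (u_out Dx) (u_out Dy) subrr !expr0n !mul0r mulr0 !addr0.
Qed.

Definition CJ := CD ^+ l.+2 * K ^+ l.+3.
Definition Cm := K ^+ 2 * CD ^+ l.

Lemma CJ_ge0 : 0 <= CJ. Proof. by rewrite mulr_ge0 ?exprn_ge0 ?(ltW CD_gt0) ?(ltW K_gt0). Qed.
Lemma Cm_ge0 : 0 <= Cm. Proof. by rewrite mulr_ge0 ?exprn_ge0 ?(ltW CD_gt0) ?(ltW K_gt0). Qed.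

Let w j := ind (sel j) * (Vi j * phi (s j))^-1.

Let w_ge0 j : 0 <= w j.
Proof.
rewrite /w; case: (boolP (sel j)) => [/sel_gt0 sj|_]; last by rewrite mul0r.
by rewrite mul1r invr_ge0 ltW// Vphi_gt0.
Qed.

Let e1 j (z : T * T) : \bar R := 
  (CJ%:E * ((ind (act j z.1))%:E * (ind (D z.1 && D z.2) * ((u z.1 - u z.2) ^+ 2 * J z.1 z.2))%:E))%E.

Let e1_ge0 j z : (0 <= e1 j z)%E.
Proof.
apply: mule_ge0; first by rewrite lee_fin CJ_ge0.
by apply: mule_ge0; [rewrite lee_fin|exact: fD_ge0].
Qed.

Let mact1 j : measurable_fun [set: T * T] (fun z : T * T => ind (act j z.1)).
Proof.
by apply: measurable_bool_natr; exact: (measurableT_comp (measurable_act j) measurable_fst).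
Qed.

Let mact2 j : measurable_fun [set: T * T] (fun z : T * T => ind (act j z.2)).
Proof.
by apply: measurable_bool_natr; exact: (measurableT_comp (measurable_act j) measurable_snd).
Qed.

Let me1 j : measurable_fun [set: T * T] (e1 j).
Proof.
by apply: emeasurable_funM => //; apply: emeasurable_funM => //; exact/measurable_EFinP.
Qed.

Lemma act_mass j :
  (\int[mu \x mu]_z (ind (act j z.1) * ind (act j z.2) * u z.1 ^+ 2)%:E <=
   (V (pt j) (L * s j))%:E * \int[mu]_y ((ind (act j y))%:E * (u y ^+ 2)%:E))%E.
Proof.
have mF : measurable_fun [set: T * T]
    (fun z : T * T => (ind (act j z.1) * ind (act j z.2) * u z.1 ^+ 2)%:E).
  by apply/measurable_EFinP; apply: measurable_funM => //; exact: measurable_funM.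
have F0 (z : T * T) : (0 <= (ind (act j z.1) * ind (act j z.2) * u z.1 ^+ 2)%:E)%E.
  by rewrite lee_fin; apply: mulr_ge0; [rewrite mulr_ge0|rewrite sqr_ge0].
have ma : measurable_fun [set: T] (fun y => ind (act j y)).
  by apply: measurable_bool_natr; exact: measurable_act.
have [sj|nsj] := boolP (sel j); last first.
  rewrite integral0_eq; last by move=> z _; rewrite /act (negbTE nsj) !mul0r.
  rewrite integral0_eq ?mule0// => z _; by rewrite /act (negbTE nsj) mul0e.
have s0 := sel_gt0 sj; have L1 := L_ge1; have Ls : 0 < L * s j by rewrite mulr_gt0//; lra.
rewrite (fubini_tonelli1 (m1 := mu) (m2 := mu) _ mF F0) -ge0_integralZl//; last 3 first.
- by apply: emeasurable_funM => //; exact/measurable_EFinP.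
- by move=> y _; rewrite mule_ge0 ?lee_fin ?sqr_ge0.
- by rewrite lee_fin ltW ?V_gt0.
apply: ge0_le_integral => //.
- by move=> x _; apply: integral_ge0 => y _; exact: (F0 (x, y)).
- exact: (@measurable_fun_fubini_tonelli_F _ _ T T R mu _ mF F0).
- by apply: emeasurable_funM => //; apply: emeasurable_funM => //; exact/measurable_EFinP.
- move=> x _; rewrite /fubini_F /=.
  under eq_integral do rewrite mulrAC EFinM.
  rewrite ge0_integralZl//; try by [exact/measurable_EFinP |
    rewrite lee_fin; apply: mulr_ge0; [|rewrite sqr_ge0]].
  rewrite muleC EFinM lee_wpmul2r//; first by apply: mule_ge0; rewrite lee_fin ?sqr_ge0.
  rewrite integral_bool_natr; last exact: measurable_act.
  by rewrite /act sj /= muV.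
Qed.

Lemma act_mass2 j :
  (\int[mu \x mu]_z (ind (act j z.1) * ind (act j z.2) * u z.2 ^+ 2)%:E <=
   (V (pt j) (L * s j))%:E * \int[mu]_y ((ind (act j y))%:E * (u y ^+ 2)%:E))%E.
Proof.
apply: le_trans (act_mass j).
have m1 : measurable_fun [set: T * T]
    (fun z : T * T => (ind (act j z.1) * ind (act j z.2) * u z.1 ^+ 2)%:E).
  by apply/measurable_EFinP; apply: measurable_funM => //; exact: measurable_funM.
have m2 : measurable_fun [set: T * T]
    (fun z : T * T => (ind (act j z.1) * ind (act j z.2) * u z.2 ^+ 2)%:E).
  by apply/measurable_EFinP; apply: measurable_funM => //; exact: measurable_funM.
have F1 (z : T * T) : (0 <= (ind (act j z.1) * ind (act j z.2) * u z.1 ^+ 2)%:E)%E.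
  by rewrite lee_fin; apply: mulr_ge0; [rewrite mulr_ge0|rewrite sqr_ge0].
have F2 (z : T * T) : (0 <= (ind (act j z.1) * ind (act j z.2) * u z.2 ^+ 2)%:E)%E.
  by rewrite lee_fin; apply: mulr_ge0; [rewrite mulr_ge0|rewrite sqr_ge0].
rewrite (fubini_tonelli1 (m1 := mu) (m2 := mu) _ m1 F1).
rewrite (fubini_tonelli1 (m1 := mu) (m2 := mu) _ m2 F2).
rewrite /fubini_F (fubini_tonelli (m1 := mu) (m2 := mu) _ m2 F2) /=.
by under eq_integral => x _ do under eq_integral => y _ do rewrite [ind (act j _) * _]mulrC.
Qed.

(** A pair inside [D] is charged to the energy through [J_low]. Otherwise the enlarged ball contains
    a point of scale at least t, so s j >= 2 t / 3 and 1 / phi(s j) is at most K^2 / phi(t); the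
    pair is charged to the L2 norm, as (u x - u y)^2 <= u x^2 + u y^2 for nonnegative u. *)
Lemma weighted_ball_variation_le j : ((w j)%:E * ball_variation j <= \int[mu \x mu]_z e1 j z +
  (2 * Cm / phi t)%:E * \int[mu]_y ((ind (act j y))%:E * (u y ^+ 2)%:E))%E.
Proof.
have I0 : (0 <= \int[mu]_y ((ind (act j y))%:E * (u y ^+ 2)%:E))%E.
  by apply: integral_ge0 => y _; rewrite mule_ge0 ?lee_fin ?sqr_ge0.
have E0 : (0 <= \int[mu \x mu]_z e1 j z)%E by apply: integral_ge0.
have C0 : 0 <= 2 * Cm / phi t.
  by apply: divr_ge0; [apply: mulr_ge0 => //; exact: Cm_ge0|rewrite ltW// phi_gt0].
have [sj|nsj] := boolP (sel j); last by rewrite /w (negbTE nsj) mul0r mul0e adde_ge0// mule_ge0.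
have s0 := sel_gt0 sj; have v0 := V_gt0 (pt j) s0; have p0 := phi_gt0 s0.
have pt0 := phi_gt0 t_gt0.
pose w' := K ^+ 2 / (Vi j * phi t).
have w'0 : 0 <= w' by rewrite divr_ge0 ?exprn_ge0 ?(ltW K_gt0)// ltW// mulr_gt0.
pose f1 (z : T * T) := (ind (act j z.1) * ind (act j z.2) * u z.1 ^+ 2)%:E.
pose f2 (z : T * T) := (ind (act j z.1) * ind (act j z.2) * u z.2 ^+ 2)%:E.
have m1 : measurable_fun [set: T * T] f1.
  by apply/measurable_EFinP; apply: measurable_funM => //; exact: measurable_funM.
have m2 : measurable_fun [set: T * T] f2.
  by apply/measurable_EFinP; apply: measurable_funM => //; exact: measurable_funM.
have F1 z : (0 <= f1 z)%E.
  by rewrite lee_fin; apply: mulr_ge0; [rewrite mulr_ge0|rewrite sqr_ge0].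
have F2 z : (0 <= f2 z)%E.
  by rewrite lee_fin; apply: mulr_ge0; [rewrite mulr_ge0|rewrite sqr_ge0].
have step : ((w j)%:E * ball_variation j <= \int[mu \x mu]_z (e1 j z + w'%:E * (f1 z + f2 z)))%E.
  rewrite /ball_variation -ge0_integralZl//; last 3 first.
  - exact: measurable_ball_variation.
  - by move=> z _; exact: ball_variation_fun_ge0.
  - by rewrite lee_fin.
  apply: ge0_le_integral => //.
  - by move=> z _; rewrite mule_ge0 ?lee_fin//; exact: ball_variation_fun_ge0.
  - by apply: emeasurable_funM => //; exact: measurable_ball_variation.
  - by apply: emeasurable_funD => //; apply: emeasurable_funM => //; exact: emeasurable_funD.
  - move=> [x y] _.
    have R0 : (0 <= w'%:E * (f1 (x, y) + f2 (x, y)))%E by apply: mule_ge0; [rewrite lee_fin|exact: adde_ge0].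
    have RHS0 := adde_ge0 (e1_ge0 j (x, y)) R0.
    have zero X : X = 0%E -> ((w j)%:E * X <= e1 j (x, y) + w'%:E * (f1 (x, y) + f2 (x, y)))%E.
      by move=> ->; rewrite mule0.
    have [xy|/eqP xy] := eqVneq x y.
      by apply: zero; rewrite /= xy subrr expr0n mulr0.
    have [ax|ax] := boolP (act j x); last by apply: zero; rewrite /= !mul0r.
    have [ay|ay] := boolP (act j y); last by apply: zero; rewrite /= mulr0 mul0r.
    have sq : (u x - u y) ^+ 2 <= u x ^+ 2 + u y ^+ 2.
      by have := mulr_ge0 (u_ge0 x) (u_ge0 y); nra.
    have small : ~~ (D x && D y) -> w j <= w'.
      move=> nD; have [y0 [ay0 Dy0]] : exists y0, act j y0 /\ ~~ D y0.
        by move: nD; rewrite negb_and => /orP[h|h]; [exists x|exists y].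
      have /andP[h1 h2] := act_rho ay0; have h3 := rho_out Dy0.
      have ph : phi t <= K ^+ 2 * phi (s j) by apply: phi_cmp => //; rewrite expr1; lra.
      rewrite /w sj mul1r /w' ler_pdivlMr ?mulr_gt0// mulrC ler_pdivrMr ?mulr_gt0//.
      by rewrite mulrCA ler_wpM2l// ltW.
    have [Dxy|nD] := boolP (D x && D y); last first.
      rewrite -[leLHS]add0e leeD// /f1 /f2 /= ?ax ?ay !mul1r -EFinD -!EFinM lee_fin.
      by rewrite ler_pM ?sqr_ge0 ?small.
    rewrite -[leLHS]adde0 leeD// /e1 /= ?ax ?ay ?Dxy !mul1r mul1e -!EFinM lee_fin.
    rewrite [leRHS]mulrCA [leLHS]mulrC ler_wpM2l ?sqr_ge0// /w sj mul1r.
    by apply: (J_low (o := pt j)) => //; rewrite -LE; [case/andP: ax|case/andP: ay].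
apply: (le_trans step).
rewrite ge0_integralD//; last 2 first.
- by move=> z _; apply: mule_ge0; [rewrite lee_fin|exact: adde_ge0].
- by apply: emeasurable_funM => //; exact: emeasurable_funD.
rewrite leeD2l// ge0_integralZl//; last 2 first.
- exact: emeasurable_funD.
- by move=> z _; rewrite adde_ge0.
rewrite ge0_integralD//.
apply: (@le_trans _ _ (w'%:E * ((V (pt j) (L * s j))%:E * \int[mu]_y ((ind (act j y))%:E * (u y ^+ 2)%:E) +
  (V (pt j) (L * s j))%:E * \int[mu]_y ((ind (act j y))%:E * (u y ^+ 2)%:E)))%E).
  by rewrite lee_wpmul2l ?lee_fin// leeD ?act_mass ?act_mass2.
have VL : V (pt j) (L * s j) <= CD ^+ l * Vi j by rewrite LE V_iter.
have VL0 : 0 <= V (pt j) (L * s j) by rewrite ltW// V_gt0// mulr_gt0//; have := L_ge1; lra.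
rewrite -ge0_muleDl ?lee_fin// -EFinD muleA -EFinM lee_wpmul2r// lee_fin.
rewrite (_ : 2 * Cm / phi t = w' * (CD ^+ l * Vi j + CD ^+ l * Vi j)); last first.
  by rewrite /Cm /w'; field; rewrite !gt_eqF.
by rewrite ler_wpM2l// lerD.
Qed.

Lemma Inear_le : (Inear <= (CJ * Cov)%:E * energyD + (2 * Cm * Cov / phi t)%:E * L2sq)%E.
Proof.
have C0 : 0 <= 2 * Cm / phi t.
  by apply: divr_ge0; [apply: mulr_ge0 => //; exact: Cm_ge0|rewrite ltW// phi_gt0].
have I0 j : (0 <= \int[mu]_y ((ind (act j y))%:E * (u y ^+ 2)%:E))%E.
  by apply: integral_ge0 => y _; rewrite mule_ge0 ?lee_fin ?sqr_ge0.
have ma j : measurable_fun [set: T] (fun y => ((ind (act j y))%:E * (u y ^+ 2)%:E)%E).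
  apply: emeasurable_funM => //; apply/measurable_EFinP/measurable_bool_natr.
  exact: measurable_act.
apply: (@le_trans _ _ (\sum_(j <oo) (\int[mu \x mu]_z e1 j z +
  (2 * Cm / phi t)%:E * \int[mu]_y ((ind (act j y))%:E * (u y ^+ 2)%:E)))%E).
  apply: lee_nneseries => j _; last exact: weighted_ball_variation_le.
  by move=> _; rewrite mule_ge0 ?ball_variation_ge0// lee_fin; exact: w_ge0.
rewrite nneseriesD; last 2 first.
- by move=> j _ _; apply: integral_ge0.
- by move=> j _ _; rewrite mule_ge0 ?lee_fin.
apply: leeD.
  rewrite -integral_nneseries// /energyD -ge0_integralZl//; last first.
    by rewrite lee_fin mulr_ge0 ?CJ_ge0// ltW// Cov_gt0.
  apply: ge0_le_integral => //.
  - by move=> z _; apply: nneseries_ge0.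
  - by apply: ge0_emeasurable_sum.
  - by apply: emeasurable_funM.
  - move=> z _; rewrite /e1 nneseriesZl; last first.
      by move=> j _; apply: mule_ge0; [rewrite lee_fin|exact: fD_ge0].
    rewrite [X in (_ <= X * _)%E]EFinM -[leRHS]muleA.
    apply: lee_wpmul2l; first by rewrite lee_fin CJ_ge0.
    exact: (@sum_ind_le (fun=> _)).
rewrite nneseriesZl//.
rewrite (_ : 2 * Cm * Cov / phi t = 2 * Cm / phi t * Cov); last by ring.
rewrite [X in (_ <= X * _)%E]EFinM -[leRHS]muleA; apply: lee_wpmul2l; first by rewrite lee_fin.
rewrite -integral_nneseries//; last first.
  by move=> j y _; rewrite mule_ge0 ?lee_fin ?sqr_ge0.
rewrite /L2sq -ge0_integralZl//; last 2 first.
- by move=> y _; rewrite lee_fin sqr_ge0.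
- by rewrite lee_fin ltW// Cov_gt0.
apply: ge0_le_integral => //.
- by move=> z _; apply: nneseries_ge0 => j _ _; rewrite mule_ge0 ?lee_fin ?sqr_ge0.
- by apply: ge0_emeasurable_sum => // j y _ _; rewrite mule_ge0 ?lee_fin ?sqr_ge0.
- by apply: emeasurable_funM.
- by move=> y _; apply: (@sum_ind_le (fun y => (u y ^+ 2)%:E)); rewrite lee_fin sqr_ge0.
Qed.

Lemma lee_combine (a1 a2 b1 b2 b3 : R) (x y : \bar R) : 0 <= a1 -> 0 <= a2 -> 0 <= b1 ->
  0 <= b2 -> 0 <= b3 -> (0 <= x)%E -> (0 <= y)%E ->
  (a1%:E * (x + b1%:E * y) + a2%:E * (b2%:E * x + b3%:E * y) =
   (a1 + a2 * b2)%:E * x + (a1 * b1 + a2 * b3)%:E * y)%E.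
Proof.
move=> a10 a20 b10 b20 b30 x0 y0.
have h (b : R) z : 0 <= b -> (0 <= z)%E -> (0 <= b%:E * z)%E.
  by move=> b0 z0; rewrite mule_ge0// lee_fin.
rewrite (ge0_muleDr _ x0 (h _ _ b10 y0)) (ge0_muleDr _ (h _ _ b20 x0) (h _ _ b30 y0)).
rewrite addeACA !muleA -!EFinM [in RHS]EFinD ge0_muleDl ?lee_fin ?mulr_ge0//.
by congr (_ + _)%E; rewrite EFinD ge0_muleDl ?lee_fin ?mulr_ge0.
Qed.

Definition Csmooth1 := Cfar * Cdual ^+ 2 + Cnear * C1 * (CJ * Cov).
Definition Csmooth2 := Cfar * Cdual ^+ 2 * (2 * Ctail) + Cnear * C1 * (2 * Cm * Cov).

Lemma energy_smoothed_le : (energy smoothed <= Csmooth1%:E * energyD + (Csmooth2 / phi t)%:E * L2sq)%E.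
Proof.
have pt0 := phi_gt0 t_gt0.
have a1 : 0 <= Cfar * Cdual ^+ 2.
  rewrite mulr_ge0 ?sqr_ge0// /Cfar.
  by rewrite mulr_ge0 ?exprn_ge0 ?(ltW CD_gt0) ?(ltW K_gt0).
have a2 : 0 <= Cnear * C1 by rewrite mulr_ge0 ?Cnear_ge0.
apply: (le_trans smoothing_energy).
apply: (@le_trans _ _ ((Cfar * Cdual ^+ 2)%:E * (energyD + (2 * (Ctail / phi t))%:E * L2sq) +
  (Cnear * C1)%:E * ((CJ * Cov)%:E * energyD + (2 * Cm * Cov / phi t)%:E * L2sq))%E).
  by apply: leeD; rewrite lee_wpmul2l ?lee_fin// ?Ifar_le ?Inear_le.
have m0 := L2sq_ge0; have e0 := energyD_ge0.
have b1 : 0 <= 2 * (Ctail / phi t) by rewrite mulr_ge0// divr_ge0 ?Ctail_ge0// ltW.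
have b2 : 0 <= CJ * Cov by rewrite mulr_ge0 ?CJ_ge0// ltW// Cov_gt0.
have b3 : 0 <= 2 * Cm * Cov / phi t.
  by rewrite divr_ge0 ?(ltW pt0)// mulr_ge0 ?(ltW Cov_gt0)// mulr_ge0 ?Cm_ge0.
rewrite lee_combine// /Csmooth1.
have -> : Cfar * Cdual ^+ 2 * (2 * (Ctail / phi t)) + Cnear * C1 * (2 * Cm * Cov / phi t) = Csmooth2 / phi t.
  by rewrite /Csmooth2; ring.
by [].
Qed.

End Support.

(** Jensen with t = 0 bounds the square by the smoothing of u^2, which vanishes by locality; no mean
    has to be inspected. *)
Lemma smoothed_support y : 0 < rho y ->
  (forall z, dd y z <= 4 * A * rho y -> u z = 0) -> smoothed y = 0.
Proof.
move=> ry hu; have := smooth_jensen y (lexx 0).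
have -> : smooth (fun z => ((u z - 0) ^+ 2)%:E) y = 0%E.
  apply/eqP; rewrite eq_le smooth_ge0 ?andbT; last by move=> z; rewrite lee_fin sqr_ge0.
  apply: (@le_trans _ _ (smooth (fun=> 0%E) y)).
    apply: smooth_mono => //.
    - by move=> z; rewrite lee_fin sqr_ge0.
    - by apply/measurable_EFinP; apply: measurable_funX; apply: measurable_funB.
    - by move=> z /hu ->; rewrite subrr expr0n.
  rewrite /smooth gt_eqF// eseries0// => i _ _.
  by rewrite /avg integral0_eq ?mule0// => z _; rewrite mule0.
rewrite subr0 lee_fin => h; apply/eqP; rewrite -sqrf_eq0 eq_le h.
by rewrite sqr_ge0.
Qed.

(** * Constant scale: approximation in L2 *)

Section ConstantScale.
Variable s0 : R.
Hypothesis s0_gt0 : 0 < s0.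
Hypothesis rhoE : forall y, rho y = s0.

(** Each term is at most 1/V times the variation on its ball, and at constant scale 1/V is phi(s0)
    times the weight in [Inear]. With [Inear] bounded, the factor phi(s0) yields convergence as s0
    tends to 0. *)
Lemma smooth_sqdiff_le : (\int[mu]_y smooth (fun z => ((u z - u y) ^+ 2)%:E) y <= (phi s0)%:E * Inear)%E.
Proof.
have p0 := phi_gt0 s0_gt0.
have pnn : (0 <= phi s0) by exact: ltW.
have mti i : measurable_fun [set: T] (fun y => (theta i y)%:E).
  by apply/measurable_EFinP; exact: measurable_theta.
have mG (i : nat) : measurable_fun [set: T * T] (fun z : T * T =>
    ((ind (dd (pt i) z.2 < s i))%:E * ((u z.2 - u z.1) ^+ 2)%:E)%E).
  apply: emeasurable_funM; first exact: (measurableT_comp (measurable_ind_ball i) measurable_snd).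
  apply/measurable_EFinP; apply: measurable_funX; apply: measurable_funB.
    exact: (measurableT_comp mu_ measurable_snd).
  exact: (measurableT_comp mu_ measurable_fst).
have G0 (i : nat) (z : T * T) :
    (0 <= (ind (dd (pt i) z.2 < s i))%:E * ((u z.2 - u z.1) ^+ 2)%:E)%E.
  by apply: mule_ge0; rewrite lee_fin ?sqr_ge0.
have mavg i : measurable_fun [set: T] (fun y => avg i (fun z => ((u z - u y) ^+ 2)%:E)).
  apply: emeasurable_funM => //.
  exact: (@measurable_fun_fubini_tonelli_F _ _ T T R mu _ (mG i) (G0 i)).
have avg0 i y : (0 <= avg i (fun z => ((u z - u y) ^+ 2)%:E))%E.
  by apply: avg_ge0 => z; rewrite lee_fin sqr_ge0.
have term0 i y : (0 <= (theta i y)%:E * avg i (fun z => ((u z - u y) ^+ 2)%:E))%E.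
  by apply: mule_ge0; rewrite ?lee_fin ?theta_ge0.
rewrite (eq_integral (fun y => \sum_(i <oo) ((theta i y)%:E * avg i (fun z => ((u z - u y) ^+ 2)%:E)))%E); last first.
  by move=> y _; rewrite /smooth rhoE gt_eqF.
rewrite integral_nneseries//; last by move=> i; exact: emeasurable_funM.
rewrite /Inear -nneseriesZl; last first.
  move=> i _; apply: mule_ge0; last exact: ball_variation_ge0.
  by rewrite lee_fin mulr_ge0// invr_ge0 ltW// Vphi_gt0// rhoE.
apply: lee_nneseries => i _; first by move=> _; exact: integral_ge0.
have [si|nsi] := boolP (sel i); last first.
  rewrite integral0_eq; first by rewrite mul0r mul0e mule0.
  by move=> y _; rewrite theta0 ?mul0e// /actA (negbTE nsi).
have v0 : 0 < Vi i by rewrite V_gt0// rhoE.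
rewrite mul1r muleA -EFinM rhoE.
have -> : phi s0 * (V (pt i) s0 * phi s0)^-1 = (V (pt i) s0)^-1.
  by field; rewrite !gt_eqF// -(rhoE (pt i)).
rewrite /ball_variation (fubini_tonelli1 (m1 := mu) (m2 := mu) _ (measurable_ball_variation i) (ball_variation_fun_ge0 i)).
rewrite -ge0_integralZl//; last 3 first.
- exact: (@measurable_fun_fubini_tonelli_F _ _ T T R mu _ (measurable_ball_variation i) (ball_variation_fun_ge0 i)).
- by move=> y _; apply: integral_ge0 => z _; exact: (ball_variation_fun_ge0 i (y, z)).
- by rewrite lee_fin invr_ge0 ltW// -(rhoE (pt i)).
apply: ge0_le_integral => //.
- exact: emeasurable_funM.
- apply: emeasurable_funM => //.
  exact: (@measurable_fun_fubini_tonelli_F _ _ T T R mu _ (measurable_ball_variation i) (ball_variation_fun_ge0 i)).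
- move=> y _; rewrite /avg -{1}(rhoE (pt i)) muleCA; apply: lee_wpmul2l.
    by rewrite lee_fin invr_ge0 ltW.
  have I0 : (0 <= \int[mu]_z ((ind (dd (pt i) z < s i))%:E * ((u z - u y) ^+ 2)%:E))%E.
    by apply: integral_ge0 => z _; exact: (G0 i (y, z)).
  have [ay|/theta0 ->] := boolP (actA i y); last first.
    by rewrite mul0e; apply: integral_ge0 => z _; exact: (ball_variation_fun_ge0 i (y, z)).
  apply: (@le_trans _ _ (1%:E * \int[mu]_z ((ind (dd (pt i) z < s i))%:E * ((u z - u y) ^+ 2)%:E))%E).
    by apply: lee_wpmul2r => //; rewrite lee_fin theta_le1.
  rewrite mul1e; apply: ge0_le_integral => //.
  + by move=> z _; exact: (G0 i (y, z)).
  + exact: (measurableT_comp (mG i) (pair1_measurable y)).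
  + exact: (measurableT_comp (measurable_ball_variation i) (pair1_measurable y)).
  + move=> z _; rewrite -EFinM lee_fin /= (actA_act ay) mul1r -sqrrN opprB.
    rewrite ler_wpM2r ?sqr_ge0// ler_nat.
    rewrite /act si /=; case: ltP => //= h.
    rewrite (_ : dd (pt i) z < L * s i)//.
    by rewrite (lt_le_trans h)// ler_peMl ?L_ge1// rhoE ltW.
Qed.

Lemma L2_smoothed_sub_le : (\int[mu]_y ((smoothed y - u y) ^+ 2)%:E <= (phi s0)%:E * Inear)%E.
Proof.
apply: le_trans smooth_sqdiff_le; apply: ge0_le_integral => //.
- by move=> y _; rewrite lee_fin sqr_ge0.
- by apply/measurable_EFinP; apply: measurable_funX; apply: measurable_funB => //; exact: measurable_smoothed.
- have mG : measurable_fun [set: T * T] (fun z : T * T => ((u z.1 - u z.2) ^+ 2)%:E).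
    by apply/measurable_EFinP; exact: measurable_sqdiff.
  have := @measurable_smooth _ (fun z => _) mG.
  move=> /(_ (fun z => _)) h.
  have {}h := h _; rewrite /= in h.
  apply: (measurableT_comp (h _) (measurable_fun_pair (@measurable_id _ T setT) (@measurable_id _ T setT))).
  by move=> z; rewrite lee_fin sqr_ge0.
- by move=> y _; exact: smooth_jensen.
Qed.

(** Only net points within r0 + s0 of the centre carry a nonzero mean, and their separation leaves
    finitely many. One index then serves all y, so the smoothing is a linear combination of the
    [theta]. *)
Lemma smoothed_finite_sum o r0 : 0 < r0 -> (forall y, ~~ (dd o y < r0) -> u y = 0) ->
  exists n, forall y, smoothed y = \sum_(i < n) theta i y * ball_mean i.
Proof.
move=> r00 hu; pose r1 := r0 + s0.
have r10 : 0 < r1 by rewrite addr_gt0.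
pose Q i := sel i && (dd o (pt i) < r1).
(* Half of the separation s0 / 4 of the net. *)
have e0 : 0 < s0 / 8 by rewrite divr_gt0.
have [k /andP[_ hk]] : exists k, 2 ^+ k * (s0 / 8) <= 2 * r1 + s0 / 8 < 2 ^+ k.+1 * (s0 / 8).
  by apply: dyadic_index => //; lra.
have [n hn] : exists n, forall i, (n <= i)%N -> ~~ Q i.
  apply: (@count_bounded_eventually Q (CD ^+ k.+1)) => m.
  apply: (@count_separated Q o (s0 / 8) r1) => //.
  - exact: ltW.
  - by move=> i /andP[].
  - move=> i j ij /andP[si _] /andP[sj _]; have := sel_sep ij si sj; rewrite rhoE; lra.
have c0 i : ~~ Q i -> sel i -> ball_mean i = 0.
  rewrite /Q => + si; rewrite si /= -leNgt => hi.
  rewrite /ball_mean /avg integral0_eq ?mule0// => z _.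
  case: ltP => hz; last by rewrite mul0e.
  rewrite mul1e /= hu// -leNgt; have := dd_tri z o (pt i); rewrite (dd_sym z) rhoE in hz *; rewrite /r1 in hi; lra.
exists n => y; have ry : 0 < rho y by rewrite rhoE.
have [m hm] := smoothedE ry; have [-> _ _] := hm (maxn m n) (leq_maxl _ _).
rewrite -!(big_mkord xpredT (fun i => theta i y * ball_mean i)).
rewrite (@big_cat_nat _ _ _ n 0 (maxn m n))//= ?leq_maxr// [X in _ + X = _]big_nat_cond.
rewrite [X in _ + X = _]big1 ?addr0// => i /andP[/andP[ni _] _].
have [si|nsi] := boolP (sel i); first by rewrite c0 ?mulr0// hn.
by rewrite theta0 ?mul0r// /actA (negbTE nsi).
Qed.

End ConstantScale.

End Average.

End Whitney.

(** * Maximality of the domain *)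

Section Domain.
(* capr r says that r is a radius for which the capacity bound is available. *)
Variables (F : set (T -> R)) (a : nat) (C1 : R) (capr : R -> Prop).
Hypothesis F_measurable : forall f, F f -> measurable_fun [set: T] f.
Hypothesis F_energy : forall f, F f -> (energy f < +oo)%E.
Hypothesis F_zero : F (fun=> 0).
Hypothesis F_linear : forall (k : R) f g, F f -> F g -> F (fun x => k * f x + g x).
Hypothesis F_markov : forall f, F f -> F (fun x => Num.min (Num.max (f x) 0) 1).
Hypothesis F_ae : forall f g : T -> R, F f -> measurable_fun [set: T] g ->
  L2sq (fun y => f y - g y)%R = 0%E -> F g.
Hypothesis F_closed : forall v : nat -> T -> R, (forall n, F (v n)) ->
  (forall e : R, 0 < e -> exists N : nat, forall n k, (N <= n)%N -> (N <= k)%N ->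
     (energy (fun y => v n y - v k y)%R + L2sq (fun y => v n y - v k y)%R <= e%:E)%E) ->
  exists2 f, F f & forall e : R, 0 < e ->
     exists n0 : nat, forall n, (n0 <= n)%N -> (L2sq (fun y => v n y - f y)%R <= e%:E)%E.
Hypothesis C1_ge0 : 0 <= C1.
Hypothesis capr_small : exists2 r : R, 0 < r & forall s : R, s <= r -> capr s.
Hypothesis cap : forall x r, 0 < r -> capr r -> exists psi,
  [/\ F psi, forall y, 0 <= psi y <= 1, forall y, dd x y < r -> psi y = 1,
      forall y, ~~ (dd x y < 2 ^+ a * r) -> psi y = 0
    & (energy psi <= (C1 * (V x r / phi r))%:E)%E].

(** * Lower semicontinuity of the energy *)

Lemma measurable_EFin_sqr (f : T -> R) : measurable_fun [set: T] f ->
  measurable_fun [set: T] (fun y => (f y ^+ 2)%:E).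
Proof. by move=> mf; apply/measurable_EFinP; exact: measurable_funX. Qed.

Lemma energy_ge0 (f : T -> R) : (0 <= energy f)%E.
Proof. by apply: integral_ge0 => z _; exact: energy_fun_ge0. Qed.

Lemma L2sq_add_le (f g h : T -> R) : measurable_fun [set: T] f ->
  measurable_fun [set: T] g -> measurable_fun [set: T] h ->
  (forall y, h y ^+ 2 <= 2 * f y ^+ 2 + 2 * g y ^+ 2) ->
  (L2sq h <= 2%:E * L2sq f + 2%:E * L2sq g)%E.
Proof.
move=> mf mg mh hfg.
have mf2 := measurable_EFin_sqr mf; have mg2 := measurable_EFin_sqr mg.
rewrite /L2sq -!ge0_integralZl//; try by move=> y _; rewrite lee_fin sqr_ge0.
rewrite -ge0_integralD//; last 4 first.
- by move=> y _; apply: mule_ge0; rewrite lee_fin ?sqr_ge0.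
- exact: emeasurable_funM.
- by move=> y _; apply: mule_ge0; rewrite lee_fin ?sqr_ge0.
- exact: emeasurable_funM.
apply: ge0_le_integral => //.
- by move=> y _; rewrite lee_fin sqr_ge0.
- exact: measurable_EFin_sqr.
- by apply: emeasurable_funD; exact: emeasurable_funM.
- by move=> y _; rewrite -!EFinM -EFinD lee_fin.
Qed.

Lemma energy_parallelogram (f g : T -> R) :
  measurable_fun [set: T] f -> measurable_fun [set: T] g ->
  (energy (fun y => f y - g y)%R + 4%:E * energy (fun y => 2^-1 * f y + 2^-1 * g y)%R =
   2%:E * energy f + 2%:E * energy g)%E.
Proof.
move=> mf mg.
pose G (h : T -> R) (z : T * T) := ((h z.1 - h z.2) ^+ 2 * J z.1 z.2)%:E.
have EG h : energy h = (\int[mu \x mu]_z G h z)%E by [].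
have G0 h z : (0 <= G h z)%E by exact: energy_fun_ge0.
have mG h : measurable_fun [set: T] h -> measurable_fun [set: T * T] (G h).
  exact: measurable_energy_fun.
have kG0 (k : R) h z : 0 <= k -> (0 <= k%:E * G h z)%E.
  by move=> k0; apply: mule_ge0; [rewrite lee_fin|exact: G0].
have mkG (k : R) h : measurable_fun [set: T] h -> measurable_fun [set: T * T] (fun z => k%:E * G h z)%E.
  by move=> mh; apply: emeasurable_funM => //; exact: mG.
have md : measurable_fun [set: T] (fun y => f y - g y) by exact: measurable_funB.
have mw : measurable_fun [set: T] (fun y => 2^-1 * f y + 2^-1 * g y).
  by apply: measurable_funD; exact: measurable_funM.
rewrite !EG -!ge0_integralZl//; try exact: mG.
rewrite -!ge0_integralD//; try by [exact: mkG | exact: mG | move=> z _; exact: kG0].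
rewrite /G /=.
by apply: eq_integral => z _; rewrite -!EFinM -!EFinD; congr (_%:E); field.
Qed.

(* The elements of nearly minimal energy among those L2-close to u form a
   Cauchy sequence by the parallelogram identity, so closedness applies. *)
Lemma F_lower_semicontinuous (u : T -> R) (b : R) : measurable_fun [set: T] u ->
  (forall e : R, 0 < e -> exists v,
     [/\ F v, (L2sq (fun y => v y - u y)%R <= e%:E)%E & (energy v <= b%:E)%E]) ->
  F u.
Proof.
move=> mu_ hu.
pose en (n : nat) : R := (n.+1)%:R^-1.
have en0 n : 0 < en n by rewrite invr_gt0.
have en_nd m n : (m <= n)%N -> en n <= en m.
  by move=> mn; rewrite lef_pV2 ?posrE// ler_nat ltnS.
have en_small e : 0 < e -> exists N, forall n, (N <= n)%N -> en n < e.
  move=> e0; exists (Num.bound e^-1) => n hn.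
  rewrite invf_plt ?posrE//; apply: (lt_le_trans (archi_boundP _)); first by rewrite invr_ge0 ltW.
  by rewrite ler_nat ltnW.
pose S n : set R := [set x | exists v, [/\ F v, (L2sq (fun y => v y - u y)%R <= (en n)%:E)%E
  & energy v = x%:E]].
have fineE v : F v -> energy v = (fine (energy v))%:E.
  by move=> Fv; rewrite fineK// ge0_fin_numE ?F_energy// energy_ge0.
have S_ge0 n x : S n x -> 0 <= x.
  by case=> v [_ _ Ev]; rewrite -lee_fin -Ev energy_ge0.
have S0 n : exists2 x, S n x & x <= b.
  have [v [Fv h1 h2]] := hu _ (en0 n); exists (fine (energy v)).
    by exists v; split => //; exact: fineE.
  by rewrite -lee_fin -fineE.
have S_sub m n : (m <= n)%N -> S n `<=` S m.
  move=> mn x [v [Fv h1 h2]]; exists v; split => //.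
  by apply: le_trans h1 _; rewrite lee_fin en_nd.
have hinf n : has_inf (S n).
  split; first by have [x Sx _] := S0 n; exists x.
  by exists 0 => x /S_ge0.
pose dn n := inf (S n).
have dn_le n x : S n x -> dn n <= x by move=> Sx; apply: ge_inf => //; case: (hinf n).
have dn_b n : dn n <= b by have [x Sx xb] := S0 n; apply: le_trans xb; exact: dn_le.
have dn_nd m n : (m <= n)%N -> dn m <= dn n.
  move=> mn; apply: lb_le_inf; first by case: (hinf n).
  by move=> x /(S_sub _ _ mn) /dn_le.
have hsup : has_sup (range dn).
  split; first by exists (dn 0%N); exists 0%N.
  by exists b => _ [n _ <-].
pose Dsup := sup (range dn).
have dn_sup n : dn n <= Dsup by apply: ub_le_sup; [case: hsup|exists n].
have vex n : exists v, [/\ F v, (L2sq (fun y => v y - u y)%R <= (en n)%:E)%E &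
    (energy v <= (dn n + en n)%:E)%E].
  have [x [v [Fv h1 h2]] hx] := inf_adherent (en0 n) (hinf n).
  by exists v; split => //; rewrite h2 lee_fin ltW.
have [v hv] := choice vex.
have Fv n : F (v n) by case: (hv n).
have mv n := F_measurable (Fv n).
have L2v n : (L2sq (fun y => v n y - u y)%R <= (en n)%:E)%E by case: (hv n).
have Ev n : (energy (v n) <= (dn n + en n)%:E)%E by case: (hv n).
(* The midpoint of two competitors is as close to u as they are, so its energy is at least [dn N].
   This leaves 4 (Dsup - dn N) + 4 en N for the energy of the difference, and 4 en N more for its L2
   norm. *)
have key N n k : (N <= n)%N -> (N <= k)%N ->
    (energy (fun y => v n y - v k y)%R + L2sq (fun y => v n y - v k y)%R <=
     (4 * (Dsup - dn N) + 8 * en N)%:E)%E.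
  move=> Nn Nk.
  have mw : measurable_fun [set: T] (fun y => 2^-1 * v n y + 2^-1 * v k y).
    by apply: measurable_funD; exact: measurable_funM.
  have Fw : F (fun y => 2^-1 * v n y + 2^-1 * v k y).
    apply: F_linear => //.
    by rewrite (_ : (fun y => _) = (fun y => 2^-1 * v k y + 0)); [exact: F_linear|apply/funext => y; rewrite addr0].
  have mvu j : measurable_fun [set: T] (fun y => v j y - u y) by exact: measurable_funB.
  have L2vN j : (N <= j)%N -> (L2sq (fun y => v j y - u y)%R <= (en N)%:E)%E.
    by move=> Nj; apply: le_trans (L2v j) _; rewrite lee_fin en_nd.
  have Sw : S N (fine (energy (fun y => 2^-1 * v n y + 2^-1 * v k y)%R)).
    exists (fun y => 2^-1 * v n y + 2^-1 * v k y); split => //; last exact: fineE.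
    have half (f : T -> R) : measurable_fun [set: T] f ->
        (L2sq (fun y => 2^-1 * f y)%R = 4^-1%:E * L2sq f)%E.
      move=> mf; rewrite /L2sq -ge0_integralZl//; last 2 first.
      - exact: measurable_EFin_sqr.
      - by move=> y _; rewrite lee_fin sqr_ge0.
      by apply: eq_integral => y _; rewrite -EFinM; congr (_%:E); field.
    apply: (@le_trans _ _ (2%:E * (L2sq (fun y => 2^-1 * (v n y - u y))%R) +
      2%:E * (L2sq (fun y => 2^-1 * (v k y - u y))%R))%E).
      apply: L2sq_add_le.
      - exact: measurable_funM.
      - exact: measurable_funM.
      - exact: measurable_funB.
      - move=> y; have := sqr_ge0 (v n y - v k y); nra.
    rewrite !half// (_ : en N = 2 * (4^-1 * en N) + 2 * (4^-1 * en N)); last by field.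
    rewrite [leRHS]EFinD; apply: leeD.
      rewrite [leRHS]EFinM; apply: lee_wpmul2l => //; rewrite [leRHS]EFinM.
      by apply: lee_wpmul2l; [rewrite lee_fin|exact: L2vN].
    rewrite [leRHS]EFinM; apply: lee_wpmul2l => //; rewrite [leRHS]EFinM.
    by apply: lee_wpmul2l; [rewrite lee_fin|exact: L2vN].
  have h1 : (L2sq (fun y => v n y - v k y)%R <= (4 * en N)%:E)%E.
    apply: (@le_trans _ _ (2%:E * L2sq (fun y => v n y - u y)%R + 2%:E * L2sq (fun y => v k y - u y)%R)%E).
      apply: L2sq_add_le => //; first exact: measurable_funB.
      by move=> y; have := sqr_ge0 ((v n y - u y) + (v k y - u y)); nra.
    rewrite (_ : 4 * en N = 2 * en N + 2 * en N); last by ring.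
    by rewrite [leRHS]EFinD; apply: leeD; rewrite [leRHS]EFinM; apply: lee_wpmul2l => //; exact: L2vN.
  have fd : F (fun y => v n y - v k y).
    by rewrite (_ : (fun y => _) = (fun y => -1 * v k y + v n y)); [exact: F_linear|apply/funext => y; ring].
  have h2 : (energy (fun y => v n y - v k y)%R <= (4 * (Dsup - dn N) + 4 * en N)%:E)%E.
    have := energy_parallelogram (mv n) (mv k).
    rewrite (fineE _ fd) (fineE _ Fw) (fineE _ (Fv n)) (fineE _ (Fv k)).
    rewrite -!EFinM -!EFinD => -[h]; rewrite lee_fin.
    have := dn_le _ _ Sw; have := dn_sup n; have := dn_sup k.
    have := Ev n; have := Ev k; rewrite (fineE _ (Fv n)) (fineE _ (Fv k)) !lee_fin.
    have := en_nd _ _ Nn; have := en_nd _ _ Nk; lra.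
  apply: (le_trans (leeD h2 h1)); rewrite -EFinD lee_fin; lra.
have [f Ff hf] : exists2 f, F f & forall e : R, 0 < e ->
    exists n0 : nat, forall n, (n0 <= n)%N -> (L2sq (fun y => v n y - f y)%R <= e%:E)%E.
  apply: F_closed => // e e0.
  have e16 : 0 < e / 16 by rewrite divr_gt0.
  have [N1 hN1] := en_small _ e16.
  have [_ [N2 _ <-] hN2] := sup_adherent e16 hsup.
  exists (maxn N1 N2) => n k hn hk; apply: (le_trans (key (maxn N1 N2) n k hn hk)).
  rewrite lee_fin; have := hN1 (maxn N1 N2) (leq_maxl _ _).
  have := dn_nd _ _ (leq_maxr N1 N2); rewrite -/Dsup in hN2; lra.
apply: (F_ae Ff) => //; apply/eqP; rewrite eq_le L2sq_ge0 andbT.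
apply/lee_addgt0Pr => e e0; rewrite add0e.
have e4 : 0 < e / 4 by rewrite divr_gt0.
have [N1 hN1] := en_small _ e4; have [N2 hN2] := hf _ e4.
pose n := maxn N1 N2.
have mf := F_measurable Ff.
apply: (@le_trans _ _ (2%:E * L2sq (fun y => v n y - f y)%R + 2%:E * L2sq (fun y => v n y - u y)%R)%E).
  apply: L2sq_add_le; try exact: measurable_funB.
  by move=> y; have := sqr_ge0 ((v n y - u y) + (v n y - f y)); nra.
rewrite (_ : e = 2 * (e / 4) + 2 * (e / 4)); last by field.
rewrite [leRHS]EFinD; apply: leeD; rewrite [leRHS]EFinM; apply: lee_wpmul2l => //.
  by apply: hN2; exact: leq_maxr.
by apply: le_trans (L2v n) _; rewrite lee_fin ltW// hN1 ?leq_maxl.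
Qed.

(** * Lattice operations, cutoffs and membership in the domain *)

(** The Markov property only supplies truncation to [0, 1]; since g - f <= 1, the maximum is f plus
    the truncation of g - f. *)
Lemma F_max (f g : T -> R) : F f -> F g -> (forall y, 0 <= f y) ->
  (forall y, 0 <= g y <= 1) -> F (fun y => Num.max (f y) (g y)).
Proof.
move=> Ff Fg f0 g01.
have Fd : F (fun y => -1 * f y + g y) by exact: F_linear.
rewrite (_ : (fun y => _) = (fun y => 1 * Num.min (Num.max (-1 * f y + g y) 0) 1 + f y)).
  exact: F_linear (F_markov Fd) Ff.
apply/funext => y; have /andP[_ g1] := g01 y; have fy := f0 y.
rewrite mul1r [Num.min _ _]min_l.
  by rewrite !maxEle; case: ifP => h1; case: ifP => h2; lra.
by rewrite ge_max; apply/andP; split; lra.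
Qed.

Lemma F_theta (eta : nat -> T -> R) i : (forall i, F (eta i)) ->
  (forall i y, 0 <= eta i y <= 1) -> F (theta eta i).
Proof.
move=> Feta eta01.
have FM n : F (cutmax eta n).
  elim: n => [|n IH] //=; apply: F_max => // y; exact: cutmax_ge0.
rewrite (_ : theta eta i = (fun y => -1 * cutmax eta i y + cutmax eta i.+1 y)); first exact: F_linear.
by apply/funext => y; rewrite /theta; ring.
Qed.

Local Notation l := (a + 7)%N.
Local Notation A := (2 ^+ a : R).
Local Notation L := (2 ^+ (a + 7) : R).

Let A_ge1 : 1 <= A. Proof. by rewrite exprn_ege1// ler1n. Qed.
Let LA : L = 128 * A. Proof. by rewrite exprD !exprS expr0; ring. Qed.

Lemma cap_family (rho : T -> R) : (forall x, 0 < rho x -> capr (rho x)) ->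
  exists eta : nat -> T -> R, [/\ forall i, F (eta i), forall i y, 0 <= eta i y <= 1,
    forall i y, sel rho i -> dd (pt i) y < rho (pt i) -> eta i y = 1,
    forall i y, ~~ actA rho A i y -> eta i y = 0
  & forall i, sel rho i ->
      (energy (eta i) <= (C1 * (V (pt i) (rho (pt i)) / phi (rho (pt i))))%:E)%E].
Proof.
move=> hcap.
have /choice[eta heta] : forall i, exists psi : T -> R, [/\ F psi, forall y, 0 <= psi y <= 1,
    forall y, sel rho i -> dd (pt i) y < rho (pt i) -> psi y = 1,
    forall y, ~~ actA rho A i y -> psi y = 0
  & sel rho i -> (energy psi <= (C1 * (V (pt i) (rho (pt i)) / phi (rho (pt i))))%:E)%E].
  move=> i; have [si|nsi] := boolP (sel rho i); last first.
    by exists (fun=> 0); split => // y; rewrite ler01 lexx.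
  have r0 := sel_gt0 si; have [psi [h1 h2 h3 h4 h5]] := cap (pt i) r0 (hcap _ r0).
  exists psi; split => //.
  - by move=> y _; exact: h3.
  - by move=> y; rewrite /actA si; exact: h4.
by exists eta; split => i *; have [? h2 h3 h4 ?] := heta i; auto.
Qed.

Lemma integral_ball_bounded (u : T -> R) : measurable_fun [set: T] u ->
  (forall y, 0 <= u y) -> (L2sq u < +oo)%E ->
  forall x r, (\int[mu]_z (ind (dd x z < r) * u z)%:E < +oo)%E.
Proof.
move=> mu_ u0 hu x r.
have [r0|r0] := ltP 0 r; last first.
  rewrite integral0_eq// => z _; rewrite ltNge (le_trans r0) ?dd_ge0//= mul0r//.
have mi : measurable_fun [set: T] (fun z => (ind (dd x z < r))%:E : \bar R).
  by apply/measurable_EFinP/measurable_bool_natr; exact: measurable_lt_dd.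
(* On the ball u <= 1 + u^2, and the ball has finite measure. *)
apply: (@le_lt_trans _ _ (\int[mu]_z ((ind (dd x z < r))%:E + (u z ^+ 2)%:E))%E).
  apply: ge0_le_integral => //.
  - by move=> z _; rewrite lee_fin mulr_ge0.
  - apply/measurable_EFinP; apply: measurable_funM => //.
    by apply: measurable_bool_natr; exact: measurable_lt_dd.
  - by apply: emeasurable_funD => //; exact: measurable_EFin_sqr.
  - move=> z _; rewrite -EFinD lee_fin; case: (dd x z < r); last by rewrite mul0r addr_ge0// sqr_ge0.
    rewrite (_ : true%:R = 1 :> R)// mul1r.
    by have := sqr_ge0 (u z - 2^-1); nra.
rewrite ge0_integralD//; last 2 first.
- by move=> z _; rewrite lee_fin sqr_ge0.
- exact: measurable_EFin_sqr.
rewrite lte_add_pinfty// integral_bool_natr/=; last exact: measurable_lt_dd.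
by rewrite muV// ltry.
Qed.

Lemma phi_small (e : R) : 0 < e -> exists2 s0 : R, 0 < s0 & forall s, 0 < s -> s <= s0 -> phi s <= e.
Proof.
move=> e0; have /andP[q0 q1] := q01; have p1 := phi_gt0 ltr01.
have Kp : 0 < K * K * phi 1 by rewrite !mulr_gt0.
have [n hn] : exists n, q ^+ n <= e / (K * K * phi 1).
  have /cvgrPdist_lt/(_ _ (divr_gt0 e0 Kp)) [n _ hn] : (fun n => q ^+ n) @ \oo --> (0 : R).
    by apply: cvg_expr; rewrite gtr0_norm.
  exists n; have := hn n (leqnn n); rewrite sub0r normrN gtr0_norm ?exprn_gt0//.
  exact: ltW.
exists (2 ^+ n)^-1; first by rewrite invr_gt0 exprn_gt0.
move=> s s_gt0 sn; apply: (le_trans (phi_mono s_gt0 sn)).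
have := phi_geom n (_ : 0 < (2 ^+ n)^-1); rewrite mulfV ?gt_eqF ?exprn_gt0// => h.
have {}h : phi (2 ^+ n)^-1 <= K * q ^+ n * phi 1 by apply: h; rewrite invr_gt0 exprn_gt0.
apply: (le_trans (ler_wpM2l (ltW K_gt0) h)).
rewrite ler_pdivlMr// in hn; apply: le_trans hn.
by rewrite le_eqVlt; apply/orP; left; apply/eqP; ring.
Qed.

Lemma F_maximal (u : T -> R) (o : T) (r0 : R) : measurable_fun [set: T] u ->
  (forall y, 0 <= u y) -> 0 < r0 -> (forall y, ~~ (dd o y < r0) -> u y = 0) ->
  (L2sq u < +oo)%E -> (energy u < +oo)%E -> F u.
Proof.
move=> mu_ u0 r00 uout uL2 uE.
have uint := integral_ball_bounded mu_ u0 uL2.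
have mtrue : measurable_fun [set: T] (fun=> true) by exact: measurable_cst.
have p1 := phi_gt0 ltr01.
have EDE : energyD u (fun=> true) = energy u.
  by apply: eq_integral => z _; rewrite mul1r.
have fin1 : energy u \is a fin_num by rewrite ge0_fin_numE ?energy_ge0.
have fin2 : L2sq u \is a fin_num by rewrite ge0_fin_numE ?L2sq_ge0.
(* [b1] bounds the energy of every smoothing and [b2] bounds [Inear], whatever the constant scale.
   Here [D] is the whole space, so the value t = 1 is arbitrary: its condition only concerns points
   outside [D]. *)
pose b1 := Csmooth1 l a C1 * fine (energy u) + Csmooth2 l a C1 / phi 1 * fine (L2sq u).
pose b2 := CJ l * Cov l * fine (energy u) + 2 * Cm l * Cov l / phi 1 * fine (L2sq u).
apply: (@F_lower_semicontinuous u b1) => // e e0.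
have [s1 s10 hs1] := phi_small (divr_gt0 e0 (ltr_pwDl ltr01 (normr_ge0 b2))).
have [s2 s20 hs2] := capr_small.
(* [s1] makes phi(s) [b2] at most e, and [s2] makes the capacity cutoffs available. *)
pose s := Num.min s1 s2.
have s_gt0 : 0 < s by rewrite lt_min s10.
have ss2 : s <= s2 by rewrite ge_min lexx orbT.
pose rho (_ : T) := s.
have rho0 x : 0 <= rho x by exact: ltW.
have mrho : measurable_fun [set: T] rho by exact: measurable_cst.
have lip x y : 2 * L * `|rho x - rho y| <= dd x y by rewrite subrr normr0 mulr0 dd_ge0.
have [eta [Feta eta01 eta1 eta0 etaE]] := @cap_family rho (fun x _ => hs2 _ ss2).
have meta i := F_measurable (Feta i).
have tt : forall y, ~~ (fun=> true) y -> u y = 0 by [].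
have tr : forall y, ~~ (fun=> true) y -> 1 <= rho y by [].
exists (smoothed (erefl L) rho0 lip eta u); split.
- have [n hn] := smoothed_finite_sum (erefl L) rho0 lip A_ge1 LA eta01 eta1 eta0 s_gt0 (fun=> erefl) r00 uout.
  have -> : smoothed (erefl L) rho0 lip eta u = fun y => \sum_(i < n) theta eta i y * ball_mean rho u i.
    by apply/funext.
  elim: n {hn} => [|n IH].
    by rewrite (_ : (fun y => _) = fun=> 0)//; apply/funext => y; rewrite big_ord0.
  rewrite (_ : (fun y => _) = fun y => ball_mean rho u n * theta eta n y + \sum_(i < n) theta eta i y * ball_mean rho u i).
    by apply: F_linear IH; exact: F_theta.
  by apply/funext => y; rewrite big_ord_recr/= addrC mulrC.
- apply: (le_trans (L2_smoothed_sub_le (erefl L) rho0 mrho lip A_ge1 LA meta eta01 eta1 eta0 mu_ u0 uint s_gt0 (fun=> erefl))).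
  apply: (@le_trans _ _ ((phi s)%:E * b2%:E)%E).
    apply: lee_wpmul2l; first by rewrite lee_fin ltW// phi_gt0.
    have := Inear_le (erefl L) rho0 lip mu_ u0 mtrue ltr01 tr.
    by rewrite EDE -(fineK fin1) -(fineK fin2) -!EFinM -EFinD.
  rewrite -EFinM lee_fin.
  have ps : phi s <= e / (1 + `|b2|) by apply: hs1 => //; rewrite ge_min lexx.
  have b20 : 0 < 1 + `|b2| by rewrite ltr_pwDl.
  rewrite ler_pdivlMr// in ps; apply: le_trans ps.
  by rewrite ler_wpM2l ?(ltW (phi_gt0 _))//; have := ler_norm b2; lra.
- have := energy_smoothed_le (erefl L) rho0 mrho lip (erefl A) A_ge1 LA C1_ge0 meta eta01 eta1 eta0 etaE mu_ u0 uint mtrue ltr01 tt tr.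
  by rewrite EDE -(fineK fin1) -(fineK fin2) -!EFinM -EFinD.
Qed.


Lemma normB_max_le (x y z w e : R) : `|x - z| <= e -> `|y - w| <= e ->
  `|Num.max x y - Num.max z w| <= e.
Proof.
rewrite !ler_norml !maxEle => /andP[? ?] /andP[? ?].
by case: (leP x y) => ?; case: (leP z w) => ?; apply/andP; split; lra.
Qed.

Lemma normB_min_le (x y z w e : R) : `|x - z| <= e -> `|y - w| <= e ->
  `|Num.min x y - Num.min z w| <= e.
Proof.
rewrite !ler_norml !minEle => /andP[? ?] /andP[? ?].
by case: (leP x y) => ?; case: (leP z w) => ?; apply/andP; split; lra.
Qed.

Lemma measurable_inv_pos (h : T -> R) : measurable_fun [set: T] h ->
  (forall y, 0 < h y) -> measurable_fun [set: T] (fun y => (h y)^-1).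
Proof.
move=> mh h0; rewrite (_ : (fun y => _) = (fun y => (h y) `^ (-1))).
  exact: (measurableT_comp (measurable_powR _) mh).
by apply/funext => y; rewrite powR_inv1// ltW.
Qed.

Let CDX_ge0 n : 0 <= CD ^+ n. Proof. by apply: exprn_ge0; exact: ltW. Qed.
Let KX_ge0 n : 0 <= K ^+ n. Proof. by apply: exprn_ge0; exact: ltW. Qed.

Lemma Csmooth1_ge0 : 0 <= Csmooth1 l a C1.
Proof.
rewrite addr_ge0//.
  by rewrite mulr_ge0 ?sqr_ge0// mulr_ge0// exprn_ge0 // ltW.
apply: mulr_ge0; first by apply: mulr_ge0 => //; exact: Cnear_ge0.
exact: mulr_ge0 (mulr_ge0 (CDX_ge0 _) (KX_ge0 _)) (CDX_ge0 _).
Qed.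

Lemma Csmooth2_ge0 : 0 <= Csmooth2 l a C1.
Proof.
rewrite addr_ge0//.
  apply: mulr_ge0; first by rewrite mulr_ge0 ?sqr_ge0// mulr_ge0// exprn_ge0 // ltW.
  by rewrite mulr_ge0// Ctail_ge0.
apply: mulr_ge0; first by apply: mulr_ge0 => //; exact: Cnear_ge0.
by rewrite mulr_ge0 ?CDX_ge0// mulr_ge0// mulr_ge0 ?CDX_ge0 ?KX_ge0.
Qed.

Lemma sqrJ_ge0 (x : R) y z : 0 <= x ^+ 2 * J y z.
Proof. exact: mulr_ge0 (sqr_ge0 _) (J_ge0 _ _). Qed.

(** * The cutoff function adapted to f *)

Section Cutoff.
Variables (o : T) (r s : R).
Hypothesis r_gt0 : 0 < r.
Hypothesis r_le_s : r <= s.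

Local Notation k := ((2 * L)^-1).

Definition ramp (y : T) : R :=
  Num.min r (Num.max 0 (Num.max (s + r / 8 - dd o y) (dd o y - (s + r / 4)))).

(** The factor 1/(2L) gives the 1-Lipschitz ramp the slope required for smoothing, and the cap r on
    the ramp keeps all radii below r/(2L), where capacity cutoffs are assumed to exist. *)
Definition scale (y : T) : R := k * ramp y.

Let L1 : 1 <= L. Proof. by rewrite exprn_ege1// ler1n. Qed.
Let k_gt0 : 0 < k. Proof. by have L1' := L1; rewrite invr_gt0; lra. Qed.

Lemma ramp_ge0 y : 0 <= ramp y.
Proof. by rewrite le_min (ltW r_gt0) le_max lexx. Qed.

Lemma ramp_le y : ramp y <= r.
Proof. by rewrite ge_min lexx. Qed.

Lemma scale_ge0 y : 0 <= scale y.
Proof. by rewrite mulr_ge0 ?ramp_ge0// ltW. Qed.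

Lemma scale_lip x y : 2 * L * `|scale x - scale y| <= dd x y.
Proof.
have L1' := L1.
rewrite -mulrBr normrM gtr0_norm// mulrA mulfV ?mul1r; last by rewrite gt_eqF; lra.
have h1 : `|dd o x - dd o y| <= dd x y.
  rewrite ler_norml; have := dd_tri x o y; have := dd_tri y o x; rewrite (dd_sym y x).
  by move=> ? ?; apply/andP; split; lra.
have h0 (z : R) : `|z - z| <= dd x y by rewrite subrr normr0 dd_ge0.
apply: normB_min_le => //; apply: normB_max_le => //; apply: normB_max_le.
  rewrite (_ : _ - _ = - (dd o x - dd o y)); last by ring.
  by rewrite normrN.
by rewrite (_ : _ - _ = dd o x - dd o y)//; ring.
Qed.

Lemma measurable_scale : measurable_fun [set: T] scale.
Proof.
have md := measurable_dd o.
apply: measurable_funM => //; apply: measurable_minr => //; apply: measurable_maxr => //.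
by apply: measurable_maxr; apply: measurable_funB.
Qed.

Lemma scale_eq0 y : s + r / 8 <= dd o y <= s + r / 4 -> scale y = 0.
Proof.
move=> /andP[h1 h2]; rewrite /scale /ramp.
rewrite (max_l (_ : Num.max _ _ <= 0)); last by rewrite ge_max; apply/andP; split; lra.
by rewrite min_r ?mulr0// ltW.
Qed.

Lemma ramp_far y : s + r / 2 <= dd o y -> r / 8 <= ramp y.
Proof.
move=> h; have := r_gt0; rewrite /ramp le_min !le_max => ?.
by apply/andP; split; [lra|apply/orP; right; apply/orP; right; lra].
Qed.

Lemma ramp_inside y : dd o y < s -> r / 8 <= ramp y.
Proof.
move=> h; have := r_gt0; rewrite /ramp le_min !le_max => ?.
by apply/andP; split; [lra|apply/orP; right; apply/orP; left; lra].
Qed.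

Definition collar (y : T) : bool := (s <= dd o y) && (dd o y < s + r / 2).
(** [annulus] and [annulus'] are the sets U and U* of CSJ for a0 = 1; the collar lies inside
    both. *)
Definition annulus (y : T) : bool := (s <= dd o y) && (dd o y < s + r).
Definition annulus' (y : T) : bool := (s - r <= dd o y) && (dd o y < s + 2 * r).

Lemma scale_out y : ~~ collar y -> k * (r / 8) <= scale y.
Proof.
rewrite negb_and -ltNge -leNgt => /orP h; rewrite ler_wpM2l ?(ltW k_gt0)//.
by case: h => [/ramp_inside|/ramp_far].
Qed.

Lemma measurable_collar : measurable_fun [set: T] collar.
Proof.
apply: measurable_and; last exact: measurable_lt_dd.
by apply: measurable_fun_ler => //; exact: measurable_dd.
Qed.

Lemma measurable_annulus : measurable_fun [set: T] annulus.
Proof.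
apply: measurable_and; last exact: measurable_lt_dd.
by apply: measurable_fun_ler => //; exact: measurable_dd.
Qed.

Lemma measurable_annulus' : measurable_fun [set: T] annulus'.
Proof.
apply: measurable_and; last exact: measurable_lt_dd.
by apply: measurable_fun_ler => //; exact: measurable_dd.
Qed.

(** * The function on the collar and its bounds *)

Variables (f : T -> R) (e : R).
Hypothesis mf : measurable_fun [set: T] f.
Hypothesis fL2 : (L2sq f < +oo)%E.
Hypothesis fE : (energy f < +oo)%E.
Hypothesis e_gt0 : 0 < e.
Hypothesis hcapr : forall t, t <= r / (2 * L) -> capr t.

Definition height (y : T) : R := `|f y| + e.
Definition data (y : T) : R := ind (collar y) * height y.

Let h := height.
Let h_gt0 y : 0 < h y. Proof. by rewrite /h /height ltr_wpDl. Qed.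
Let f_le_h y : f y ^+ 2 <= h y ^+ 2.
Proof.
rewrite -[f y ^+ 2]real_normK ?num_real// ler_sqr ?nnegrE//; last exact: ltW.
by rewrite /h /height; have := e_gt0; lra.
Qed.
Let mh : measurable_fun [set: T] h.
Proof. by apply: measurable_funD => //; exact: measurableT_comp. Qed.
Let h_diff x y : (h x - h y) ^+ 2 <= (f x - f y) ^+ 2.
Proof.
rewrite (_ : h x - h y = `|f x| - `|f y|); last by rewrite /h /height; ring.
rewrite -[leLHS]real_normK ?num_real// -[leRHS]real_normK ?num_real//.
by rewrite ler_sqr ?nnegrE// ler_dist_dist.
Qed.

Lemma measurable_data : measurable_fun [set: T] data.
Proof. by apply: measurable_funM => //; apply: measurable_bool_natr; exact: measurable_collar. Qed.

Lemma data_ge0 y : 0 <= data y.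
Proof. by rewrite mulr_ge0// ltW// h_gt0. Qed.

Lemma data_out y : ~~ collar y -> data y = 0.
Proof. by rewrite /data => /negbTE ->; rewrite mul0r. Qed.

Definition massB : \bar R := (\int[mu]_y (ind (dd o y < s + 2 * r) * f y ^+ 2)%:E)%E.

Let s2r : 0 < s + 2 * r. Proof. by have := r_gt0; have := r_le_s; lra. Qed.

Let mB rr : measurable_fun [set: T] (fun y => ind (dd o y < rr)).
Proof. by apply: measurable_bool_natr; exact: measurable_lt_dd. Qed.

Lemma L2sq_data : (L2sq data <= 2%:E * massB + (2 * e ^+ 2 * V o (s + 2 * r))%:E)%E.
Proof.
have mf2 : measurable_fun [set: T] (fun y => (ind (dd o y < s + 2 * r) * f y ^+ 2)%:E).
  by apply/measurable_EFinP; apply: measurable_funM => //; exact: measurable_funX.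
have mi : measurable_fun [set: T] (fun y => (ind (dd o y < s + 2 * r))%:E : \bar R).
  exact/measurable_EFinP.
have p0 y : (0 <= (ind (dd o y < s + 2 * r) * f y ^+ 2)%:E :> \bar R)%E.
  by rewrite lee_fin mulr_ge0 ?sqr_ge0.
have -> : ((2 * e ^+ 2 * V o (s + 2 * r))%:E =
    (2 * e ^+ 2)%:E * \int[mu]_y (ind (dd o y < s + 2 * r))%:E)%E.
  rewrite integral_bool_natr; last exact: measurable_lt_dd.
  by rewrite /= muV// EFinM.
have e20 : 0 <= 2 * e ^+ 2 by rewrite mulr_ge0 ?sqr_ge0.
rewrite /massB -!ge0_integralZl//.
rewrite -ge0_integralD//; last 4 first.
- by move=> y _; apply: mule_ge0; [rewrite lee_fin|exact: p0].
- exact: emeasurable_funM.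
- by move=> y _; apply: mule_ge0; rewrite lee_fin.
- exact: emeasurable_funM.
apply: ge0_le_integral => //.
- by move=> y _; rewrite lee_fin sqr_ge0.
- by apply: measurable_EFin_sqr; exact: measurable_data.
- by apply: emeasurable_funD; exact: emeasurable_funM.
- move=> y _; rewrite -!EFinM -EFinD lee_fin /data.
  have [cy|_] := boolP (collar y); last first.
    by rewrite mul0r expr0n/= addr_ge0// mulr_ge0// mulr_ge0// sqr_ge0.
  have -> : dd o y < s + 2 * r by case/andP: cy => _; have := r_gt0; lra.
  rewrite /height !mul1r mulr1 -[f y ^+ 2]real_normK ?num_real//.
  by have := sqr_ge0 (`|f y| - e); nra.
Qed.

Lemma massB_ge0 : (0 <= massB)%E.
Proof. by apply: integral_ge0 => y _; rewrite lee_fin mulr_ge0 ?sqr_ge0. Qed.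

Lemma massB_fin : (massB < +oo)%E.
Proof.
apply: le_lt_trans fL2; apply: ge0_le_integral => //.
- by move=> y _; rewrite lee_fin mulr_ge0 ?sqr_ge0.
- by apply/measurable_EFinP; apply: measurable_funM => //; exact: measurable_funX.
- exact: measurable_EFin_sqr.
- by move=> y _; rewrite lee_fin ler_piMl ?sqr_ge0//; case: (_ < _).
Qed.

Definition energyU : \bar R := (\int[mu \x mu]_z
  (ind (annulus z.1) * ind (annulus' z.2) * ((f z.1 - f z.2) ^+ 2 * J z.1 z.2))%:E)%E.

Let energyU_fun_ge0 (z : T * T) : (0 <= (ind (annulus z.1) * ind (annulus' z.2) *
  ((f z.1 - f z.2) ^+ 2 * J z.1 z.2))%:E :> \bar R)%E.
Proof. by rewrite lee_fin mulr_ge0 ?sqrJ_ge0 ?mulr_ge0. Qed.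

Let mdiffJ : measurable_fun [set: T * T] (fun z => (f z.1 - f z.2) ^+ 2 * J z.1 z.2).
Proof. by apply: measurable_funM => //; exact: measurable_sqdiff. Qed.

Let m1 (b : T -> bool) : measurable_fun [set: T] b ->
  measurable_fun [set: T * T] (fun z => ind (b z.1)).
Proof. by move=> ?; apply: measurable_bool_natr; exact: (measurableT_comp _ measurable_fst). Qed.

Let m2 (b : T -> bool) : measurable_fun [set: T] b ->
  measurable_fun [set: T * T] (fun z => ind (b z.2)).
Proof. by move=> ?; apply: measurable_bool_natr; exact: (measurableT_comp _ measurable_snd). Qed.

Let mEU : measurable_fun [set: T * T] (fun z => (ind (annulus z.1) * ind (annulus' z.2) *
  ((f z.1 - f z.2) ^+ 2 * J z.1 z.2))%:E).
Proof.
apply/measurable_EFinP; apply: measurable_funM => //; apply: measurable_funM.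
  exact: m1 measurable_annulus.
exact: m2 measurable_annulus'.
Qed.

Lemma energyU_ge0 : (0 <= energyU)%E.
Proof. by apply: integral_ge0 => z _. Qed.

Lemma energyU_fin : (energyU < +oo)%E.
Proof.
apply: le_lt_trans fE; apply: ge0_le_integral => //.
- exact: measurable_energy_fun.
- move=> z _; rewrite lee_fin (ler_piMl (sqrJ_ge0 _ _ _))//.
  by case: (annulus _) => /=; case: (annulus' _) => /=; rewrite ?mulr1 ?mulr0.
Qed.

Lemma energyD_data : (energyD data collar <= energyU)%E.
Proof.
have mc := measurable_collar; have md := measurable_data.
apply: ge0_le_integral => //.
- by move=> z _; rewrite lee_fin mulr_ge0 ?sqrJ_ge0.
- apply/measurable_EFinP; apply: measurable_funM.
    apply: measurable_bool_natr; apply: measurable_and.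
      exact: (measurableT_comp mc measurable_fst).
    exact: (measurableT_comp mc measurable_snd).
  by apply: measurable_funM => //; exact: measurable_sqdiff.
- move=> [x y] _ /=; rewrite lee_fin.
  have [/andP[cx cy]|_] := boolP (collar x && collar y); last first.
    by rewrite mul0r mulr_ge0 ?sqrJ_ge0.
  have -> : annulus x by case/andP: cx => h1 h2; apply/andP; split => //; have := r_gt0; lra.
  have -> : annulus' y by case/andP: cy => h1 h2; apply/andP; split; have := r_gt0; lra.
  by rewrite /data cx cy !mul1r ler_wpM2r// h_diff.
Qed.

(** * The quotient profile and its weighted energy *)

Section Profile.
Variable G : T -> R.
Hypothesis mG : measurable_fun [set: T] G.
Hypothesis G_ge0 : forall y, 0 <= G y.
Hypothesis G_mid : forall y, s + r / 8 <= dd o y <= s + r / 4 -> G y = h y.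
Hypothesis G_out : forall y, s + 5 / 8 * r <= dd o y -> G y = 0.
Hypothesis energyG : (energy G < +oo)%E.

Definition profile (y : T) : R :=
  if dd o y <= s + r / 4 then 1 else Num.min 1 (G y * (h y)^-1).

Lemma profile01 y : 0 <= profile y <= 1.
Proof.
rewrite /profile; case: ifP => _; first by rewrite ler01 lexx.
by rewrite ge_min lexx le_min ler01 mulr_ge0//= invr_ge0 ltW.
Qed.

Lemma profile_in y : dd o y <= s + r / 4 -> profile y = 1.
Proof. by rewrite /profile => ->. Qed.

Lemma profile_out y : s + 5 / 8 * r <= dd o y -> profile y = 0.
Proof.
move=> hy; rewrite /profile leNgt (_ : _ < _); last by have := r_gt0; lra.
by rewrite G_out// mul0r min_r.
Qed.

Lemma measurable_profile : measurable_fun [set: T] profile.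
Proof.
apply: measurable_fun_ifT => //.
  by apply: measurable_fun_ler => //; exact: measurable_dd.
by apply: measurable_minr => //; apply: measurable_funM => //; exact: measurable_inv_pos.
Qed.

(** The identity holds on both sides of the threshold s + r/4 because [G] equals h on the whole
    shell. Its thickness r/8 ensures that a point within r/8 of one beyond the threshold is still
    covered. *)
Lemma height_profile y : s + r / 8 <= dd o y -> h y * profile y = Num.min (h y) (G y).
Proof.
move=> hy; have hy0 := h_gt0 y; rewrite /profile; case: ifP => hy'.
  by rewrite mulr1 G_mid ?hy//= minxx.
rewrite minEle [RHS]minEle ler_pdivlMr// mul1r.
by case: ifP => _; rewrite ?mulr1// mulrCA divff ?mulr1// gt_eqF.
Qed.

(** A difference of two minima is in absolute value at most the larger of the two differences. *)
Lemma sqdiff_min_le (x x' y y' : R) :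
  (Num.min x y - Num.min x' y') ^+ 2 <= (x - x') ^+ 2 + (y - y') ^+ 2.
Proof.
have H (z w : R) : z ^+ 2 <= z ^+ 2 + w ^+ 2 by rewrite lerDl sqr_ge0.
have H' (z w : R) : z ^+ 2 <= w ^+ 2 + z ^+ 2 by rewrite lerDr sqr_ge0.
case: (leP x y) => h1; case: (leP x' y') => h2 //.
  by have [h3|h3] := leP y' x; [apply: le_trans (H' _ _)|apply: le_trans (H _ _)]; nra.
by have [h3|h3] := leP x' y; [apply: le_trans (H _ _)|apply: le_trans (H' _ _)]; nra.
Qed.

(** Unless both values of the profile agree, both points lie between s + r/8 and s + 3r/4. Write h x
    (p x - p y) as the increment of h p minus p y (h x - h y), for the profile p. The increment of h
    p = min(h, G) costs those of G and h, which with the factors 2 gives the coefficients 2 and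
    4. *)
Lemma profile_near x y : dd x y < r / 8 ->
  h x ^+ 2 * (profile x - profile y) ^+ 2 <=
  2 * (G x - G y) ^+ 2 + 4 * (ind (annulus x) * ind (annulus' y) * (f x - f y) ^+ 2).
Proof.
move=> xy; have r0 := r_gt0.
have hx := dd_tri y o x; have hy := dd_tri x o y; rewrite (dd_sym y x) in hx.
have [pp|npp] := eqVneq (profile x) (profile y).
  rewrite pp subrr expr0n mulr0; apply: addr_ge0; apply: mulr_ge0 => //.
    exact: sqr_ge0.
  exact: mulr_ge0 (mulr_ge0 (ler0n _ _) (ler0n _ _)) (sqr_ge0 _).
have h1 : s + r / 4 < dd o x \/ s + r / 4 < dd o y.
  have [hx1|] := leP (dd o x) (s + r / 4); last by left.
  have [hy1|] := leP (dd o y) (s + r / 4); last by right.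
  by move: npp; rewrite !profile_in// eqxx.
have h2 : dd o x < s + 5 / 8 * r \/ dd o y < s + 5 / 8 * r.
  have [hx1|] := leP (s + 5 / 8 * r) (dd o x); last by left.
  have [hy1|] := leP (s + 5 / 8 * r) (dd o y); last by right.
  by move: npp; rewrite !profile_out// eqxx.
have [hx1 hx2] : s + r / 8 <= dd o x /\ dd o x < s + 3 / 4 * r by split; lra.
have [hy1 hy2] : s + r / 8 <= dd o y /\ dd o y < s + 3 / 4 * r by split; lra.
have -> : annulus x by apply/andP; split; lra.
have -> : annulus' y by apply/andP; split; lra.
rewrite !mul1r; have := h_diff x y; have := sqdiff_min_le (h x) (h y) (G x) (G y).
rewrite -!height_profile//; have /andP[p0 p1] := profile01 y.
have q2 : profile y ^+ 2 <= 1 by rewrite expr_le1.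
set p := profile x; set q' := profile y in p0 p1 q2 *.
move=> k1 k2.
have k3 : q' ^+ 2 * (h x - h y) ^+ 2 <= (h x - h y) ^+ 2 by rewrite ler_piMl ?sqr_ge0.
have k4 : h x ^+ 2 * (p - q') ^+ 2 <=
   2 * (h x * p - h y * q') ^+ 2 + 2 * (q' ^+ 2 * (h x - h y) ^+ 2).
  have := sqr_ge0 ((h x * p - h y * q') + q' * (h x - h y)).
  rewrite (_ : h x ^+ 2 * (p - q') ^+ 2 = ((h x * p - h y * q') - q' * (h x - h y)) ^+ 2); last by ring.
  by set z := h x * p - h y * q'; set w := _ - h y; nra.
by lra.
Qed.

Let mI1 : measurable_fun [set: T * T] (fun z => ind (r / 8 <= dd z.1 z.2) * J z.1 z.2).
Proof.
by apply: measurable_funM => //; apply: measurable_bool_natr; exact: measurable_fun_ler.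
Qed.

Let msq1 (u : T -> R) : measurable_fun [set: T] u ->
  measurable_fun [set: T * T] (fun z => u z.1 ^+ 2 * (ind (r / 8 <= dd z.1 z.2) * J z.1 z.2)).
Proof.
move=> mu_; apply: measurable_funM => //; apply: measurable_funX.
exact: (measurableT_comp mu_ measurable_fst).
Qed.

Let msq2 (u : T -> R) : measurable_fun [set: T] u ->
  measurable_fun [set: T * T] (fun z => u z.2 ^+ 2 * (ind (r / 8 <= dd z.1 z.2) * J z.1 z.2)).
Proof.
move=> mu_; apply: measurable_funM => //; apply: measurable_funX.
exact: (measurableT_comp mu_ measurable_snd).
Qed.

Let sq0 (x : R) y z : 0 <= x ^+ 2 * (ind (r / 8 <= dd y z) * J y z).
Proof. exact: mulr_ge0 (sqr_ge0 _) (mulr_ge0 (ler0n _ _) (J_ge0 _ _)). Qed.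

Let mEUr : measurable_fun [set: T * T] (fun z => ind (annulus z.1) * ind (annulus' z.2) *
  ((f z.1 - f z.2) ^+ 2 * J z.1 z.2)).
Proof. exact/measurable_EFinP. Qed.

Let mGJ : measurable_fun [set: T * T] (fun z => (G z.1 - G z.2) ^+ 2 * J z.1 z.2).
Proof. by apply: measurable_funM => //; exact: measurable_sqdiff. Qed.

Let mpJ : measurable_fun [set: T * T] (fun z => (profile z.1 - profile z.2) ^+ 2 * J z.1 z.2).
Proof.
by apply: measurable_funM => //; apply: measurable_sqdiff; exact: measurable_profile.
Qed.

Let EU0 (z : T * T) : 0 <= ind (annulus z.1) * ind (annulus' z.2) *
  ((f z.1 - f z.2) ^+ 2 * J z.1 z.2).
Proof. by have := energyU_fun_ge0 z; rewrite lee_fin. Qed.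

Lemma ge0_integral_comb3 (c1 c2 c3 : R) (f1 f2 f3 : T * T -> R) :
  0 <= c1 -> 0 <= c2 -> 0 <= c3 ->
  (forall z, 0 <= f1 z) -> (forall z, 0 <= f2 z) -> (forall z, 0 <= f3 z) ->
  measurable_fun [set: T * T] f1 -> measurable_fun [set: T * T] f2 ->
  measurable_fun [set: T * T] f3 ->
  (\int[mu \x mu]_z (c1 * f1 z + c2 * f2 z + c3 * f3 z)%:E =
   c1%:E * \int[mu \x mu]_z (f1 z)%:E + c2%:E * \int[mu \x mu]_z (f2 z)%:E +
   c3%:E * \int[mu \x mu]_z (f3 z)%:E)%E.
Proof.
move=> c10 c20 c30 f10 f20 f30 mf1 mf2 mf3.
have E1 : measurable_fun [set: T * T] (fun z => (f1 z)%:E) by exact/measurable_EFinP.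
have E2 : measurable_fun [set: T * T] (fun z => (f2 z)%:E) by exact/measurable_EFinP.
have E3 : measurable_fun [set: T * T] (fun z => (f3 z)%:E) by exact/measurable_EFinP.
rewrite -!ge0_integralZl//; try by move=> z _; rewrite lee_fin.
rewrite -!ge0_integralD//; try by
  [ exact: emeasurable_funM | move=> z _; rewrite -EFinM lee_fin mulr_ge0
  | apply: emeasurable_funD; exact: emeasurable_funM
  | move=> z _; rewrite -!EFinM -EFinD lee_fin addr_ge0 ?mulr_ge0 ].
Qed.

Lemma L2sq_profile : (L2sq profile <= (V o (s + r))%:E)%E.
Proof.
have sr : 0 < s + r by have := r_gt0; have := r_le_s; lra.
rewrite -muV// -[leRHS](integral_bool_natr _ (measurable_lt_dd _ _)).
apply: ge0_le_integral => //.
- by move=> y _; rewrite lee_fin sqr_ge0.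
- by apply: measurable_EFin_sqr; exact: measurable_profile.
- exact/measurable_EFinP.
- move=> y _; rewrite lee_fin; have [hy|hy] := ltP (dd o y) (s + r).
    by have /andP[? ?] := profile01 y; rewrite expr_le1.
  by rewrite profile_out ?expr0n//; have := r_gt0; lra.
Qed.

(** Only finiteness matters here, for membership in [F], so the factor e^-2 coming from h >= e is
    harmless. *)
Lemma energy_profile : (energy profile < +oo)%E.
Proof.
have mp := measurable_profile; have e20 : 0 <= (e ^+ 2)^-1 by rewrite invr_ge0 sqr_ge0.
have t0 : 0 < r / 8 by rewrite divr_gt0.
(* The zero third terms fit the shape of [ge0_integral_comb3]. *)
pose F1 (z : T * T) := (e ^+ 2)^-1 * (2 * ((G z.1 - G z.2) ^+ 2 * J z.1 z.2) +
  4 * (ind (annulus z.1) * ind (annulus' z.2) * ((f z.1 - f z.2) ^+ 2 * J z.1 z.2)) + 0 * 0).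
pose F2 (z : T * T) := 2 * (profile z.1 ^+ 2 * (ind (r / 8 <= dd z.1 z.2) * J z.1 z.2)) +
  2 * (profile z.2 ^+ 2 * (ind (r / 8 <= dd z.1 z.2) * J z.1 z.2)) + 0 * 0.
have G0 z : 0 <= (G z.1 - G z.2) ^+ 2 * J z.1 z.2 by exact: sqrJ_ge0.
have F10 z : 0 <= F1 z.
  by rewrite /F1 mulr_ge0// mulr0 addr0 addr_ge0// mulr_ge0.
have F20 z : 0 <= F2 z.
  by rewrite /F2 mulr0 addr0 addr_ge0// mulr_ge0.
have mF1 : measurable_fun [set: T * T] F1.
  apply: measurable_funM => //; apply: measurable_funD => //.
  by apply: measurable_funD; apply: measurable_funM.
have mF2 : measurable_fun [set: T * T] F2.
  apply: measurable_funD => //; apply: measurable_funD; apply: measurable_funM => //.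
    exact: msq1.
  exact: msq2.
have cmp : (energy profile <= \int[mu \x mu]_z (F1 z + F2 z)%:E)%E.
  apply: ge0_le_integral => //.
  - by move=> z _; exact: energy_fun_ge0.
  - exact: measurable_energy_fun.
  - by apply/measurable_EFinP; exact: measurable_funD.
  - move=> [x y] _; rewrite lee_fin /=; have [xy|xy] := ltP (dd x y) (r / 8).
      rewrite -[leLHS]addr0; apply: lerD (F20 (x, y)).
      rewrite /F1 /= mulr0 addr0 [leRHS]mulrC ler_pdivlMr ?exprn_gt0//.
      apply: (@le_trans _ _ (h x ^+ 2 * (profile x - profile y) ^+ 2 * J x y)).
        rewrite [leLHS]mulrC mulrA ler_wpM2r// ler_wpM2r ?sqr_ge0//.
        by apply: lerXn2r; rewrite ?nnegrE; [exact: ltW|exact: ltW|rewrite /h /height lerDr].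
      apply: (le_trans (ler_wpM2r (J_ge0 x y) (profile_near xy))).
      by rewrite le_eqVlt; apply/orP; left; apply/eqP; ring.
    rewrite -[leLHS]add0r; apply: lerD (F10 (x, y)) _.
    rewrite /F2 /= xy !mul1r mulr0 addr0.
    rewrite [leRHS](_ : _ = (2 * profile x ^+ 2 + 2 * profile y ^+ 2) * J x y); last by ring.
    rewrite ler_wpM2r//.
    by have := sqr_ge0 (profile x + profile y); nra.
apply: (le_lt_trans cmp).
under eq_integral => z _ do rewrite EFinD.
rewrite ge0_integralD//; try by [exact/measurable_EFinP | move=> z _; rewrite lee_fin].
have ltD (x y : \bar R) : (x < +oo)%E -> (y < +oo)%E -> (x + y < +oo)%E by exact: lte_add_pinfty.
have ltM (k' : R) (x : \bar R) : 0 <= k' -> (0 <= x)%E -> (x < +oo)%E -> (k'%:E * x < +oo)%E.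
  by move=> k0 x0 xoo; apply: lte_mul_pinfty.
have tailfin : ((Ctail / phi (r / 8))%:E * L2sq profile < +oo)%E.
  apply: (ltM); last exact: le_lt_trans L2sq_profile (ltry _).
    by rewrite divr_ge0 ?Ctail_ge0// ltW// phi_gt0.
  exact: L2sq_ge0.
apply: (ltD).
  rewrite /F1; under eq_integral => z _ do rewrite EFinM.
  rewrite ge0_integralZl//; last 2 first.
  - apply/measurable_EFinP; apply: measurable_funD => //.
    by apply: measurable_funD; apply: measurable_funM.
  - by move=> z _; rewrite lee_fin mulr0 addr0 addr_ge0// mulr_ge0.
  rewrite ge0_integral_comb3// integral_cst// mul0e adde0.
  apply: (ltM) => //.
    apply: adde_ge0; apply: mule_ge0 => //; apply: integral_ge0 => z _; rewrite lee_fin//.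
  apply: (ltD); apply: (ltM) => //; last 2 first.
  - exact: energyU_ge0.
  - exact: energyU_fin.
  exact: energy_ge0.
rewrite /F2 ge0_integral_comb3//; last 2 first.
- exact: msq1.
- exact: msq2.
rewrite integral_cst// mul0e adde0.
apply: (ltD); apply: (ltM) => //.
- by apply: integral_ge0 => z _; rewrite lee_fin.
- exact: le_lt_trans (tail_mass mp t0) tailfin.
- by apply: integral_ge0 => z _; rewrite lee_fin.
- exact: le_lt_trans (tail_mass2 mp t0) tailfin.
Qed.

Lemma F_profile : F profile.
Proof.
have sr : 0 < s + r by have := r_gt0; have := r_le_s; lra.
apply: (@F_maximal profile o (s + r)) => //.
- exact: measurable_profile.
- by move=> y; have /andP[] := profile01 y.
- by move=> y hy; apply: profile_out; rewrite -leNgt in hy; have := r_gt0; lra.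
- exact: le_lt_trans L2sq_profile (ltry _).
- exact: energy_profile.
Qed.

(** Pairs closer than r/8 are handled by [profile_near] and |f| <= h. For the others the squared
    increment of the profile is at most 1, and the tail of the kernel is integrated against f^2 over
    the ball. *)
Lemma profile_cutoff_energy :
  (\int[mu \x mu]_z (ind (dd o z.1 < s + 2 * r) *
     (f z.1 ^+ 2 * ((profile z.1 - profile z.2) ^+ 2 * J z.1 z.2)))%:E <=
   2%:E * energy G + 4%:E * energyU + (Ctail / phi (r / 8))%:E * massB)%E.
Proof.
have mp := measurable_profile.
have t0 : 0 < r / 8 by rewrite divr_gt0.
pose u y := ind (dd o y < s + 2 * r) * f y.
have mu_ : measurable_fun [set: T] u by exact: measurable_funM.
have uE y : u y ^+ 2 = ind (dd o y < s + 2 * r) * f y ^+ 2.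
  by rewrite /u; case: (_ < _); rewrite ?mul1r ?mul0r ?expr0n.
have -> : massB = L2sq u by apply: eq_integral => y _; rewrite uE.
have hp z : 0 <= f z.1 ^+ 2 * ((profile z.1 - profile z.2) ^+ 2 * J z.1 z.2).
  exact: mulr_ge0 (sqr_ge0 _) (sqrJ_ge0 _ _ _).
apply: (@le_trans _ _ (\int[mu \x mu]_z (2 * ((G z.1 - G z.2) ^+ 2 * J z.1 z.2) +
  4 * (ind (annulus z.1) * ind (annulus' z.2) * ((f z.1 - f z.2) ^+ 2 * J z.1 z.2)) +
  1 * (u z.1 ^+ 2 * (ind (r / 8 <= dd z.1 z.2) * J z.1 z.2)))%:E)%E).
  apply: ge0_le_integral => //.
  - by move=> z _; rewrite lee_fin; exact: mulr_ge0.
  - apply/measurable_EFinP; apply: measurable_funM.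
      exact: (@m1 (fun y => dd o y < s + 2 * r) (measurable_lt_dd _ _)).
    apply: measurable_funM => //; apply: measurable_funX.
    exact: (measurableT_comp mf measurable_fst).
  - apply/measurable_EFinP; apply: measurable_funD.
      by apply: measurable_funD; apply: measurable_funM.
    by apply: measurable_funM => //; exact: msq1.
  - move=> [x y] _ /=; rewrite lee_fin.
    have [xy|xy] := ltP (dd x y) (r / 8).
      rewrite mul0r mulr0 mulr0 addr0.
      apply: (@le_trans _ _ (h x ^+ 2 * (profile x - profile y) ^+ 2 * J x y)).
        apply: (@le_trans _ _ (f x ^+ 2 * ((profile x - profile y) ^+ 2 * J x y))).
          by apply: ler_piMl; [exact: (hp (x, y))|case: (_ < _)].
        by rewrite mulrA ler_wpM2r// ler_wpM2r ?sqr_ge0.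
      apply: (le_trans (ler_wpM2r (J_ge0 x y) (profile_near xy))).
      by rewrite le_eqVlt; apply/orP; left; apply/eqP; ring.
    rewrite -[leLHS]add0r; apply: lerD.
      by rewrite addr_ge0// mulr_ge0//; [exact: sqrJ_ge0|exact: (EU0 (x, y))].
    rewrite !mul1r uE mulrA ler_wpM2l//; first exact: mulr_ge0 (ler0n _ _) (sqr_ge0 _).
    rewrite ler_piMl//.
    have /andP[? ?] := profile01 x; have /andP[? ?] := profile01 y.
    by rewrite -[leLHS]real_normK ?num_real// expr_le1// ler_norml; apply/andP; split; lra.
rewrite ge0_integral_comb3//; last 2 first.
- by move=> z; exact: sqrJ_ge0.
- exact: msq1.
by rewrite mul1e; apply: leeD => //; exact: tail_mass.
Qed.

End Profile.

(** * Existence of the cutoff and elimination of the auxiliary constant *)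

Definition Ccut1 := 2 * Csmooth1 l a C1 + 4.
(** One 2 is the coefficient of the energy of g, the other comes from [L2sq_data]. Since k r / 8 =
    2^-(l + 4) r, passing from [phi] there to phi(r) costs K^(l + 5). *)
Definition Ccut2 := 4 * Csmooth2 l a C1 * K ^+ (l + 5).

Let phi_inv_scale n t : 0 < t -> r <= 2 ^+ n * t -> (phi t)^-1 <= K ^+ n.+1 / phi r.
Proof.
move=> t0 rt; rewrite ler_pdivlMr ?phi_gt0// mulrC ler_pdivrMr ?phi_gt0//.
exact: phi_cmp.
Qed.

Lemma cutoff_exists : exists psi : T -> R, [/\ F psi, forall y, 0 <= psi y <= 1,
  forall y, dd o y < s -> psi y = 1, forall y, ~~ (dd o y < s + r) -> psi y = 0
  & (\int[mu \x mu]_z (ind (dd o z.1 < s + 2 * r) *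
       (f z.1 ^+ 2 * ((psi z.1 - psi z.2) ^+ 2 * J z.1 z.2)))%:E <=
     Ccut1%:E * energyU + ((Ccut2 + Ctail * K ^+ 4) / phi r)%:E * massB +
     (Ccut2 * (e ^+ 2 * V o (s + 2 * r)) / phi r)%:E)%E].
Proof.
have L1' := L1; have A1 := A_ge1; have r0 := r_gt0; have p0 := phi_gt0 r0.
have kE : k * 2 * L = 1 by field; rewrite gt_eqF//; lra.
have k0 := k_gt0.
have [x|eta [Feta eta01 eta1 eta0 etaE]] := @cap_family scale.
  move=> _; apply: hcapr; rewrite /scale mulrC ler_wpM2r ?ramp_le//; exact: ltW.
have meta i := F_measurable (Feta i).
have md := measurable_data.
have dint : forall x r', (\int[mu]_z (ind (dd x z < r') * data z)%:E < +oo)%E.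
  apply: integral_ball_bounded => //; first exact: data_ge0.
  apply: (le_lt_trans L2sq_data); apply: lte_add_pinfty; last exact: ltry.
  by apply: lte_mul_pinfty => //; exact: massB_fin.
have t0 : 0 < k * (r / 8) by rewrite mulr_gt0// divr_gt0.
pose G := smoothed (erefl L) scale_ge0 scale_lip eta data.
have mG : measurable_fun [set: T] G.
  exact: (measurable_smoothed (erefl L) scale_ge0 measurable_scale scale_lip A_ge1 LA meta eta01 eta1 eta0 md).
have G0 y : 0 <= G y by exact: (smoothed_ge0 _ _ _ _ data_ge0).
have G_mid y : s + r / 8 <= dd o y <= s + r / 4 -> G y = h y.
  move=> /[dup] hy /scale_eq0; rewrite /G /smoothed => ->; rewrite eqxx /data.
  by rewrite (_ : collar y) ?mul1r//; apply/andP; split; lra.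
(* The smoothing sees at most 4 A k r = r/64 away from y, less than the gap r/8 between the collar
   and s + 5r/8. *)
have G_out y : s + 5 / 8 * r <= dd o y -> G y = 0.
  move=> hy; have sy : 0 < scale y.
    by apply: (lt_le_trans t0); apply: scale_out; rewrite negb_and -!leNgt; apply/orP; right; lra.
  apply: (smoothed_support (erefl L) scale_ge0 scale_lip A_ge1 LA eta01 eta1 eta0 md data_ge0 dint sy) => z hz.
  apply: data_out; rewrite negb_and -!leNgt; apply/orP; right.
  have hs : scale y <= k * r by rewrite ler_wpM2l ?ramp_le// ltW.
  have : 4 * A * scale y <= r / 64.
    apply: (@le_trans _ _ (4 * A * (k * r))); first by rewrite ler_wpM2l//; lra.
    by rewrite LA in kE *; rewrite le_eqVlt; apply/orP; left; apply/eqP; field; rewrite gt_eqF//; lra.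
  by have := dd_tri z o y; rewrite (dd_sym z y); lra.
have EG : (energy G <= (Csmooth1 l a C1)%:E * energyU +
    (Ccut2 / 2 / phi r)%:E * massB + (Ccut2 / 2 * (e ^+ 2 * V o (s + 2 * r)) / phi r)%:E)%E.
  apply: (le_trans (energy_smoothed_le (erefl L) scale_ge0 measurable_scale scale_lip (erefl A)
    A_ge1 LA C1_ge0 meta eta01 eta1 eta0 etaE md data_ge0 dint measurable_collar t0
    data_out scale_out)).
  rewrite -addeA; apply: leeD.
    by apply: lee_wpmul2l; [rewrite lee_fin Csmooth1_ge0|exact: energyD_data].
  have h1 : Csmooth2 l a C1 / phi (k * (r / 8)) <= Csmooth2 l a C1 * (K ^+ (l + 5) / phi r).
    rewrite ler_wpM2l ?Csmooth2_ge0//; have := @phi_inv_scale (l + 4)%N (k * (r / 8)) t0.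
    rewrite -addnS; apply.
    rewrite [leRHS](_ : _ = k * 2 * L * r); first by rewrite kE mul1r.
    by rewrite (exprD _ l 4) [2 ^+ 4](_ : _ = 16); [field; rewrite gt_eqF//; lra|ring].
  have h2 : 0 <= Csmooth2 l a C1 * (K ^+ (l + 5) / phi r).
    by rewrite mulr_ge0 ?Csmooth2_ge0// divr_ge0 ?KX_ge0// ltW.
  apply: (le_trans (lee_wpmul2r (L2sq_ge0 _) (_ : _ <= (Csmooth2 l a C1 * (K ^+ (l + 5) / phi r))%:E)%E)).
    by rewrite lee_fin.
  apply: (le_trans (lee_wpmul2l _ L2sq_data)); first by rewrite lee_fin.
  rewrite ge0_muleDr; last 2 first.
  - by apply: mule_ge0 => //; exact: massB_ge0.
  - rewrite lee_fin; apply: mulr_ge0; first by apply: mulr_ge0 => //; exact: sqr_ge0.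
    exact/ltW/V_gt0.
  rewrite muleA -!EFinM; apply: leeD.
    by rewrite le_eqVlt; apply/orP; left; apply/eqP; congr (_%:E * _)%E; rewrite /Ccut2; field; rewrite gt_eqF.
  by rewrite lee_fin le_eqVlt; apply/orP; left; apply/eqP; rewrite /Ccut2; field; rewrite gt_eqF.
have EGfin : (energy G < +oo)%E.
  apply: (le_lt_trans EG); apply: lte_add_pinfty; last exact: ltry.
  apply: lte_add_pinfty; apply: lte_mul_pinfty => //.
  - by rewrite lee_fin Csmooth1_ge0.
  - exact: energyU_fin.
  - rewrite lee_fin; apply: divr_ge0; last exact: ltW.
    by apply: divr_ge0 => //; apply: mulr_ge0; [apply: mulr_ge0 => //; exact: Csmooth2_ge0|exact: KX_ge0].
  - exact: massB_fin.
exists (profile G); split.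
- exact: F_profile.
- exact: profile01.
- by move=> y hy; apply: profile_in; lra.
- by move=> y; rewrite -leNgt => hy; apply: profile_out => //; lra.
have C20 : 0 <= Ccut2.
  by apply: mulr_ge0; [apply: mulr_ge0 => //; exact: Csmooth2_ge0|exact: KX_ge0].
have X0 := energyU_ge0; have Y0 := massB_ge0.
have V0 : 0 < V o (s + 2 * r) by exact: V_gt0.
have W0 : 0 <= e ^+ 2 * V o (s + 2 * r) by apply: mulr_ge0; [exact: sqr_ge0|exact: ltW].
have fX : energyU \is a fin_num by rewrite ge0_fin_numE// energyU_fin.
have fY : massB \is a fin_num by rewrite ge0_fin_numE// massB_fin.
have fG : energy G \is a fin_num by rewrite ge0_fin_numE ?energy_ge0.
apply: (le_trans (profile_cutoff_energy mG G0 G_mid G_out)).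
move: EG; rewrite -(fineK fX) -(fineK fY) -(fineK fG) -!EFinM -!EFinD !lee_fin => EG.
have fY0 : 0 <= fine massB by exact: fine_ge0.
have h8 : Ctail / phi (r / 8) * fine massB <= Ctail * (K ^+ 4 / phi r) * fine massB.
  rewrite ler_wpM2r// ler_wpM2l ?Ctail_ge0//; apply: phi_inv_scale; first by rewrite divr_gt0.
  by rewrite !exprS expr0; lra.
rewrite (_ : Ccut1 * _ + _ + _ = 2 * (Csmooth1 l a C1 * fine energyU + Ccut2 / 2 / phi r * fine massB
   + Ccut2 / 2 * (e ^+ 2 * V o (s + 2 * r)) / phi r) + 4 * fine energyU +
   Ctail * (K ^+ 4 / phi r) * fine massB); last first.
  by rewrite /Ccut1; field; rewrite gt_eqF.
by apply: lerD => //; rewrite lerD2r ler_wpM2l.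
Qed.

End Cutoff.

Definition Ccsj := 2 * Ccut2 + Ctail * K ^+ 4.

Lemma F_cst1 o r0 : 0 < r0 -> (forall y, dd o y < r0) -> F (fun=> 1).
Proof.
move=> r00 hy; apply: (@F_maximal (fun=> 1) o r0) => //.
- by move=> y; rewrite hy.
- rewrite /L2sq (eq_integral (fun y => (ind (dd o y < r0))%:E)); last first.
    by move=> y _; rewrite hy expr1n.
  by rewrite integral_bool_natr/= ?muV ?ltry//; exact: measurable_lt_dd.
- by rewrite /energy integral0_eq// => z _; rewrite subrr expr0n mul0r.
Qed.

Lemma integral_weight_eq0 (w : T -> R) (G : T * T -> R) :
  measurable_fun [set: T] w -> measurable_fun [set: T * T] G ->
  (forall y, 0 <= w y) -> (forall z, 0 <= G z) ->
  (\int[mu]_y (w y)%:E = 0)%E -> (\int[mu \x mu]_z (w z.1 * G z)%:E = 0)%E.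
Proof.
move=> mw mG w0 G0 hw.
have mwG : measurable_fun [set: T * T] (fun z => (w z.1 * G z)%:E).
  apply/measurable_EFinP; apply: measurable_funM => //.
  exact: (measurableT_comp mw measurable_fst).
have wG0 (z : T * T) : (0 <= (w z.1 * G z)%:E)%E by rewrite lee_fin mulr_ge0.
rewrite (fubini_tonelli1 (m1 := mu) (m2 := mu) _ mwG wG0).
have /ae_eq_integral_abs : measurable_fun [set: T] (fun y => (w y)%:E).
  exact/measurable_EFinP.
move=> /(_ mu measurableT) [+ _].
rewrite (eq_integral (fun y => (w y)%:E)); last first.
  by move=> y _; rewrite gee0_abs// lee_fin.
move=> /(_ hw) wae; rewrite -[RHS](integral0 mu [set: T]); apply: ae_eq_integral => //.
  exact: (@measurable_fun_fubini_tonelli_F _ _ T T R mu _ mwG wG0).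
apply: filterS wae => x /(_ Logic.I) [wx] _.
by rewrite /fubini_F integral0_eq// => y _ /=; rewrite wx mul0r.
Qed.

Lemma cutoff_sobolev (o : T) (r s : R) (f : T -> R) : 0 < r -> r <= s ->
  measurable_fun [set: T] f -> (L2sq f < +oo)%E -> (energy f < +oo)%E ->
  (forall t, t <= r / (2 * L) -> capr t) ->
  exists psi : T -> R, [/\ F psi, forall y, 0 <= psi y <= 1,
  forall y, dd o y < s -> psi y = 1, forall y, ~~ (dd o y < s + r) -> psi y = 0
  & (\int[mu \x mu]_z (ind (dd o z.1 < s + 2 * r) *
       (f z.1 ^+ 2 * ((psi z.1 - psi z.2) ^+ 2 * J z.1 z.2)))%:E <=
     Ccut1%:E * energyU o r s f + (Ccsj / phi r)%:E * massB o r s f)%E].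
Proof.
move=> r0 rs mf fL2 fE hcap.
have V0 : 0 < V o (s + 2 * r) by apply: V_gt0; lra.
have X0 := energyU_ge0 o r s f; have Y0 := massB_ge0 o r s f.
have fY : massB o r s f \is a fin_num by rewrite ge0_fin_numE// massB_fin.
have C20 : 0 <= Ccut2.
  by apply: mulr_ge0; [apply: mulr_ge0 => //; exact: Csmooth2_ge0|exact: KX_ge0].
have p0 := phi_gt0 r0.
(* No positive e matches a zero mass. But then f vanishes almost everywhere on the ball, so the left
   side is 0 and e = 1 will do. *)
have [Y1|Y1] := eqVneq (massB o r s f) 0%E.
  have [psi [h1 h2 h3 h4 _]] := cutoff_exists o r0 rs mf fL2 fE ltr01 hcap.
  exists psi; split => //; rewrite Y1 mule0 adde0.
  rewrite (eq_integral (fun z => ((ind (dd o z.1 < s + 2 * r) * f z.1 ^+ 2) *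
    ((psi z.1 - psi z.2) ^+ 2 * J z.1 z.2))%:E)); last by move=> z _; rewrite mulrA.
  rewrite (@integral_weight_eq0 (fun y => ind (dd o y < s + 2 * r) * f y ^+ 2)
    (fun z => (psi z.1 - psi z.2) ^+ 2 * J z.1 z.2)) //.
  - apply: mule_ge0 => //; rewrite lee_fin; apply: addr_ge0 => //.
    by apply: mulr_ge0 => //; exact: Csmooth1_ge0.
  - apply: measurable_funM; last exact: measurable_funX.
    by apply: measurable_bool_natr; exact: measurable_lt_dd.
  - by apply: measurable_funM => //; apply: measurable_sqdiff; exact: F_measurable.
  - by move=> y; exact: mulr_ge0 (ler0n _ _) (sqr_ge0 _).
  - by move=> z; exact: sqrJ_ge0.
have Yp : 0 < fine (massB o r s f) by rewrite fine_gt0// lt0e Y1 Y0/= -ge0_fin_numE.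
(* With this e the error term e^2 V equals the mass of f^2, whence the second [Ccut2] in [Ccsj]. *)
pose e := Num.sqrt (fine (massB o r s f) / V o (s + 2 * r)).
have e0 : 0 < e by rewrite sqrtr_gt0 divr_gt0.
have eE : e ^+ 2 * V o (s + 2 * r) = fine (massB o r s f).
  by rewrite sqr_sqrtr ?mulfVK ?gt_eqF// divr_ge0// ltW.
have [psi [h1 h2 h3 h4 h5]] := cutoff_exists o r0 rs mf fL2 fE e0 hcap.
exists psi; split => //; apply: (le_trans h5).
rewrite -addeA; apply: leeD => //; rewrite eE -[X in (_ * X + _)%E](fineK fY) -[X in (_ <= _ * X)%E](fineK fY).
rewrite -!EFinM -!EFinD lee_fin le_eqVlt; apply/orP; left; apply/eqP.
by rewrite /Ccsj; field; rewrite gt_eqF.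
Qed.

(** The second alternative covers radii beyond the diameter, where capacity cutoffs may be missing:
    the constant 1 is then a cutoff of zero energy. *)
Lemma cutoff_sobolev_uniform : exists Ca Cb : R, [/\ 0 < Ca, 0 < Cb &
  forall (o : T) (r s : R) (f : T -> R), 0 < r -> r <= s ->
    measurable_fun [set: T] f -> (L2sq f < +oo)%E -> (energy f < +oo)%E ->
    (forall t, t <= r / (2 * L) -> capr t) \/ (forall y, dd o y < s) ->
    exists psi : T -> R, [/\ F psi, forall y, 0 <= psi y <= 1,
    forall y, dd o y < s -> psi y = 1, forall y, ~~ (dd o y < s + r) -> psi y = 0
    & (\int[mu \x mu]_z (ind (dd o z.1 < s + 2 * r) *
         (f z.1 ^+ 2 * ((psi z.1 - psi z.2) ^+ 2 * J z.1 z.2)))%:E <=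
       Ca%:E * energyU o r s f + (Cb / phi r)%:E * massB o r s f)%E]].
Proof.
have C20 : 0 <= Ccut2.
  by apply: mulr_ge0; [apply: mulr_ge0 => //; exact: Csmooth2_ge0|exact: KX_ge0].
have Ca0 : 0 < Ccut1 by have := Csmooth1_ge0; rewrite /Ccut1; lra.
have Cb0 : 0 <= Ccsj.
  apply: addr_ge0; first exact: mulr_ge0.
  by apply: mulr_ge0; [exact: Ctail_ge0|exact: KX_ge0].
(* The added 1 makes the second constant strictly positive. *)
exists Ccut1, (Ccsj + 1); split => //; first by rewrite ltr_wpDl.
move=> o r s f r0 rs mf fL2 fE hr; have p0 := phi_gt0 r0.
have Y0 : (0 <= massB o r s f)%E by exact: massB_ge0.
have X0 : (0 <= energyU o r s f)%E by exact: energyU_ge0.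
case: hr => [hcap|hy].
  have [psi [h1 h2 h3 h4 h5]] := cutoff_sobolev o r0 rs mf fL2 fE hcap.
  exists psi; split => //; apply: (le_trans h5); apply: leeD => //.
  by apply: lee_wpmul2r => //; rewrite lee_fin ler_wpM2r ?lerDl// invr_ge0 ltW.
exists (fun=> 1); split => //.
- by apply: (@F_cst1 o s) => //; exact: lt_le_trans rs.
- by move=> y; rewrite ler01 lexx.
- by move=> y; rewrite (lt_trans (hy y))// ltrDl.
- rewrite integral0_eq; last by move=> z _; rewrite subrr expr0n mul0r !mulr0.
  apply: adde_ge0; apply: mule_ge0 => //; rewrite lee_fin; first exact: ltW.
  by rewrite divr_ge0 ?(ltW p0)// addr_ge0.
Qed.

End Domain.
End JumpSpace.


Lemma measurable_fun_lt_const d (T : measurableType d) (R : realType) (f : T -> R) :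
  (forall r, measurable [set x | f x < r]) -> measurable_fun [set: T] f.
Proof.
move=> mf _ ; apply: (measurability _ (RGenInftyO.measurableE R)) => //.
move=> /= _ [_ [r ->] <-]; rewrite setTI preimage_itvNyo; exact: mf.
Qed.

(** * Metric measure spaces and Dirichlet forms *)

Section MetricMeasure.
Context (R : realType) (X : completeMetricType R).
Variable m : {measure set (borel X) -> \bar R}.
Hypothesis mms : metric_measure_space m.

Let borel_open (A : set X) : open A -> measurable (A : set (borel X)).
Proof. exact: sub_sigma_algebra. Qed.

Lemma open_mball (x : X) r : open (ball x r).
Proof.
rewrite openE => y /=; rewrite ballEmdist => /= xy.
apply/nbhs_ballP; exists (r - mdist x y); first by rewrite /= subr_gt0.
move=> z; rewrite !ballEmdist /= => yz.
by apply: (le_lt_trans (metric_triangle x y z)); rewrite -ltrBrDl.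
Qed.

Lemma measurable_ball_borel (x : X) r : measurable (ball x r : set (borel X)).
Proof. exact: borel_open (open_mball x r). Qed.

Lemma dense_sequence : exists pt : nat -> X,
  forall y e, 0 < e -> exists n, mdist (pt n) y < e.
Proof.
case: mms => _ [D /countable_injP[f finj] dD] _ _ _.
(* An index attained by no point of [D] yields the default point, which does no harm to density. *)
pose pt n := xget point [set x | D x /\ f x = n].
exists pt => y e e0.
have [x [yx Dx]] : ball y e `&` D !=set0.
  by apply: dD; [exists y; exact: ballxx|exact: open_mball].
exists (f x); rewrite (_ : pt (f x) = x).
  by move: yx; rewrite ballEmdist /= metric_sym.
have [Dz fz] : [set z | D z /\ f z = f x] (pt (f x)) by apply: xgetPex; exists x.
by apply: finj => //; rewrite inE.
Qed.

(** Measurability is meant for the product of the Borel sigma-algebras. Separability writes the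
    condition d(x, y) < r as a countable union over the dense sequence of conditions on sums of
    functions of one variable. *)
Lemma measurable_mdist : measurable_fun [set: borel X * borel X]
  (fun z : borel X * borel X => mdist z.1 z.2).
Proof.
have [pt pt_dense] := dense_sequence.
have mpt n : measurable_fun [set: borel X] (fun y : borel X => mdist (pt n) y).
  apply: measurable_fun_lt_const => r; rewrite -ballEmdist; exact: measurable_ball_borel.
apply: measurable_fun_lt_const => r.
rewrite (_ : [set _ | _] = \bigcup_n [set z : borel X * borel X |
    mdist (pt n) z.1 + mdist (pt n) z.2 < r]).
  apply: bigcup_measurable => n _.
  rewrite -[X in measurable X]setTI; apply: measurable_fun_ltr => //.
  apply: measurable_funD; first exact: (measurableT_comp (mpt n) measurable_fst).
  exact: (measurableT_comp (mpt n) measurable_snd).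
apply/seteqP; split => [[x y] /= xy|[x y] [n _] /= h].
  have [n hn] := pt_dense x ((r - mdist x y) / 2) ltac:(by rewrite divr_gt0// subr_gt0).
  exists n => //=; have := metric_triangle (pt n) x y; lra.
by apply: le_lt_trans h; rewrite (metric_sym (pt n) x); exact: metric_triangle.
Qed.

Lemma vol_gt0 (x : X) r : 0 < r -> (0 < vol m x r)%E.
Proof.
move=> r0; case: mms => _ _ _ _; apply; first exact: open_mball.
by exists x; exact: ballxx.
Qed.

(** Local compactness gives one ball of finite measure about x, and doubling spreads finiteness to
    all radii. *)
Lemma vol_fin (CD : R) : (forall (x : X) (r : R), 0 < r -> (vol m x (2 * r) <= CD%:E * vol m x r)%E) ->
  forall (x : X) r, (vol m x r < +oo)%E.
Proof.
move=> dbl x r; case: mms => lc _ _ rad _.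
have [U /nbhs_ballP[e /= e0 eU] [cU clU]] := lc x I.
have ve : (vol m x e < +oo)%E.
  apply: le_lt_trans (rad U cU (fun _ _ => I)); apply: le_measure.
  - by rewrite inE; exact: measurable_ball_borel.
  - by rewrite inE -[U]setCK; apply: measurableC; apply: borel_open; exact: closed_openC.
  - by move=> z /eU; exact.
have vk k : (vol m x (2 ^+ k * e) < +oo)%E.
  elim: k => [|k IH]; first by rewrite mul1r.
  rewrite exprS -mulrA; apply: le_lt_trans (dbl _ _ _) _; first by rewrite mulr_gt0 ?exprn_gt0.
  have vp := vol_gt0 x (mulr_gt0 (exprn_gt0 k (ltr0Sn R 1)) e0).
  by rewrite -(@fineK _ (vol m x (2 ^+ k * e))) ?ge0_fin_numE ?ltW// -EFinM ltry.
have [k hk] : exists k, r <= 2 ^+ k * e.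
  exists (Num.bound (`|r| / e)); rewrite -ler_pdivrMr//.
  have h1 : r / e <= `|r| / e by rewrite ler_wpM2r ?ler_norm// invr_ge0 ltW.
  apply: (le_trans h1); apply: (@le_trans _ _ (Num.bound (`|r| / e))%:R).
    by apply/ltW/archi_boundP; rewrite divr_ge0// ltW.
  by rewrite -natrX ler_nat ltnW// ltn_expl.
apply: le_lt_trans (vk k); apply: le_measure.
- by rewrite inE; exact: measurable_ball_borel.
- by rewrite inE; exact: measurable_ball_borel.
- exact: le_ball.
Qed.

Lemma VD_sigma_finite : VD m -> sigma_finite [set: borel X] m.
Proof.
case=> CD _ dbl; exists (fun n => ball (point : X) n.+1%:R).
  apply/esym/seteqP; split => // y _; exists (Num.bound (mdist point y)) => //.
  rewrite ballEmdist /=; apply: (lt_le_trans (archi_boundP (mdist_ge0 _ _))).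
  by rewrite ler_nat.
by move=> n; split; [exact: measurable_ball_borel|exact: vol_fin dbl _ _].
Qed.

End MetricMeasure.

(** Tonelli needs the sigma-finite structure; the measure is repacked as an equal one, so that
    statements transfer by rewriting. *)
Lemma sigma_finite_pack d (T : measurableType d) (R : realType) (m : {measure set T -> \bar R}) :
  sigma_finite [set: T] m -> exists m' : {sigma_finite_measure set T -> \bar R}, m = m'.
Proof.
case: m => m0 c msf; pose m1 := Measure.Pack c.
have h := @Measure_isSigmaFinite.Build _ _ _ m1 msf.
pose m' : {sigma_finite_measure set T -> \bar R} :=
  HB.pack_for {sigma_finite_measure set T -> \bar R} m0 c h.
by exists m'.
Qed.

(** * From the Dirichlet form to the abstract hypotheses *)

Section Form.
Context (R : realType) (X : completeMetricType R).
Variable m : {sigma_finite_measure set (borel X) -> \bar R}.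
Variables (F : set (X -> R)) (E : (X -> R) -> (X -> R) -> R) (J : X -> X -> R).
Hypothesis mms : metric_measure_space m.
Hypothesis form : regular_pure_jump_dirichlet_form m F E J.
Local Notation T := (borel X).
Local Notation ind b := ((b%R : bool)%:R%R : R).

Let J_ge0 x y : 0 <= J x y. Proof. by case: form => _ _ []. Qed.
Let mJ : measurable_fun [set: T * T] (fun z : T * T => J z.1 z.2).
Proof. by case: form => _ _ []. Qed.

Lemma L2_fin (f : T -> R) : f \in Lfun m 2%:E -> (L2sq m f < +oo)%E.
Proof.
move=> /Lfun2_integrable_sqr /integrableP[_]; congr (_ < _)%E.
by apply: eq_integral => x _; rewrite [LHS]gee0_abs// lee_fin sqr_ge0.
Qed.

Lemma L2norm_sqr (f : X -> R) : (f : T -> R) \in Lfun m 2%:E ->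
  (L2norm m f ^+ 2)%:E = L2sq m (f : T -> R).
Proof.
move=> fL; have := fL; rewrite inE => /andP[_]; rewrite inE /= => fn.
have fn' : ('N[m]_2%:E [EFin \o (f : T -> R)] \is a fin_num)%E.
  by rewrite ge0_fin_numE ?Lnorm_ge0.
have := poweR_Lnorm m (EFin \o (f : T -> R)) (_ : 2 != 0 :> R).
rewrite -(fineK fn') => /(_ ltac:(by [])) h.
rewrite /L2norm -powR_mulrn; last by rewrite fine_ge0 ?Lnorm_ge0.
rewrite -poweR_EFin h; apply: eq_integral => x _ /=.
by rewrite -real_normK ?num_real// powR_mulrn.
Qed.

Lemma measurable_offdiag : measurable (@offdiag R X : set (T * T)).
Proof.
rewrite (_ : @offdiag R X = [set z : T * T | 0 < mdist z.1 z.2]).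
  rewrite -[X in measurable X]setTI; apply: measurable_fun_ltr => //.
  exact: measurable_mdist mms.
apply/seteqP; split => z /=; rewrite mdist_gt0; first by move/eqP.
by move=> /eqP.
Qed.

Let mdiff (f : X -> R) : measurable_fun [set: T] (f : T -> R) ->
  measurable_fun [set: T * T] (fun z : T * T => (f z.1 - f z.2) ^+ 2).
Proof.
move=> mf; apply: measurable_funX; apply: measurable_funB.
  exact: (measurableT_comp mf measurable_fst).
exact: (measurableT_comp mf measurable_snd).
Qed.

Lemma jump_energyE (f : X -> R) (A : set (T * T)) :
  measurable_fun [set: T] (f : T -> R) -> measurable A ->
  jump_energy m J f A =
  (\int[m \x m]_(z in A) ((f z.1 - f z.2) ^+ 2 * J z.1 z.2)%:E)%E.
Proof.
move=> mf mA; pose w : T * T -> \bar R := (fun z => (J z.1 z.2)%:E) \_ (@offdiag R X : set (T * T)).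
have mw : measurable_fun [set: T * T] w.
  apply/(measurable_restrictT _ _).1; first exact: measurable_offdiag.
  by apply: measurable_funTS; exact/measurable_EFinP.
have w0 z : (0 <= w z)%E by rewrite /w /patch; case: ifP => // _; rewrite lee_fin.
rewrite /jump_energy (_ : jump_measure m J = density (m \x m)%E w); last first.
  by apply/funext => B; rewrite /jump_measure integral_mkcondr.
rewrite ge0_integral_density//.
- apply: eq_integral => z _; rewrite /w /patch; case: ifPn; first by rewrite EFinM.
  rewrite notin_setE /offdiag /= => /contrapT ->.
  by rewrite subrr expr0n mul0r mule0.
- by apply: measurable_funTS; apply/measurable_EFinP; exact: mdiff.
- by move=> z; rewrite lee_fin sqr_ge0.
Qed.

(** The energy measure is by definition a density, so the integral of f^2 against it is an iterated
    integral, and Tonelli makes it a double one. *)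
Lemma energy_measureE (psi f : X -> R) (B : T -> bool) :
  measurable_fun [set: T] (psi : T -> R) -> measurable_fun [set: T] (f : T -> R) ->
  measurable_fun [set: T] B ->
  (\int[energy_measure m J psi]_(y in [set y | B y]) (f y ^+ 2)%:E =
   \int[m \x m]_z (ind (B z.1) * (f z.1 ^+ 2 * ((psi z.1 - psi z.2) ^+ 2 * J z.1 z.2)))%:E)%E.
Proof.
move=> mpsi mf mB; pose w (x : T) : \bar R := (\int[m]_y ((psi x - psi y) ^+ 2 * J x y)%:E)%E.
have mk : measurable_fun [set: T * T]
    (fun z : T * T => ((psi z.1 - psi z.2) ^+ 2 * J z.1 z.2)%:E).
  by apply/measurable_EFinP; apply: measurable_funM => //; exact: mdiff.
have k0 (z : T * T) : (0 <= ((psi z.1 - psi z.2) ^+ 2 * J z.1 z.2)%:E)%E.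
  by rewrite lee_fin mulr_ge0 ?sqr_ge0.
have mw : measurable_fun [set: T] w.
  exact: (@measurable_fun_fubini_tonelli_F _ _ T T R m _ mk k0).
have w0 x : (0 <= w x)%E by apply: integral_ge0 => y _; exact: (k0 (x, y)).
have mf1 : measurable_fun [set: T * T] (fun z : T * T => ind (B z.1) * f z.1 ^+ 2).
  apply: measurable_funM.
    by apply: measurable_bool_natr; exact: (measurableT_comp mB measurable_fst).
  by apply: measurable_funX; exact: (measurableT_comp mf measurable_fst).
have mG : measurable_fun [set: T * T] (fun z : T * T =>
    (ind (B z.1) * (f z.1 ^+ 2 * ((psi z.1 - psi z.2) ^+ 2 * J z.1 z.2)))%:E).
  apply/measurable_EFinP.
  rewrite (_ : (fun z => _) = fun z : T * T => (ind (B z.1) * f z.1 ^+ 2) *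
     ((psi z.1 - psi z.2) ^+ 2 * J z.1 z.2)); last by apply/funext => z; rewrite mulrA.
  by apply: measurable_funM => //; exact/measurable_EFinP.
have G0 (z : T * T) : (0 <= (ind (B z.1) *
    (f z.1 ^+ 2 * ((psi z.1 - psi z.2) ^+ 2 * J z.1 z.2)))%:E)%E.
  by rewrite lee_fin; apply: mulr_ge0 => //; apply: mulr_ge0; [exact: sqr_ge0|have := k0 z; rewrite lee_fin].
have mBs : measurable [set y | B y] by rewrite -[X in measurable X]setTI; exact: mB.
have -> : energy_measure m J psi = density m w by [].
rewrite ge0_integral_density//; last 2 first.
- by apply: measurable_funTS; apply/measurable_EFinP; exact: measurable_funX.
- by move=> x; rewrite lee_fin sqr_ge0.
rewrite integral_mkcond (fubini_tonelli1 (m1 := m) (m2 := m) _ mG G0).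
apply: eq_integral => x _; rewrite /fubini_F /patch.
have [Bx|nBx] := boolP (B x); last first.
  rewrite memNset; last exact/negP.
  by rewrite [RHS]integral0_eq// => y _; rewrite /= mul0r.
rewrite mem_set// /w -ge0_integralZl//; last 3 first.
- exact: (measurableT_comp mk (pair1_measurable x)).
- by move=> y _; exact: (k0 (x, y)).
- by rewrite lee_fin sqr_ge0.
by apply: eq_integral => y _ /=; rewrite mul1r EFinM.
Qed.

Lemma F_Lfun (f : X -> R) : F f -> (f : T -> R) \in Lfun m 2%:E.
Proof. by case: form => -[[h _ _ _ _] _ _ _] _ _ _; exact: h. Qed.

Lemma F_measurableT (f : X -> R) : F f -> measurable_fun [set: T] (f : T -> R).
Proof. by move=> /F_Lfun; rewrite inE => /andP[]; rewrite inE. Qed.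

Lemma form_energy (f : X -> R) : F f -> (E f f)%:E = energy m J (f : T -> R).
Proof.
move=> Ff; case: form => _ _ _ /(_ _ Ff) ->.
rewrite jump_energyE; [|exact: F_measurableT|exact: measurable_offdiag].
rewrite integral_mkcond; apply: eq_integral => z _; rewrite /patch; case: ifPn => //.
rewrite notin_setE /offdiag /= => /contrapT ->.
by rewrite subrr expr0n mul0r.
Qed.

Lemma F_linearT (k : R) (f g : X -> R) : F f -> F g -> F (fun x => k * f x + g x).
Proof. by case: form => -[[_ _ _ h _] _ _ _] _ _ _; exact: h. Qed.

Lemma F_zeroT : F (fun=> 0).
Proof. by case: form => -[[_ _ h _ _] _ _ _] _ _ _. Qed.

Lemma F_markovT (f : X -> R) : F f -> F (fun x => Num.min (Num.max (f x) 0) 1).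
Proof. by case: form => -[_ _ _ h] _ _ _ /h[]. Qed.

Lemma F_aeT (f g : X -> R) : F f -> measurable_fun [set: T] (g : T -> R) ->
  L2sq m (fun y : T => f y - g y) = 0%E -> F g.
Proof.
move=> Ff mg h; have mf := F_measurableT Ff.
case: form => -[[_ hae _ _ _] _ _ _] _ _ _; apply: (hae f) => //.
have /ae_eq_integral_abs : measurable_fun [set: T] (fun y : T => ((f y - g y) ^+ 2)%:E).
  by apply/measurable_EFinP; apply: measurable_funX; exact: measurable_funB.
move=> /(_ m measurableT) [+ _].
rewrite (eq_integral (fun y : T => ((f y - g y) ^+ 2)%:E)); last first.
  by move=> y _; rewrite gee0_abs// lee_fin sqr_ge0.
move=> /(_ h); apply: filterS => y + _ => /(_ Logic.I) /= [].
by move=> /eqP; rewrite sqrf_eq0 subr_eq0 => /eqP.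
Qed.

Lemma form_norm_sqr (f : X -> R) : F f ->
  (form_norm m E f ^+ 2)%:E = (energy m J (f : T -> R) + L2sq m (f : T -> R))%E.
Proof.
move=> Ff; case: form => -[_ [_ _ _ E0] _ _] _ _ _.
by rewrite sqr_sqrtr ?addr_ge0 ?sqr_ge0 ?E0// EFinD L2norm_sqr ?F_Lfun// form_energy.
Qed.

Lemma F_subT (f g : X -> R) : F f -> F g -> F (f \- g).
Proof.
move=> Ff Fg; rewrite (_ : f \- g = fun x => -1 * g x + f x); first exact: F_linearT.
by apply/funext => x /=; ring.
Qed.

Lemma F_closedT (v : nat -> X -> R) : (forall n, F (v n)) ->
  (forall e : R, 0 < e -> exists N : nat, forall n k, (N <= n)%N -> (N <= k)%N ->
     (energy m J (fun y : T => v n y - v k y)%R + L2sq m (fun y : T => v n y - v k y)%R <= e%:E)%E) ->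
  exists2 f, F f & forall e : R, 0 < e ->
     exists n0 : nat, forall n, (n0 <= n)%N -> (L2sq m (fun y : T => v n y - f y)%R <= e%:E)%E.
Proof.
move=> Fv hv; have := form => -[[_ _ cl _] _ _ _].
have [|f Ff cvf] := cl v Fv.
  (* Half of e^2 turns the non-strict bound into the strict one that closedness asks for. *)
  move=> e e0; have [|N hN] := hv (e ^+ 2 / 2); first by rewrite divr_gt0 ?exprn_gt0.
  exists N => n k Nn Nk; have := hN n k Nn Nk.
  rewrite -(form_norm_sqr (F_subT (Fv n) (Fv k))) lee_fin => h.
  rewrite ltNge; apply/negP => ge; have : e ^+ 2 <= form_norm m E (v n \- v k) ^+ 2.
    by rewrite ler_sqr ?nnegrE ?sqrtr_ge0// ltW.
  by have := exprn_gt0 2 e0; lra.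
exists f => // e e0.
have se0 : 0 < Num.sqrt e by rewrite sqrtr_gt0.
have /cvgrPdist_lt/(_ _ se0) [n0 _ hn0] := cvf.
exists n0 => n hn; have := hn0 n hn; rewrite /= sub0r normrN ger0_norm ?sqrtr_ge0// => hlt.
have := form_norm_sqr (F_subT (Fv n) Ff) => eq.
apply: (@le_trans _ _ ((form_norm m E (v n \- f) ^+ 2)%:E)).
  by rewrite eq leeDr// energy_ge0.
rewrite lee_fin -[leRHS](@sqr_sqrtr _ e) ?(ltW e0)//.
by rewrite ler_sqr ?nnegrE ?sqrtr_ge0// ltW.
Qed.

End Form.

(** * Scale functions *)

(** C 2^beta2 serves both for doubling and for monotonicity up to a constant; q = 2^-beta1 is the
    decay per halving of the radius. *)
Lemma scale_function_bounds (R : realType) (phi : R -> R) : scale_function phi ->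
  exists K q : R, [/\ 1 <= K, 0 < q < 1, forall r, 0 < r -> 0 < phi r,
    forall r s, 0 < r -> r <= s -> phi r <= K * phi s
  & forall r, 0 < r -> phi (2 * r) <= K * phi r /\
      forall k, phi r <= K * q ^+ k * phi (2 ^+ k * r)].
Proof.
move=> [[g [phi_set _ _ _ _]] [C [b1 [b2 [C1 b10 b12 hC]]]]].
have C0 : 0 < C by lra.
have phi_gt0 r : 0 < r -> 0 < phi r.
  move=> r0; rewrite lt_neqAle; apply/andP; split.
    (* If phi r were 0, the quotient phi r / phi r would be 0 by convention, against the positive
       lower bound 1 / C. *)
    apply/negP => /eqP p0; have [+ _] := hC r r r0 (lexx r).
    by rewrite -p0 mul0r divff ?gt_eqF// powR1 mulr1 leNgt invr_gt0 C0.
  by have := phi_set r; rewrite /= !in_itv/= !andbT; apply; exact: ltW.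
have low r s : 0 < r -> r <= s -> (s / r) `^ b1 * phi r <= C * phi s.
  move=> r0 rs; have [+ _] := hC r s r0 rs.
  by rewrite ler_pdivlMr ?phi_gt0// -mulrA mulrC ler_pdivrMr// [_ * C]mulrC.
have two_b2 : 1 <= 2 `^ b2 :> R.
  by rewrite -[leLHS](powRr0 2) ler_powR ?ler1n//; lra.
have KC : C <= C * 2 `^ b2 by rewrite ler_peMr// ltW.
exists (C * 2 `^ b2), (2 `^ (- b1)); split => //.
- lra.
- by rewrite powR_gt0//= powRN invf_lt1 ?powR_gt0// /powR pnatr_eq0/= expR_gt1 mulr_gt0 ?ln_gt0 ?ltr1n.
- move=> r s r0 rs; have := low r s r0 rs.
  have h : 1 <= (s / r) `^ b1.
    rewrite -[leLHS](powRr0 (s / r)) ler_powR//; last exact: ltW.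
    by rewrite ler_pdivlMr ?mul1r.
  have p0 := phi_gt0 r r0; have p1 : 0 < phi s by apply: phi_gt0; lra.
  have : C * phi s <= C * 2 `^ b2 * phi s by rewrite ler_wpM2r// ltW.
  have : phi r <= (s / r) `^ b1 * phi r by rewrite ler_peMl// ltW.
  by lra.
- move=> r r0; have p0 := phi_gt0 r r0; split.
    have [_] := hC r (2 * r) r0 ltac:(lra).
    by rewrite mulfK ?gt_eqF// ler_pdivrMr.
  move=> k; have k1 : 1 <= 2 ^+ k :> R by rewrite exprn_ege1// ler1n.
  have rk : r <= 2 ^+ k * r by rewrite ler_peMl// ltW.
  have := low r _ r0 rk; rewrite mulfK ?gt_eqF//.
  have -> : (2 ^+ k) `^ b1 = (2 `^ b1) ^+ k :> R.
    elim: (k) => [|j IH]; first by rewrite !expr0 powR1.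
    by rewrite !exprS powRM ?exprn_ge0// IH.
  move=> h; rewrite powRN exprVn mulrAC ler_pdivlMr ?exprn_gt0 ?powR_gt0//.
  rewrite mulrC; apply: (le_trans h); rewrite ler_wpM2r//.
  by apply/ltW/phi_gt0; lra.
Qed.

(** * The cutoff Sobolev inequality for a sigma-finite measure *)

Section SigmaFinite.
Context (R : realType) (X : completeMetricType R).
Variable m : {sigma_finite_measure set (borel X) -> \bar R}.
Variables (phi : R -> R) (F : set (X -> R)) (E : (X -> R) -> (X -> R) -> R).
Variable J : X -> X -> R.
Local Notation T := (borel X).
Local Notation ind b := ((b%R : bool)%:R%R : R).

Lemma diam_ge (x y : X) : ((mdist x y)%:E <= diam X)%E.
Proof. by apply: ereal_sup_ubound; exists (x, y). Qed.

Lemma CSJ_of_sigma_finite : metric_measure_space m -> VD m -> scale_function phi ->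
  regular_pure_jump_dirichlet_form m F E J ->
  J_phi m J phi -> Cap_phi_le m F E phi ->
  CSJ m F J phi.
Proof.
move=> mms vd /scale_function_bounds[K0 [q [K01 q01 phi_gt0 phi_mono phi_two]]] form.
move=> [c [C [c0 C0 hJ]]] [A1 [A2 [C1 [A11 A21 C11 hcap]]]].
have [CD CD1 dbl] := vd.
have [J_ge0 J_sym mJ _] : jump_kernel m J by case: form.
have vfin x r : (vol m x r < +oo)%E by exact: (vol_fin mms (CD := CD)).
pose V (x : T) r : R := fine (vol m x r).
have volE x r : vol m x r = (V x r)%:E by rewrite /V fineK// ge0_fin_numE.
have V_gt0 x r : 0 < r -> 0 < V x r.
  by move=> r0; rewrite -lte_fin -volE; exact: vol_gt0 mms x r r0.
have [pt pt_dense] := dense_sequence mms.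
(* One constant absorbs the scaling of [phi] and both kernel bounds. *)
pose K := K0 + C + c^-1.
have ci : 0 < c^-1 by rewrite invr_gt0.
have K1 : 1 <= K by rewrite /K; lra.
have K0K : K0 <= K by rewrite /K; lra.
have mdd := measurable_mdist mms.
have muV (x : T) r : 0 < r -> m [set y | mdist x y < r] = (V x r)%:E.
  by move=> _; rewrite -volE /vol ballEmdist.
have V_dbl x r : 0 < r -> V x (2 * r) <= CD * V x r.
  by move=> r0; rewrite -lee_fin EFinM -!volE; exact: dbl.
have phi_mono' r s : 0 < r -> r <= s -> phi r <= K * phi s.
  move=> r0 rs; apply: (le_trans (phi_mono r s r0 rs)); rewrite ler_wpM2r//.
  by apply/ltW/phi_gt0; lra.
have phi_dbl r : 0 < r -> phi (2 * r) <= K * phi r.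
  move=> r0; have [h _] := phi_two r r0; apply: (le_trans h).
  by rewrite ler_wpM2r// ltW// phi_gt0.
have [q0 q1] := andP q01.
have phi_geom r k : 0 < r -> phi r <= K * q ^+ k * phi (2 ^+ k * r).
  move=> r0; have [_ h] := phi_two r r0; apply: (le_trans (h k)).
  rewrite ler_wpM2r//; last by rewrite ler_wpM2r// exprn_ge0// ltW.
  by apply/ltW/phi_gt0; rewrite mulr_gt0// exprn_gt0.
have J_bounds (x y : X) : x <> y -> c <= J x y * (V x (mdist x y) * phi (mdist x y)) <= C.
  move=> xy; have d0 : 0 < mdist x y by rewrite mdist_gt0; exact/eqP.
  have vp : 0 < V x (mdist x y) * phi (mdist x y) by rewrite mulr_gt0 ?V_gt0 ?phi_gt0.
  have /andP[] := hJ x y xy; rewrite volE -EFinM inver gt_eqF// -!EFinM !lee_fin.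
  by rewrite ler_pdivrMr// ler_pdivlMr// => -> ->.
have J_lower (x y : X) : x <> y -> 1 <= K * (J x y * (V x (mdist x y) * phi (mdist x y))).
  move=> /J_bounds /andP[h _]; apply: (@le_trans _ _ (c^-1 * c)); first by rewrite mulVf ?gt_eqF.
  by apply: ler_pM => //; [exact: ltW|exact: ltW|rewrite /K; lra].
have J_upper (x y : X) : x <> y -> J x y * (V x (mdist x y) * phi (mdist x y)) <= K.
  by move=> /J_bounds /andP[_ h]; rewrite /K; lra.
(* 2^a dominates A1, for the supports of the cutoffs, and A2, so that r/(2L) < r/A2, which is at
   most diam/A2 when r is at most the diameter. *)
have [a aA1 aA2] : exists2 a, A1 <= 2 ^+ a :> R & A2 <= 2 ^+ a :> R.
  exists (Num.bound (A1 + A2)); apply: (@le_trans _ _ (Num.bound (A1 + A2))%:R).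
  - by apply: (@le_trans _ _ (A1 + A2)); [lra|apply/ltW/archi_boundP; lra].
  - by rewrite -natrX ler_nat ltnW// ltn_expl.
  - by apply: (@le_trans _ _ (A1 + A2)); [lra|apply/ltW/archi_boundP; lra].
  - by rewrite -natrX ler_nat ltnW// ltn_expl.
have A20 : 0 < A2 by lra.
pose capr (r : R) := (r%:E < diam X / A2%:E)%E.
have diamV : (diam X / A2%:E = diam X * (A2^-1)%:E)%E by rewrite inver gt_eqF.
have capr_of (r : R) : 0 < r -> (r%:E <= diam X)%E -> forall t, t < r / A2 -> capr t.
  move=> r0 rd t ht; rewrite /capr diamV; apply: (@lt_le_trans _ _ (r / A2)%:E).
    by rewrite lte_fin.
  by rewrite EFinM; apply: lee_wpmul2r => //; rewrite lee_fin invr_ge0 ltW.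
(* Two distinct points make the diameter positive. *)
have capr_small : exists2 r : R, 0 < r & forall s : R, s <= r -> capr s.
  case: mms => _ _ [x [y xy]] _ _.
  have d0 : 0 < mdist x y by rewrite mdist_gt0; exact/eqP.
  exists (mdist x y / (2 * A2)); first by rewrite divr_gt0 ?mulr_gt0.
  move=> s hs; apply: (capr_of (mdist x y) d0 (diam_ge x y)); apply: (le_lt_trans hs).
  by rewrite ltr_pM2l// ltf_pV2 ?posrE ?mulr_gt0//; lra.
have cap (x : T) r : 0 < r -> capr r -> exists psi : T -> R,
    [/\ F psi, forall y, 0 <= psi y <= 1, forall y, mdist x y < r -> psi y = 1,
      forall y, ~~ (mdist x y < 2 ^+ a * r) -> psi y = 0
    & (energy m J psi <= (C1 * (V x r / phi r))%:E)%E].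
  move=> r0 hr; have [psi [Fpsi [_ h1 h2 h3] h4]] := hcap x r r0 hr.
  exists psi; split => //.
  - by move=> y xy; apply: h2; rewrite ballEmdist.
  - move=> y xy; apply: h3; rewrite ballEmdist /= => h; move/negP: xy; apply.
    by apply: (lt_le_trans h); rewrite ler_wpM2r// ltW.
  - rewrite -(form_energy mms form Fpsi); apply: (le_trans h4).
    by rewrite volE inver gt_eqF ?phi_gt0// -!EFinM mulrA.
have C10 : 0 <= C1 by lra.
have Fen (f : T -> R) : F f -> (energy m J f < +oo)%E.
  by move=> Ff; rewrite -(form_energy mms form Ff) ltry.
have [Ca [Cb [Ca0 Cb0 main]]] := @cutoff_sobolev_uniform _ T R m (fun x y => mdist x y) V
  CD K q phi J (@mdistxx _ _) (@metric_sym _ _) (fun y x z => metric_triangle x y z)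
  (fun x y xy => ltac:(by rewrite mdist_gt0; exact/eqP)) mdd muV V_gt0 (ltW CD1) V_dbl
  phi_gt0 K1 phi_mono' phi_dbl q01 phi_geom J_ge0 J_sym mJ J_lower J_upper pt pt_dense
  F a C1 capr (F_measurableT form) Fen (F_zeroT form) (F_linearT form) (F_markovT form)
  (F_aeT form) (F_closedT mms form) C10 capr_small cap.
(* With a0 = 1 the ball is B(x, s + 2r), and U* exceeds U by r on either side. *)
exists 1, Ca, Cb; split => //.
move=> r s x f r0 rs Ff B U U'.
have mf := F_measurableT form Ff.
have [|psi [Fpsi h1 h2 h3 h4]] := main x r s f r0 rs mf (L2_fin (F_Lfun form Ff)) (Fen f Ff).
  (* If r exceeds the diameter, the whole space lies in B(x, s), as r <= s. *)
  have [rd|rd] := leP r%:E (diam X); [left|right].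
    move=> t ht; apply: (capr_of r r0 rd); apply: (le_lt_trans ht).
    rewrite ltr_pM2l// ltf_pV2 ?posrE ?mulr_gt0 ?exprn_gt0// exprD.
    have p7 : 1 <= 2 ^+ 7 :> R by rewrite exprn_ege1// ler1n.
    have : 2 ^+ a * 1 <= 2 ^+ a * 2 ^+ 7 :> R by rewrite ler_wpM2l// exprn_ge0.
    by lra.
  by move=> y; apply: lt_le_trans rs; rewrite -lte_fin; apply: le_lt_trans rd; exact: diam_ge.
have mpsi := F_measurableT form Fpsi.
exists psi; split => //.
  split => //.
  - by move=> y; rewrite ballEmdist; exact: h2.
  - by move=> y; rewrite ballEmdist /= => hy; apply: h3; apply/negP.
have BE : B = [set y | mdist x y < s + 2 * r] by rewrite /B ballEmdist (_ : 1 + 1 = 2)//; ring.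
have mlt rr : measurable_fun [set: T] (fun y : T => mdist x y < rr).
  apply: measurable_fun_ltr => //.
  exact: (@measurableT_comp _ _ _ _ _ _ _ _ (fun y : T => (x : T, y)) mdd (pair1_measurable _)).
rewrite BE (energy_measureE form mpsi mf (mlt _)); apply: (le_trans h4); apply: leeD.
  apply: lee_wpmul2l; first by rewrite lee_fin ltW.
  have UE : U = [set y | annulus (fun x y : T => mdist x y) x r s y].
    apply/seteqP; split => y; rewrite /U /annulus !ballEmdist /=.
      by move=> [h5 /negP]; rewrite -leNgt h5 => ->.
    by move=> /andP[h5 h6]; split => //; apply/negP; rewrite -leNgt.
  have U'E : U' = [set y | annulus' (fun x y : T => mdist x y) x r s y].
    rewrite /U' mul1r (_ : 1 + 1 = 2); last by ring.
    apply/seteqP; split => y; rewrite /annulus' !ballEmdist /=.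
      by move=> [h5 /negP]; rewrite -leNgt h5 => ->.
    by move=> /andP[h5 h6]; split => //; apply/negP; rewrite -leNgt.
  have mU : measurable (U : set T) by apply: measurableD; exact: measurable_ball_borel.
  have mU' : measurable (U' : set T) by apply: measurableD; exact: measurable_ball_borel.
  rewrite (jump_energyE mms form mf (measurableX mU mU')) [leRHS]integral_mkcond.
  rewrite le_eqVlt; apply/orP; left; apply/eqP; apply: eq_integral => -[y z] _.
  rewrite /patch; case: ifPn => /=.
    by rewrite inE => -[/=]; rewrite UE U'E /= => -> ->; rewrite !mul1r.
  rewrite notin_setE /= => h5; rewrite (_ : _ * _ = 0)//.
  have [h6|] := boolP (annulus _ _ _ _ y); last by rewrite !mul0r.
  have [h7|] := boolP (annulus' _ _ _ _ z); last by rewrite mulr0 mul0r.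
  by case: h5; split; rewrite ?UE ?U'E.
apply: lee_wpmul2l; first by rewrite lee_fin divr_ge0 ?ltW// phi_gt0.
rewrite [leRHS]integral_mkcond le_eqVlt; apply/orP; left; apply/eqP.
apply: eq_integral => y _; rewrite /patch; case: ifPn => /=.
  by rewrite inE /= => ->; rewrite mul1r.
by rewrite notin_setE /= => /negP /negbTE ->; rewrite mul0r.
Qed.

End SigmaFinite.

Theorem theorem1p6 (R : realType) (X : completeMetricType R)
    (m : {measure set (borel X) -> \bar R}) (phi : R -> R)
    (F : set (X -> R)) (E : (X -> R) -> (X -> R) -> R) (J : X -> X -> R) :
  metric_measure_space m -> VD m -> scale_function phi ->
  regular_pure_jump_dirichlet_form m F E J ->
  J_phi m J phi -> Cap_phi_le m F E phi ->
  CSJ m F J phi.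
Proof.
move=> mms vd; have [m' mE] := sigma_finite_pack (VD_sigma_finite mms vd).
move: mms vd; rewrite mE; exact: CSJ_of_sigma_finite.
Qed.
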